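(* Let $d\ge1$, $m\ge2$, and let $a\in C^m([0,\infty))$ satisfy $a_0\le a(t)\le a_1$ for all $t\ge0$ with constants $0<a_0\le a_1$. Let $\Theta,\Xi$ be positive monotone increasing functions on $[0,\infty)$ and let $\Lambda$ be a positive, continuous, strictly increasing function on $[0,\infty)$ with $\lim_{t\to\infty}\Lambda(t)=\infty$. Assume: - there is a constant $a_\infty>0$ with $\int_0^t|a(s)-a_\infty|\,ds\le\Theta(t)$ for all $t\ge0$; - there are constants $C_k>0$ with $|a^{(k)}(t)|\le C_k\,\Xi(t)^{-k}$ for all $t\ge0$, $k=1,\dots,m$; - $\Theta(t)/\Lambda(t)$ is monotone increasing and $\lim_{t\to\infty}\Theta(t)/\Lambda(t)=\infty$; - there is a constant $C_0>0$ with $\Lambda(t)\le C_0\,\Xi(t)$ for all $t\ge0$; - $\Xi^{-m}\in L^1([0,\infty))$ and $\displaystyle\sup_{t\ge0}\Big\{\Lambda(t)^m\,\Theta(t)^{-1}\int_t^\infty\Xi(s)^{-m}\,ds\Big\}<\infty$. Then there exist positive constants $N_0$ and $C$, independent of $t$, $\theta$ and of the initial data, such that for all $t\ge0$ and almost every $\theta\in\mathbb{T}^d$ $$\mathcal{E}(t,\theta)\le C\exp\Big(2|\xi(\theta)|\,\Theta\Big(\Lambda^{-1}\Big(\frac{N_0}{|\xi(\theta)|}\Big)\Big)\Big)\,\mathcal{E}(0,\theta).$$ Consequently, setting for $N>0$ $$U(N,u_0,u_1):=\int_{\mathbb{T}^d}\exp\Big(2|\xi(\theta)|\,\Theta\Big(\Lambda^{-1}\Big(\frac{N}{|\xi(\theta)|}\Big)\Big)\Big)\,\mathcal{E}(0,\theta)\,d\theta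 ,$$ the following hold. (i) If $U(N,u_0,u_1)<\infty$ for every $N\ge1$, then there exists a positive constant $N_0$ such that $E(t)\lesssim U(N_0,u_0,u_1)$ for all $t\ge0$. (ii) There exists a positive constant $N_0$ such that $E(t)\lesssim U(N_0,u_0,u_1)$ for all $t\ge0$ holds for every $(u_0,u_1)$ satisfying $U(N_0,u_0,u_1)<\infty$.
   Context: The problem is the semi-discrete wave equation on $\mathbb{Z}^d$ $$u''(t)[k]-a(t)^2\sum_{j=1}^d\big(u(t)[k+e_j]-2u(t)[k]+u(t)[k-e_j]\big)=0\quad(t\ge0,\ k\in\mathbb{Z}^d),\qquad u(0)=u_0,\ u'(0)=u_1,$$ with $u_0,u_1\in l^2(\mathbb{Z}^d)$, $\{e_j\}$ the standard basis of $\mathbb{R}^d$, and $u$ the solution with $u,u'$ continuous in $t$ with values in $l^2(\mathbb{Z}^d)$. With $D_j^+f[k]:=f[k+e_j]-f[k]$ the total energy is $$E(t):=\sum_{k}|u'(t)[k]|^2+a(t)^2\sum_{j=1}^d\sum_{k}|D_j^+u(t)[k]|^2 .$$ $\mathbb{T}:=[-\pi,\pi]$. For $f\in l^2(\mathbb{Z}^d)$, $\hat f(\theta):=\sum_{k\in\mathbb{Z}^d}e^{-\mathrm{i}k\cdot\theta}f[k]$, $\theta\in\mathbb{T}^d$. $\xi(\theta)=(\xi_1(\theta_1),\dots,\xi_d(\theta_d))$ with $\xi_j(\theta_j):=2\sin(\theta_j/2)$, and $|\cdot|$ is the Euclidean norm. $\hat u(t,\theta)$ is the transform of $u(t)$;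 it solves $\partial_t^2\hat u+a(t)^2|\xi(\theta)|^2\hat u=0$ with $\hat u(0,\theta)=\hat u_0(\theta)$, $\partial_t\hat u(0,\theta)=\hat u_1(\theta)$. The energy density is $$\mathcal{E}(t,\theta):=|\partial_t\hat u(t,\theta)|^2+a(t)^2|\xi(\theta)|^2|\hat u(t,\theta)|^2 .$$ $\Lambda^{-1}:[\Lambda(0),\infty)\to[0,\infty)$ is the inverse function of $\Lambda$; by convention $\Lambda^{-1}(r):=0$ for $0<r<\Lambda(0)$. $f\lesssim g$ means $f\le Cg$ with a positive constant $C$ (here independent of $t$). *)

(* Defs.v *)
From HB Require Import structures.
From mathcomp Require Import all_boot all_order all_algebra.
From mathcomp Require Import all_classical all_reals all_analysis.
From mathcomp Require Import complex.

Set Implicit Arguments.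
Unset Strict Implicit.
Unset Printing Implicit Defensive.

Import Order.TTheory GRing.Theory Num.Theory.
Import numFieldNormedType.Exports.
Import ComplexField.Normc.

Local Open Scope classical_set_scope.
Local Open Scope ring_scope.
Local Open Scope complex_scope.

(* The library has binary product measures and a product sigma-algebra on
   [d.-tuple R], but no [d]-fold product of sigma-finite measures: Lebesgue
   measure on R^d is obtained by iterating the binary product along
   [(x, y) |-> x :: y]; see [lebesgueT_box]. *)

Section tuple_measure.
Context {R : realType}.

Definition consT n (p : R * n.-tuple R) : n.+1.-tuple R :=
  [the n.+1.-tuple R of p.1 :: p.2].

Definition unconsT n (x : n.+1.-tuple R) : R * n.-tuple R :=
  (thead x, [tuple of behead x]).

Lemma consTK n : cancel (@consT n) (@unconsT n).
Proof.
case=> x y; rewrite /unconsT /consT /= theadE; congr (_, _).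
exact/val_inj.
Qed.

Lemma measurable_consT n : measurable_fun [set: R * n.-tuple R] (@consT n).
Proof. by apply: measurable_cons. Qed.

Lemma measurable_unconsT n : measurable_fun [set: n.+1.-tuple R] (@unconsT n).
Proof.
apply: measurable_fun_pair; last exact: measurable_behead.
exact: measurable_tnth.
Qed.

Section step.
Variables (n : nat) (m : {sigma_finite_measure set (n.-tuple R) -> \bar R}).

Definition lebesgue_step : set (n.+1.-tuple R) -> \bar R :=
  pushforward (lebesgue_measure \x m)%E (@consT n).

Let lebesgue_step0 : lebesgue_step set0 = 0%E.
Proof. by rewrite /lebesgue_step /pushforward preimage_set0 measure0. Qed.

Let lebesgue_step_ge0 A : (0 <= lebesgue_step A)%E.
Proof. by rewrite /lebesgue_step /pushforward; exact: measure_ge0. Qed.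

Let lebesgue_step_sigma_additive : semi_sigma_additive lebesgue_step.
Proof.
rewrite /lebesgue_step; apply: measure_semi_sigma_additive.
exact: measurable_consT.
Qed.

HB.instance Definition _ := isMeasure.Build _ _ _ lebesgue_step
  lebesgue_step0 lebesgue_step_ge0 lebesgue_step_sigma_additive.

Let lebesgue_step_sigma_finite : sigma_finite setT lebesgue_step.
Proof.
have /sigma_finiteP[F [TF ndF Foo]] := sigma_finiteT (@lebesgue_measure R).
have /sigma_finiteP[G [TG ndG Goo]] := sigma_finiteT m.
exists (fun i => @unconsT n @^-1` (F i `*` G i)).
  rewrite -preimage_bigcup [X in _ @^-1` X](_ : _ = setT) ?preimage_setT//.
  rewrite -subTset => -[x y] _.
  have [i _ Fi] : (\bigcup_i F i) x by rewrite -TF.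
  have [j _ Gj] : (\bigcup_i G i) y by rewrite -TG.
  exists (maxn i j) => //; split => /=.
  - by move: x Fi; exact/subsetPset/ndF/leq_maxl.
  - by move: y Gj; exact/subsetPset/ndG/leq_maxr.
move=> i; have [mF Fi] := Foo i; have [mG Gi] := Goo i; split.
  rewrite -[X in measurable X]setTI; apply: measurable_unconsT => //.
  exact: measurableX.
rewrite /lebesgue_step /pushforward -comp_preimage.
rewrite (_ : _ \o _ = id) ?preimage_id; last by apply/funext => p; exact: consTK.
by rewrite product_measure1E// lte_mul_pinfty// ge0_fin_numE.
Qed.

HB.instance Definition _ :=
  Measure_isSigmaFinite.Build _ _ _ lebesgue_step lebesgue_step_sigma_finite.
End step.

Section dirac0.
Definition dirac_nil : set (0.-tuple R) -> \bar R := \d_([tuple] : 0.-tuple R).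

HB.instance Definition _ := Measure.on dirac_nil.

Let dirac_nil_sigma_finite : sigma_finite setT dirac_nil.
Proof.
exists (fun=> setT); first by rewrite bigcup_const.
by move=> _; split=> //; rewrite /dirac_nil diracE ltry.
Qed.

HB.instance Definition _ :=
  Measure_isSigmaFinite.Build _ _ _ dirac_nil dirac_nil_sigma_finite.
End dirac0.

Fixpoint lebesgueT (d : nat) : {sigma_finite_measure set (d.-tuple R) -> \bar R} :=
  if d is n.+1 then lebesgue_step (lebesgueT n) else dirac_nil.

Lemma lebesgueT_box d (A : 'I_d -> set R) : (forall i, measurable (A i)) ->
  lebesgueT d [set x | forall i, A i (tnth x i)] =
  (\prod_(i < d) lebesgue_measure (A i))%E.
Proof.
elim: d A => [|d IH] A mA.
  rewrite big_ord0 /= /dirac_nil diracE mem_set//.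
  by case.
rewrite big_ord_recl /= /lebesgue_step /pushforward.
have mB : measurable [set y : d.-tuple R | forall i, A (lift ord0 i) (tnth y i)].
  rewrite (_ : mkset _ = \bigcap_(i in [set: 'I_d])
    ((fun y : d.-tuple R => tnth y i) @^-1` A (lift ord0 i))).
    apply: fin_bigcap_measurable => // i _.
    by rewrite -[X in measurable X]setTI; exact: measurable_tnth.
  by apply/seteqP; split => y /= Hy i; [move=> _; exact: Hy|exact: Hy].
rewrite (_ : _ @^-1` _ =
    A ord0 `*` [set y : d.-tuple R | forall i, A (lift ord0 i) (tnth y i)]).
  rewrite product_measure1E//; last exact: mA.
  by congr (_ * _)%E; exact: (IH (fun i => A (lift ord0 i)) (fun i => mA _)).
apply/seteqP; split => -[x y] /=.
  by move=> H; split => [|i]; [exact: (H ord0)|have := H (lift ord0 i); rewrite tnthS].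
move=> [Hx Hy] i; case: (unliftP ord0 i) => [j ->|->//].
by rewrite tnthS.
Qed.
End tuple_measure.

(* Functions of time live on [0, +oo[: their values at negative times are never
   used, and the derivative at [0] is the right derivative. *)

Section half_line.
Context {R : realType}.
Implicit Types (f : R -> R) (g : R -> R[i]) (t : R).

Definition hquot f t : R -> R := fun s => (f s - f t) / (s - t).

Definition hderivable f t := cvg (hquot f t @ within `[0, +oo[ t^').

Definition hderive f t : R := lim (hquot f t @ within `[0, +oo[ t^').

Definition is_Cm (m : nat) f :=
  (forall k t, (k < m)%N -> 0 <= t -> hderivable (iter k hderive f) t) /\
  {within `[0, +oo[, continuous (iter m hderive f)}.

Definition chderivable g t :=
  hderivable (fun s => complex.Re (g s)) t /\ hderivable (fun s => complex.Im (g s)) t.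

Definition chderive g t : R[i] :=
  hderive (fun s => complex.Re (g s)) t +i* hderive (fun s => complex.Im (g s)) t.

Definition is_inverse_at (Lam : R -> R) (r : R) : set R :=
  [set t | 0 <= t /\ Lam t = r].

(* For [Lam] continuous and strictly increasing to [+oo], the set chosen from is
   a singleton as soon as [Lam 0 <= r]. *)
Definition Linv (Lam : R -> R) (r : R) : R :=
  if r < Lam 0 then 0 else xget 0 (is_inverse_at Lam r).
End half_line.

Section lattice.
Context {R : realType} {d : nat}.
Implicit Types (f : 'rV[int]_d -> R[i]) (u : R -> 'rV[int]_d -> R[i]).

Definition sqnorm f : \bar R := \esum_(k in [set: 'rV[int]_d]) (normc (f k) ^+ 2)%:E.

Definition l2 f := (sqnorm f < +oo)%E.

Definition l2_continuous_at u (t : R) :=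
  sqnorm (fun k => u s k - u t k) @[s --> within `[0, +oo[ (nbhs t)] --> 0%E.

Definition e_ (j : 'I_d) : 'rV[int]_d := delta_mx 0 j.

Definition Dplus (j : 'I_d) f : 'rV[int]_d -> R[i] := fun k => f (k + e_ j) - f k.

Definition dt u : R -> 'rV[int]_d -> R[i] := fun t k => chderive (fun s => u s k) t.

(* Coordinatewise differentiability together with the continuity of [u] and
   [dt u] in l^2 makes [u] continuously differentiable with values in l^2. *)
Definition wave_solution (a : R -> R) (u0 u1 : 'rV[int]_d -> R[i]) u :=
  [/\ (forall t, 0 <= t -> l2 (u t) /\ l2 (dt u t)),
      (forall t, 0 <= t -> l2_continuous_at u t /\ l2_continuous_at (dt u) t),
      (forall t k, 0 <= t -> chderivable (fun s => u s k) t /\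
                             chderivable (fun s => dt u s k) t),
      (forall t k, 0 <= t ->
         dt (dt u) t k - (a t ^+ 2)%:C *
           \sum_(j < d) (u t (k + e_ j) - 2%:R * u t k + u t (k - e_ j)) = 0) &
      u 0 = u0 /\ dt u 0 = u1].

Definition energy (a : R -> R) u (t : R) : \bar R :=
  (sqnorm (dt u t) + (a t ^+ 2)%:E * \sum_(j < d) sqnorm (Dplus j (u t)))%E.
End lattice.

Section fourier.
Context {R : realType} {d : nat}.
Implicit Types (f : 'rV[int]_d -> R[i]) (g : d.-tuple R -> R[i]).

Definition torus : set (d.-tuple R) :=
  [set theta | forall j, tnth theta j \in `[- pi, pi]].

Definition expi (x : R) : R[i] := cos x +i* sin x.

Definition dotp (k : 'rV[int]_d) (theta : d.-tuple R) : R :=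
  \sum_(j < d) (k 0 j)%:~R * tnth theta j.

Definition box (n : nat) : set 'rV[int]_d :=
  [set k : 'rV[int]_d | forall j, `|k 0 j| <= n%:Z].

Definition fourier_sum f (n : nat) (theta : d.-tuple R) : R[i] :=
  \sum_(k \in box n) expi (- dotp k theta) * f k.

(* The series converges in L^2 of the torus, so the transform is defined up to
   null sets. *)
Definition is_fourier f g :=
  [/\ measurable_fun torus (fun theta => complex.Re (g theta)),
      measurable_fun torus (fun theta => complex.Im (g theta)) &
      (\int[lebesgueT d]_(theta in torus)
         (normc (fourier_sum f n theta - g theta) ^+ 2)%:E)%E @[n --> \oo] --> 0%E].

Definition fourier f : d.-tuple R -> R[i] := xget (fun=> 0) [set g | is_fourier f g].

Definition xi (theta : d.-tuple R) (j : 'I_d) : R := 2 * sin (tnth theta j / 2).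

Definition xi_norm (theta : d.-tuple R) : R :=
  Num.sqrt (\sum_(j < d) xi theta j ^+ 2).

(* Each [uh t] is only determined up to a null set; the second condition selects
   the families of representatives for which the pointwise time derivative
   entering [energy_density] makes sense. *)
Definition is_fourier_evolution (u : R -> 'rV[int]_d -> R[i])
    (uh : R -> d.-tuple R -> R[i]) :=
  (forall t, 0 <= t -> is_fourier (u t) (uh t)) /\
  {ae lebesgueT d, forall theta, torus theta ->
     forall t, 0 <= t -> chderivable (fun s => uh s theta) t}.

Definition mode_energy (a : R -> R) (t : R) (theta : d.-tuple R) (v w : R[i]) : R :=
  normc w ^+ 2 + a t ^+ 2 * xi_norm theta ^+ 2 * normc v ^+ 2.

Definition energy_density (a : R -> R) (uh : R -> d.-tuple R -> R[i])
    (t : R) (theta : d.-tuple R) : R :=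
  mode_energy a t theta (uh t theta) (chderive (fun s => uh s theta) t).

(* [x / 0 = 0] only concerns the null set of [theta] with [xi_norm theta = 0]. *)
Definition weight (Theta Lam : R -> R) (N : R) (theta : d.-tuple R) : R :=
  expR (2 * xi_norm theta * Theta (Linv Lam (N / xi_norm theta))).

Definition U (a Theta Lam : R -> R) (N : R) (u0 u1 : 'rV[int]_d -> R[i]) : \bar R :=
  (\int[lebesgueT d]_(theta in torus)
    (weight Theta Lam N theta *
     mode_energy a 0 theta (fourier u0 theta) (fourier u1 theta))%:E)%E.
End fourier.

Arguments torus {R} d.

(* Main.v *)
(* For fixed theta the transform solves y'' + a^2 x^2 y = 0 with x = |xi(theta)|.
   Up to the time Linv (N / x), compare with the constant coefficient ainf: the
   energy v^2 + ainf^2 x^2 y^2 grows at the relative rate O(x |a - ainf|), which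
   integrates to O(x Theta).  After that time, x Xi is large and an approximate
   solution lambda = al + i be of the Riccati equation
   lambda' + lambda^2 + a^2 x^2 = 0, namely the WKB expansion with m terms, has a
   residual O(x^2 (x Xi)^-m); the adapted energy ((v - al y)^2 + be^2 y^2) / be
   then grows at the relative rate O(x^(1-m) Xi^-m), whose integral is again
   O(x Theta (Linv (N / x))).  Since Theta / Lam increases, enlarging N to N0
   turns the constant in front of x Theta into 2.

   The transform is only defined up to null sets for each time, so the ODE is
   used for the truncated sums [fourier_sum (u t) n], which are
   differentiable in t for every theta and solve it up to a source term that comes from the
   boundary of the box and tends to 0 in L^2([0, T] x torus) as n tends to
   infinity.  Fatou's lemma then yields the energy estimate for almost every
   theta, and Parseval's identity turns it into the estimate of E(t). *)

Require Import Defs.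
From HB Require Import structures.
From mathcomp Require Import all_boot all_order all_algebra.
From mathcomp Require Import all_classical all_reals all_analysis.
From mathcomp Require Import measurable_realfun complex ring lra zify.
From mathcomp Require finmap.

Set Implicit Arguments.
Unset Strict Implicit.
Unset Printing Implicit Defensive.

Import Order.TTheory GRing.Theory Num.Theory.
Import numFieldNormedType.Exports.
Import ComplexField.Normc.

Local Open Scope classical_set_scope.
Local Open Scope ring_scope.

(** * Calculus on a half-line: continuity, derivatives, Gronwall's inequality, primitives *)

Section half_line_calculus.
Context {R : realType}.
Implicit Types (f g F G P r : R -> R) (s t T c x : R).

(** Because of the source term every energy inequality is proved with a right-hand side. Young's
    inequality with weight [(1 + T)^-1] separates the source from the energy: over [[0, T]] the
    energy grows by at most one more factor e per zone, whatever [T] is, and the integral of the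
    squared source is multiplied by a constant times [1 + T]. For fixed [T] that term disappears in
    the limit, which leaves constants independent of [T]. The threshold [N <= x * Lam s] does two
    things. Through [Lam <= C0 * Xi] it keeps [x * Xi] large from [s] on, so that the leading term
    [x * a] dominates in [be], which stays comparable with [x]. Through the tail condition it bounds
    x^(1-m) times the integral of Xi^-m over [[s, +oo[] by M x Theta(s) (x Lam(s))^-m <= M x
    Theta(s). This has the same form as the exponent obtained before that time, so the two exponents
    add up. Partial sums are compared with their limits through |z + w|^2 <= 2 |z|^2 + 2 |w|^2; the
    factors lost in this way enter [C] but never the exponent. *)

Definition hcont s f := {within `[s, +oo[, continuous f}.

(* [is_derive] is two-sided, hence only required at interior points. *)
Definition hder s f f' :=
  hcont s f /\ forall t, s < t -> is_derive t (1 : R) f (f' t).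

Lemma hcont_le s t f : s <= t -> hcont s f -> hcont t f.
Proof.
move=> st; apply: continuous_subspaceW => x /=.
by rewrite !in_itv/= !andbT; exact: le_trans.
Qed.

Lemma hder_le s t f f' : s <= t -> hder s f f' -> hder t f f'.
Proof.
move=> st [cf df]; split; first exact: hcont_le cf.
by move=> u tu; apply: df; exact: le_lt_trans tu.
Qed.

Lemma hcont_cst s c : hcont s (fun=> c).
Proof. by apply: continuous_subspaceT => x; exact: cst_continuous. Qed.

Lemma hcontD s f g : hcont s f -> hcont s g -> hcont s (fun t => f t + g t).
Proof. by move=> cf cg x; apply: cvgD; [exact: cf|exact: cg]. Qed.

Lemma hcontN s f : hcont s f -> hcont s (fun t => - f t).
Proof. by move=> cf x; apply: cvgN; exact: cf. Qed.

Lemma hcontB s f g : hcont s f -> hcont s g -> hcont s (fun t => f t - g t).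
Proof. by move=> cf cg; apply: hcontD => //; exact: hcontN. Qed.

Lemma hcontM s f g : hcont s f -> hcont s g -> hcont s (fun t => f t * g t).
Proof. by move=> cf cg x; apply: cvgM; [exact: cf|exact: cg]. Qed.

Lemma hcont_comp s f g : hcont s f -> continuous g -> hcont s (fun t => g (f t)).
Proof. by move=> cf cg x; apply: continuous_comp; [exact: cf|exact: cg]. Qed.

Lemma hcontP s f :
  hcont s f <-> forall x, s <= x -> f @ within `[s, +oo[ (nbhs x) --> f x.
Proof.
have e x : [set` `[s, +oo[] x = (s <= x) :> Prop by rewrite /= in_itv/= andbT.
by rewrite /hcont subspace_continuousP; split=> cf x; move: (cf x); rewrite e.
Qed.

Lemma hcontV s f : (forall t, s <= t -> f t != 0) -> hcont s f ->
  hcont s (fun t => (f t)^-1).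
Proof.
move=> f0 /hcontP cf; apply/hcontP => x sx.
by apply: cvgV; [exact: f0|exact: cf].
Qed.

Lemma hcontX s f n : hcont s f -> hcont s (fun t => f t ^+ n).
Proof.
by move=> cf; apply: (@hcont_comp _ _ (fun x : R => x ^+ n)) => //; exact: exprn_continuous.
Qed.

Lemma hcont_norm s f : hcont s f -> hcont s (fun t => `|f t|).
Proof.
by move=> cf; apply: (@hcont_comp _ _ (fun x : R => `|x|)) => //; exact: norm_continuous.
Qed.

Lemma hcont_sum (I : Type) (r : seq I) (p : pred I) s (f : I -> R -> R) :
  (forall i, hcont s (f i)) -> hcont s (fun t => \sum_(i <- r | p i) f i t).
Proof.
move=> cf; elim: r => [|i r IH].
  by under eq_fun do rewrite big_nil; exact: hcont_cst.
under eq_fun do rewrite big_cons.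
by case: (p i) => //; apply: hcontD.
Qed.

Lemma hder_cst s c : hder s (fun=> c) (fun=> 0).
Proof. by split; [exact: hcont_cst|move=> t _; exact: is_derive_cst]. Qed.

Lemma hder_id s : hder s id (fun=> 1).
Proof.
split; last by move=> t _; exact: is_derive_id.
by apply: continuous_subspaceT => x; exact: cvg_id.
Qed.

Lemma hder_eq s f f' g' : hder s f f' -> (forall t, s < t -> f' t = g' t) ->
  hder s f g'.
Proof. by move=> [cf df] e; split => // t st; rewrite -e//; exact: df. Qed.

Lemma hderD s f f' g g' : hder s f f' -> hder s g g' ->
  hder s (fun t => f t + g t) (fun t => f' t + g' t).
Proof.
move=> [cf df] [cg dg]; split; first exact: hcontD.
by move=> t st; apply: is_deriveD; [exact: df|exact: dg].
Qed.

Lemma hderN s f f' : hder s f f' -> hder s (fun t => - f t) (fun t => - f' t).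
Proof.
move=> [cf df]; split; first exact: hcontN.
by move=> t st; apply: is_deriveN; exact: df.
Qed.

Lemma hderB s f f' g g' : hder s f f' -> hder s g g' ->
  hder s (fun t => f t - g t) (fun t => f' t - g' t).
Proof. by move=> df dg; apply: hderD => //; exact: hderN. Qed.

Lemma hderM s f f' g g' : hder s f f' -> hder s g g' ->
  hder s (fun t => f t * g t) (fun t => f' t * g t + f t * g' t).
Proof.
move=> [cf df] [cg dg]; split; first exact: hcontM.
move=> t st; apply: is_derive_eq.
  by apply: is_deriveM; [exact: df|exact: dg].
by rewrite /GRing.scale/= addrC [g t * _]mulrC.
Qed.

Lemma hderZ s c f f' : hder s f f' -> hder s (fun t => c * f t) (fun t => c * f' t).
Proof.
move=> df; apply: (@hder_eq _ _ (fun t => 0 * f t + c * f' t)).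
  by apply: hderM => //; exact: hder_cst.
by move=> t _; rewrite mul0r add0r.
Qed.

Lemma hderX2 s f f' : hder s f f' -> hder s (fun t => f t ^+ 2) (fun t => 2 * f t * f' t).
Proof.
move=> df; under eq_fun do rewrite expr2.
by apply: hder_eq (hderM df df) _ => t _; ring.
Qed.

Lemma hderV s f f' : (forall t, s <= t -> f t != 0) -> hder s f f' ->
  hder s (fun t => (f t)^-1) (fun t => - f' t / f t ^+ 2).
Proof.
move=> f0 [cf df]; split; first exact: hcontV.
move=> t st; have dft := df _ st; have f0t := f0 _ (ltW st).
have dV : derivable (fun y => (f y)^-1) t 1 by apply: derivableV.
apply: DeriveDef => //; rewrite deriveV// derive_val.
by rewrite /GRing.scale/= mulNr mulNr mulrC.
Qed.

Lemma hder_sum (I : Type) (r : seq I) (p : pred I) s (f f' : I -> R -> R) :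
  (forall i, hder s (f i) (f' i)) ->
  hder s (fun t => \sum_(i <- r | p i) f i t) (fun t => \sum_(i <- r | p i) f' i t).
Proof.
move=> df; elim: r => [|i r IH].
  under eq_fun do rewrite big_nil.
  by apply: hder_eq (hder_cst _ _) _ => t _; rewrite big_nil.
under eq_fun do rewrite big_cons.
apply: (@hder_eq _ _ (fun t => if p i then f' i t + \sum_(j <- r | p j) f' j t
   else \sum_(j <- r | p j) f' j t)); last first.
  by move=> t _; rewrite big_cons.
by case: (p i) => //; apply: hderD.
Qed.

Lemma hder_expR s f f' : hder s f f' ->
  hder s (fun t => expR (f t)) (fun t => f' t * expR (f t)).
Proof.
move=> [cf df]; split; first by apply: hcont_comp => //; exact: continuous_expR.
move=> t st; have dft := df _ st.
by rewrite mulrC; exact: (@is_derive1_comp _ expR f t _ _ (is_derive_expR _) dft).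
Qed.

Lemma hder_le0 s T f f' : s <= T -> hder s f f' ->
  (forall t, s < t -> f' t <= 0) -> f T <= f s.
Proof.
rewrite le_eqVlt => /predU1P[->//|sT] [cf df] f0.
have [||c] := @MVT R f f' s T sT _ _.
- by move=> x; rewrite in_itv/= => /andP[sx _]; exact: df.
- apply: continuous_subspaceW cf => x /=; rewrite !in_itv/= andbT.
  by case/andP.
rewrite in_itv/= => /andP[sc cT] e.
by rewrite -subr_le0 e pmulr_lle0 ?f0// subr_gt0.
Qed.

(** The function F exp(G(s) - G) - P is nonincreasing: [G] increases, so the exponential is at most
    1 and the contribution of [r] is dominated by [P] without a weight. *)
Lemma gronwall s T F F' G g P r : s <= T -> hder s F F' -> hder s G g ->
  hder s P r -> (forall t, s < t -> 0 <= g t) -> (forall t, s < t -> 0 <= r t) ->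
  (forall t, s < t -> F' t <= g t * F t + r t) ->
  F T <= expR (G T - G s) * (F s + (P T - P s)).
Proof.
move=> sT dF dG dP g0 r0 ineq.
have G_ge t : s < t -> G s <= G t.
  move=> st; rewrite -lerN2.
  apply: (@hder_le0 s t (fun t => - G t) (fun t => - g t)); first exact: ltW.
    exact: hderN.
  by move=> u su; rewrite oppr_le0 g0.
have dE : hder s (fun t => expR (G s - G t)) (fun t => - g t * expR (G s - G t)).
  apply: hder_expR; apply: hder_eq (hderB (hder_cst _ (G s)) dG) _.
  by move=> t _; rewrite sub0r.
have := hder_le0 sT (hderB (hderM dF dE) dP).
rewrite subrr expR0 mulr1 => H.
have {H}h : F T * expR (G s - G T) - P T <= F s - P s.
  apply: H => t st; have := ineq t st; have := expR_ge0 (G s - G t).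
  have : expR (G s - G t) <= 1 by rewrite -expR0 ler_expR subr_le0 G_ge.
  have := r0 t st; move: (expR _) => e; nra.
have e0 : expR (G T - G s) * expR (G s - G T) = 1.
  by rewrite -expRD -expR0; congr expR; ring.
have h' : F T * expR (G s - G T) <= F s + (P T - P s) by lra.
have -> : F T = expR (G T - G s) * (F T * expR (G s - G T)).
  by rewrite mulrCA e0 mulr1.
by rewrite ler_pM2l// expR_gt0.
Qed.

(** Freezing [g] at the value [g s] on the left of [s] produces a function continuous on the whole
    line, to which two-sided results on integrals and measurability apply. *)
Lemma hcont_continuous s g : hcont s g -> continuous (fun x => g (Num.max s x)).
Proof.
move=> cg.
move=> x; have sx : s <= Num.max s x by rewrite le_max lexx.
apply: cvg_trans (iffLR (hcontP s g) cg _ sx).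
have cmax : Num.max s y @[y --> x] --> Num.max s x.
  by apply: (@continuous_max R R (fun=> s) id); [exact: cvg_cst|exact: cvg_id].
move=> U /= nU; have := cmax _ nU; rewrite /= !nbhs_simpl /=.
by apply: filterS => y /=; apply; rewrite in_itv/= andbT le_max lexx.
Qed.

Lemma hder_primitive s g : hcont s g ->
  hder s (fun t => \int[lebesgue_measure]_(x in `[s, t]) g x) g.
Proof.
move=> cg; pose h x := g (Num.max s x).
have ch : continuous h by exact: hcont_continuous.
have hg x : s <= x -> h x = g x by move=> sx; rewrite /h max_r.
have ih t : lebesgue_measure.-integrable `[s, t] (EFin \o h).
  apply: continuous_compact_integrable; first exact: segment_compact.
  exact: continuous_subspaceT.
have E t : \int[lebesgue_measure]_(x in `[s, t]) g x =
    \int[lebesgue_measure]_(x in `[s, t]) h x.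
  by apply: eq_Rintegral => x; rewrite inE/= in_itv/= => /andP[sx _]; rewrite hg.
under eq_fun do rewrite E.
split.
  apply/hcontP => x sx.
  (* The right end [x + 1] only makes the interval compact; near [x] the condition [y < x + 1] holds
     automatically. *)
  have sx1 : s <= x + 1 by rewrite ler_wpDr.
  have /subspace_continuousP/(_ x) := parameterized_integral_continuous sx1 (ih (x + 1)).
  rewrite /= in_itv/= sx/= lerDl ler01 => /(_ isT); apply: cvg_trans.
  apply: cvg_app => U /=; rewrite /within/= => nU.
  have : \forall y \near x, y < x + 1 by apply: lt_nbhsl; rewrite ltrDl.
  move=> yx.
  change (\forall y \near x, y \in `[s, x + 1] -> U y) in nU.
  change (\forall y \near x, y \in `[s, +oo[ -> U y).
  near=> y; rewrite in_itv/= andbT => sy.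
  have yx1 : y < x + 1 by near: y.
  by apply: (near nU y) => //; rewrite in_itv/= sy ltW.
move=> t st; have [d1 d2] := continuous_FTC1 (ltr_pwDr ltr01 (lexx t)) (ih (t + 1)) st (ch t).
apply: DeriveDef; first exact: d1.
by rewrite -derive1E d2 hg// ltW.
Unshelve. all: by end_near. Qed.

End half_line_calculus.

(** * Symbol classes: each derivative gains a factor 1 / Xi *)

Section symbols.
Context {R : realType}.
Variable Xi : R -> R.
Hypothesis Xi_gt0 : forall t, 0 <= t -> 0 < Xi t.
Implicit Types (f g : R -> R).

Definition decays j f := exists2 C : R, 0 <= C &
  forall t, 0 <= t -> `|f t| <= C * Xi t ^- j.

(** Symbols of order [- j] with [n] controlled derivatives, as in symbolic calculus with [Xi] as the
    scale. The derivative is quantified existentially, so that closure under sums, products and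
    inverses requires no formula for higher derivatives. *)
Fixpoint symbol n j f : Prop :=
  [/\ hcont 0 f, decays j f &
      if n is n'.+1 then exists2 f', hder 0 f f' & symbol n' j.+1 f' else True].

Lemma symbolE n j f : symbol n j f =
  [/\ hcont 0 f, decays j f &
      if n is n'.+1 then exists2 f', hder 0 f f' & symbol n' j.+1 f' else True].
Proof. by case: n. Qed.

Lemma symbol_decays n j f : symbol n j f -> decays j f.
Proof. by rewrite symbolE => -[]. Qed.

Lemma symbol_hcont n j f : symbol n j f -> hcont 0 f.
Proof. by rewrite symbolE => -[]. Qed.

Lemma symbol_weak n j f : symbol n.+1 j f -> symbol n j f.
Proof.
elim: n j f => [|n IH] j f; first by case.
by case=> cf bf [f' df sf']; split => //; exists f' => //; exact: IH.
Qed.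

Lemma symbolW n k j f : (k <= n)%N -> symbol n j f -> symbol k j f.
Proof.
move=> /subnKC <-; elim: (n - k)%N => [|i IH]; first by rewrite addn0.
by rewrite addnS => /symbol_weak.
Qed.

Lemma symbol0 n j : symbol n j (fun=> 0).
Proof.
elim: n j => [|n IH] j; (split; [exact: hcont_cst|
  exists 0 => // t t0; by rewrite mul0r normr0|]) => //.
by exists (fun=> 0) => //; exact: hder_cst.
Qed.

Lemma symbol_cst n c : symbol n 0 (fun=> c).
Proof.
have b : decays 0 (fun=> c).
  by exists `|c| => // t t0; rewrite expr0 invr1 mulr1.
by case: n => [|n]; split => //; [exact: hcont_cst|exact: hcont_cst|];
  exists (fun=> 0); [exact: hder_cst|exact: symbol0].
Qed.

Lemma decaysD j f g : decays j f -> decays j g -> decays j (fun t => f t + g t).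
Proof.
move=> [C C0 bf] [D D0 bg]; exists (C + D); first exact: addr_ge0.
by move=> t t0; rewrite (le_trans (ler_normD _ _))// mulrDl lerD ?bf ?bg.
Qed.

Lemma decaysM j k f g : decays j f -> decays k g ->
  decays (j + k) (fun t => f t * g t).
Proof.
move=> [C C0 bf] [D D0 bg]; exists (C * D); first exact: mulr_ge0.
by move=> t t0; rewrite normrM exprD invfM mulrACA ler_pM ?bf ?bg.
Qed.

Lemma symbolD n j f g : symbol n j f -> symbol n j g ->
  symbol n j (fun t => f t + g t).
Proof.
elim: n j f g => [|n IH] j f g [cf bf df] [cg bg dg];
  (split; [exact: hcontD|exact: decaysD|]) => //.
case: df dg => f' df sf' [g' dg sg'].
by exists (fun t => f' t + g' t); [exact: hderD|exact: IH].
Qed.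

Lemma symbolM n j k f g : symbol n j f -> symbol n k g ->
  symbol n (j + k) (fun t => f t * g t).
Proof.
elim: n j k f g => [|n IH] j k f g [cf bf df] [cg bg dg];
  (split; [exact: hcontM|exact: decaysM|]) => //.
case: (df) (dg) => f' df' sf' [g' dg' sg'].
exists (fun t => f' t * g t + f t * g' t); first exact: hderM.
apply: symbolD; first by rewrite -addSn; apply: IH => //; apply: symbol_weak.
by rewrite -addnS; apply: IH => //; apply: symbol_weak.
Qed.

Lemma symbolN n j f : symbol n j f -> symbol n j (fun t => - f t).
Proof.
move=> sf; under eq_fun do rewrite -mulN1r.
exact: (symbolM (symbol_cst n (-1)) sf).
Qed.

Lemma symbol_sum n j k (F : 'I_k -> R -> R) : (forall i, symbol n j (F i)) ->
  symbol n j (fun t => \sum_(i < k) F i t).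
Proof.
elim: k F => [|k IH] F sF.
  by under eq_fun do rewrite big_ord0; exact: symbol0.
by under eq_fun do rewrite big_ord_recr/=; apply: symbolD => //; apply: IH.
Qed.

(** Induction on [n]: the derivative of 1 / f is - f' (1 / f)^2, where 1 / f is needed with one
    derivative fewer. The lower bound [c] makes 1 / f bounded. *)
Lemma symbolV n f (c : R) : 0 < c -> (forall t, 0 <= t -> c <= f t) ->
  symbol n 0 f -> symbol n 0 (fun t => (f t)^-1).
Proof.
move=> c0 fc; have f0 t : 0 <= t -> 0 < f t by move=> /fc; exact: lt_le_trans.
have fn0 t : 0 <= t -> f t != 0 by move=> /f0; rewrite lt0r => /andP[].
have b : decays 0 (fun t => (f t)^-1).
  exists c^-1; first by rewrite invr_ge0 ltW.
  move=> t t0; have ft0 := f0 _ t0.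
  rewrite expr0 invr1 mulr1 ger0_norm; last by rewrite invr_ge0 ltW.
  by rewrite lef_pV2 ?posrE// fc.
elim: n => [|n IH] sf; have cf := symbol_hcont sf.
  by split => //; exact: hcontV.
split => //; first exact: hcontV.
case: (sf) => _ _ [f' df sf'].
exists (fun t => - f' t / f t ^+ 2); first exact: hderV.
have sV := IH (symbol_weak sf).
rewrite -[1%N]/(1 + (0 + 0))%N.
under eq_fun do rewrite expr2 invfM.
by apply: symbolM; [exact: symbolN|exact: symbolM].
Qed.

End symbols.

(** * Coefficients of the WKB expansion *)

Section WKB_coefficients.
Context {R : realType}.
Variables (Xi a : R -> R) (m : nat) (a0 : R).
Hypothesis Xi_gt0 : forall t, 0 <= t -> 0 < Xi t.
Hypothesis a0_gt0 : 0 < a0.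
Hypothesis a_ge : forall t, 0 <= t -> a0 <= a t.
Hypothesis a_symbol : symbol Xi m 0 a.

(* [\sum_i nu_i (- i / x)^i] multiplied by [i x] is the WKB expansion; the
   recursion cancels the powers of [x] in the Riccati equation one by one. *)
Lemma exists_WKB k : (k < m)%N ->
  exists nu nu' : nat -> R -> R,
  [/\ nu 0%N = a,
      forall i, (i <= k)%N ->
        [/\ symbol Xi (m - i) i (nu i), hder 0 (nu i) (nu' i) &
            symbol Xi (m - i.+1) i.+1 (nu' i)] &
      forall i t, (i < k)%N -> 0 <= t ->
        nu' i t + \sum_(j < i.+2) nu j t * nu (i.+1 - j)%N t = 0].
Proof.
elim: k => [|k IH] km.
  have [a' da sa'] : exists2 f', hder 0 a f' & symbol Xi m.-1 1 f'.
    by move: a_symbol; rewrite symbolE; case: m km => // n _ [].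
  exists (fun=> a), (fun=> a'); split => // i.
  by rewrite leqn0 => /eqP ->; rewrite subn0 subn1.
have [nu [nu' [nu0 Hs Hr]]] := IH (ltnW km).
(* The relation of index [k] is affine in the new coefficient, which occurs at both ends of the sum,
   each time multiplied by [nu 0 = a]; hence the division by [2 * a t], which is at least
   [2 * a0]. *)
pose f t := - (nu' k t + \sum_(j < k) nu j.+1 t * nu (k - j)%N t) / (2 * a t).
have sf : symbol Xi (m - k.+1) k.+1 f.
  have [_ _ sk'] := Hs k (leqnn k).
  have sV : symbol Xi (m - k.+1) 0 (fun t => (2 * a t)^-1).
    apply: (@symbolV _ Xi _ _ (2 * a0)); first by rewrite mulr_gt0.
      by move=> t t0; rewrite ler_pM2l ?a_ge.
    apply: (symbolM (symbol_cst _ _ 2)).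
    by apply: symbolW a_symbol; exact: leq_subr.
  rewrite -[X in symbol _ _ X]addn0; apply: symbolM; last exact: sV.
  apply: symbolN; apply: symbolD => //; apply: symbol_sum => j.
  rewrite [X in symbol _ _ X](_ : k.+1 = (j.+1 + (k - j))%N);
    last by rewrite addSn subnKC// ltnW.
  have jk := ltn_ord j.
  apply: symbolM.
    have [s _ _] := Hs j.+1 jk; apply: symbolW s.
    by rewrite leq_sub2l// ltnS ltnW.
  have [s _ _] := Hs (k - j)%N (leq_subr _ _); apply: symbolW s.
  by rewrite leq_sub2l// (leq_trans (leq_subr _ _)).
(* Each coefficient uses up one derivative of [a]; since [k.+1 < m], at least one is left and [f] is
   differentiable. *)
have [f' df sf'] : exists2 f', hder 0 f f' & symbol Xi (m - k.+2) k.+2 f'.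
  by move: sf; rewrite symbolE -(subnSK km) => -[].
exists (fun i => if i == k.+1 then f else nu i),
       (fun i => if i == k.+1 then f' else nu' i); split => //.
  move=> i; rewrite leq_eqVlt => /predU1P[->|ik]; first by rewrite eqxx.
  by rewrite ltn_eqF//; apply: Hs.
move=> i t; rewrite ltnS leq_eqVlt => /predU1P[->|ik] t0.
  rewrite big_ord_recl big_ord_recr/= subn0 !eqxx /bump/= !add1n subnn/=.
  rewrite ltn_eqF// nu0.
  under eq_bigr => j _.
    rewrite eqSS ltn_eqF// ifF; last first.
      by rewrite subSS ltn_eqF// ltnS leq_subr.
    rewrite subSS; over.
  rewrite /f; set s := \sum_(_ < _) _.
  have at0 : a t != 0 by rewrite gt_eqF// (lt_le_trans a0_gt0)// a_ge.
  by field.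
rewrite ltn_eqF; last by rewrite (leq_trans ik).
rewrite -[RHS](Hr i t ik t0); congr (_ + _); apply: eq_bigr => j _.
rewrite ltn_eqF; last by rewrite (leq_ltn_trans (leq_ord j))// ltnS.
by rewrite ltn_eqF// (leq_ltn_trans (leq_subr _ _))// ltnS.
Qed.

End WKB_coefficients.

(** * Approximate solutions of the Riccati equation *)

Section riccati.
Context {R : realType}.
Variables (Xi a : R -> R) (m : nat) (a0 a1 : R).
Hypothesis Xi_gt0 : forall t : R, 0 <= t -> 0 < Xi t.
Hypothesis a0_gt0 : 0 < a0.
Hypothesis a_bnd : forall t : R, 0 <= t -> a0 <= a t <= a1.
Hypothesis a_symbol : symbol Xi m 0 a.
Hypothesis m_gt0 : (0 < m)%N.

Lemma decays_uniform (F : nat -> R -> R) M : (forall n, decays Xi n (F n)) ->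
  exists2 C : R, 0 <= C & forall n t, (n < M)%N -> 0 <= t -> `|F n t| <= C * Xi t ^- n.
Proof.
move=> dF; elim: M => [|M [C C0 HC]]; first by exists 0.
have [D D0 HD] := dF M; exists (C + D); first exact: addr_ge0.
move=> n t; rewrite ltnS leq_eqVlt => nM t0.
have X0 : 0 <= Xi t ^- n by rewrite invr_ge0 exprn_ge0// ltW// Xi_gt0.
case/predU1P: nM => [nM|nM]; rewrite mulrDl.
  by rewrite nM in X0 *; rewrite (le_trans (HD _ t0))// lerDr mulr_ge0.
by rewrite (le_trans (HC _ _ nM t0))// lerDl mulr_ge0.
Qed.

Lemma complex_Re_sum n (r : 'I_n -> R) (w : 'I_n -> R[i]) :
  complex.Re (\sum_(k < n) (r k)%:C%C * w k) = \sum_(k < n) complex.Re (w k) * r k.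
Proof.
rewrite raddf_sum; apply: eq_bigr => k _.
by case: (w k) => u v /=; rewrite mul0r subr0 mulrC.
Qed.

Lemma complex_Im_sum n (r : 'I_n -> R) (w : 'I_n -> R[i]) :
  complex.Im (\sum_(k < n) (r k)%:C%C * w k) = \sum_(k < n) complex.Im (w k) * r k.
Proof.
rewrite raddf_sum; apply: eq_bigr => k _.
by case: (w k) => u v /=; rewrite mul0r addr0 mulrC.
Qed.

(** This is - i / x, the inverse of i x. *)
Definition wkb_c (x : R) : R[i] := (0 +i* - x^-1)%C.

Lemma wkb_cX_bound x n : 0 < x ->
  `|complex.Re (wkb_c x ^+ n)| <= x ^- n /\ `|complex.Im (wkb_c x ^+ n)| <= x ^- n.
Proof.
move=> x0; elim: n => [|n].
  by rewrite !expr0 invr1 /= normr1 normr0.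
rewrite !exprS; case: (wkb_c x ^+ n) => u v /= [Hu Hv].
rewrite !mul0r sub0r add0r mulNr opprK mulNr normrN !normrM.
have xV0 : 0 <= x^-1 by rewrite invr_ge0 ltW.
by rewrite (ger0_norm xV0) invfM !ler_pM2l ?invr_gt0.
Qed.

(* The last two bounds are those of the real and imaginary parts of
   [lambda' + lambda^2 + a^2 x^2] with [lambda = al + i be]. *)
Lemma exists_riccati : exists K B : R, [/\ 1 <= K, 0 < B &
  forall x : R, 0 < x -> exists al be al' be' : R -> R,
  [/\ [/\ hder 0 al al', hder 0 be be', hcont 0 al' & hcont 0 be'] &
   forall t, 0 <= t -> K <= x * Xi t ->
   [/\ `|al t| <= x * B, x * (a0 / 2) <= be t <= x * B,
       `|al' t + al t ^+ 2 - be t ^+ 2 + a t ^+ 2 * x ^+ 2| <= B * x ^+ 2 * (x * Xi t) ^- m &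
       `|be' t + 2 * al t * be t| <= B * x ^+ 2 * (x * Xi t) ^- m]]].
Proof.
have m1m : (m.-1 < m)%N by rewrite prednK.
have a_ge t : 0 <= t -> a0 <= a t by move=> /a_bnd/andP[].
have [nu [nu' [nu0 Hs Hr]]] := exists_WKB a0_gt0 a_ge a_symbol m1m.
have {}Hs i : (i < m)%N -> [/\ symbol Xi (m - i) i (nu i), hder 0 (nu i) (nu' i) &
            symbol Xi (m - i.+1) i.+1 (nu' i)].
  by move=> im; apply: Hs; rewrite -ltnS prednK.
have {}Hr i t : (i.+1 < m)%N -> 0 <= t ->
    nu' i t + \sum_(j < i.+2) nu j t * nu (i.+1 - j)%N t = 0.
  by move=> im; apply: Hr; rewrite -ltnS prednK.
(* These are polynomials in a variable that stands for - i / x. The approximate solution lambda is i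
   x times the value of [p]; since i x = - x^2 (- i / x), the residual of the Riccati equation is -
   x^2 times the value of [P]. The recursion says that the coefficients of [P] below index [m]
   vanish. *)
pose p t : {poly R} := \poly_(i < m) nu i t.
pose p' t : {poly R} := \poly_(i < m) nu' i t.
pose P t : {poly R} := 'X * p' t + p t * p t - (a t ^+ 2)%:P.
have dz j : decays Xi j (fun=> 0) by exact: (symbol_decays (symbol0 Xi 0 j)).
have dnu i : decays Xi i (fun t => (p t)`_i).
  under eq_fun do rewrite coef_poly.
  by case: (ltnP i m) => im //; have [s _ _] := Hs i im; exact: symbol_decays s.
have dnu' i : decays Xi i.+1 (fun t => (p' t)`_i).
  under eq_fun do rewrite coef_poly.
  by case: (ltnP i m) => im //; have [_ _ s] := Hs i im; exact: symbol_decays s.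
have dsum j k (F : 'I_k -> R -> R) : (forall i, decays Xi j (F i)) ->
    decays Xi j (fun t => \sum_(i < k) F i t).
  elim: k F => [|k IH] F dF; first by under eq_fun do rewrite big_ord0.
  by under eq_fun do rewrite big_ord_recr/=; apply: decaysD => //; apply: IH.
have dP n : (0 < n)%N -> decays Xi n (fun t => (P t)`_n).
  case: n => // n _; under eq_fun do rewrite coefB coefD coefXM coefC/= subr0 coefM.
  apply: decaysD; first exact: dnu'.
  apply: dsum => i; rewrite [X in decays _ X _](_ : n.+1 = (i + (n.+1 - i))%N); first exact: decaysM.
  by rewrite subnKC// -ltnS.
have P0 n t : 0 <= t -> (n < m)%N -> (P t)`_n = 0.
  move=> t0; case: n => [|n] nm; rewrite !coefE/= ?coefM.
    by rewrite big_ord1/= coef_poly m_gt0 nu0 add0r subrr.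
  rewrite (ltnW nm) subr0 -[RHS](Hr n t nm t0); congr (_ + _).
  apply: eq_bigr => j _; rewrite !coef_poly.
  by rewrite (leq_ltn_trans (leq_ord j))// (leq_ltn_trans (leq_subr _ _)).
have sP t : (size (P t) <= m.*2.+1)%N.
  have sp : (size (p t) <= m)%N by exact: size_poly.
  have sp' : (size (p' t) <= m)%N by exact: size_poly.
  rewrite (leq_trans (size_polyD _ _))// geq_max; apply/andP; split; last first.
    by rewrite size_polyN (leq_trans (size_polyC_leq1 _)).
  rewrite (leq_trans (size_polyD _ _))// geq_max; apply/andP; split.
    rewrite (leq_trans (size_polyMleq _ _))// size_polyX/= -addnn.
    by rewrite ltnS (leq_trans sp')// leq_addr.
  rewrite (leq_trans (size_polyMleq _ _))// -addnn.
  by rewrite (leq_trans (leq_pred _))// leqW// leq_add.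
have [C1 C10 HC1] := decays_uniform m dnu.
(* The factor [0 < n] discards the constant coefficient, which vanishes at nonnegative times by
   [P0]; a single decay statement then covers all indices. *)
have {}dP n : decays Xi n (fun t => (P t)`_n *+ (0 < n)%N).
  by case: n => [|n]; [under eq_fun do rewrite mulr0n; exact: dz|exact: dP].
have [C2 C20 HC2] := decays_uniform m.*2.+1 dP.
(* If z = x Xi(t) is at least the first constant, the terms of positive index in [be] add up to at
   most x m C1 / z <= x a0 / 2, half the lower bound of the leading term [x * a t]. The second
   constant exceeds both [m%:R * C1], which controls [al / x] and [be / x], and [m.*2.+1%:R * C2],
   which controls the residual. *)
exists (1 + 2 * m%:R * C1 / a0), (a1 + m%:R * C1 + 1 + m.*2.+1%:R * C2).
split.
- by rewrite lerDl !mulr_ge0// invr_ge0 ltW.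
- have /andP[h1 h2] := a_bnd (lexx 0).
  rewrite ltr_pwDl ?mulr_ge0// ltr_wpDl ?ltr01// addr_ge0 ?mulr_ge0//.
  by rewrite (le_trans _ h2)// (le_trans _ h1)// ltW.
move=> x x0.
pose w k : R[i] := (0 +i* x)%C * wkb_c x ^+ k.
exists (fun t => \sum_(k < m) complex.Re (w k) * nu k t),
  (fun t => \sum_(k < m) complex.Im (w k) * nu k t),
  (fun t => \sum_(k < m) complex.Re (w k) * nu' k t),
  (fun t => \sum_(k < m) complex.Im (w k) * nu' k t); split.
  split.
  + apply: hder_sum => k; apply: hderZ.
    by have [] := Hs k (ltn_ord k).
  + apply: hder_sum => k; apply: hderZ.
    by have [] := Hs k (ltn_ord k).
  + apply: hcont_sum => k; apply: hcontM; first exact: hcont_cst.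
    by have [_ _ s] := Hs k (ltn_ord k); exact: symbol_hcont s.
  + apply: hcont_sum => k; apply: hcontM; first exact: hcont_cst.
    by have [_ _ s] := Hs k (ltn_ord k); exact: symbol_hcont s.
move=> t t0 Kx.
have wB k : `|complex.Re (w k)| <= x * x ^- k /\ `|complex.Im (w k)| <= x * x ^- k.
  have [u v] := wkb_cX_bound k x0; rewrite /w.
  case: (wkb_c x ^+ k) u v => u v /= Hu Hv.
  by rewrite !mul0r sub0r add0r normrN !normrM (ger0_norm (ltW x0)) !ler_pM2l.
pose z := x * Xi t; rewrite -/z in Kx *.
have z1 : 1 <= z.
  by rewrite (le_trans _ Kx)// lerDl !mulr_ge0// invr_ge0 ltW.
have HCz k : (k < m)%N -> `|nu k t| * x ^- k <= C1 * z ^- k.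
  move=> km; have := HC1 k t km t0; rewrite coef_poly km => h.
  have -> : C1 * z ^- k = (C1 * Xi t ^- k) * x ^- k by rewrite /z exprMn invfM; ring.
  by rewrite ler_wpM2r// invr_ge0 exprn_ge0// ltW.
have zV k : (0 < k)%N -> z ^- k <= z^-1.
  move=> k0; rewrite lef_pV2 ?posrE ?exprn_gt0 ?(lt_le_trans ltr01)//.
  by rewrite -[leLHS]expr1 ler_weXn2l.
have z0 : 0 < z by exact: lt_le_trans z1.
have zV1 k : z ^- k <= 1.
  by rewrite -invr1 lef_pV2 ?posrE ?exprn_gt0// exprn_ege1.
have BC1 : m%:R * C1 <= a1 + m%:R * C1 + 1 + m.*2.+1%:R * C2.
  have := a_bnd t0; have : 0 <= m.*2.+1%:R * C2 by rewrite mulr_ge0.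
  by move: (_ * C2) => u; move: (m%:R * C1) => v; move: a0_gt0; lra.
have BC2 : m.*2.+1%:R * C2 <= a1 + m%:R * C1 + 1 + m.*2.+1%:R * C2.
  have := a_bnd t0; have : 0 <= m%:R * C1 by rewrite mulr_ge0.
  by move: (_ * C2) => u; move: (m%:R * C1) => v; move: a0_gt0; lra.
set B := (X in _ <= x * X); rewrite -/B in BC1 BC2.
have sumB (A : 'I_m -> R) : (forall k, `|A k| <= x * x ^- k) ->
    `|\sum_(k < m) A k * nu k t| <= x * (m%:R * C1).
  move=> HA; rewrite (le_trans (ler_norm_sum _ _ _))//.
  have -> : x * (m%:R * C1) = \sum_(k < m) x * C1.
    by rewrite sumr_const card_ord -mulr_natl; ring.
  apply: ler_sum => k _; rewrite normrM.
  apply: (@le_trans _ _ (x * x ^- k * `|nu k t|)); first by rewrite ler_wpM2r.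
  rewrite -mulrA ler_pM2l// mulrC (le_trans (HCz _ _))// -[leRHS]mulr1.
  by rewrite ler_wpM2l.
have al_bnd := sumB (fun k => complex.Re (w k)) (fun k => (wB k).1).
have be_bnd : `|\sum_(k < m) complex.Im (w k) * nu k t - x * a t| <= x * (a0 / 2).
  have w0 : complex.Im (w (Ordinal m_gt0)) * nu (Ordinal m_gt0) t = x * a t.
    by rewrite [Ordinal _ : nat]/= nu0 /w expr0 mulr1.
  rewrite (bigD1 (Ordinal m_gt0))// w0 addrAC subrr add0r (le_trans (ler_norm_sum _ _ _))//.
  apply: (@le_trans _ _ (\sum_(k < m) x * (C1 * z^-1))).
    rewrite big_mkcond/=; apply: ler_sum => k _.
    case: ifPn => [k0|_]; last by rewrite !mulr_ge0// ?invr_ge0 ltW.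
    rewrite normrM; apply: (@le_trans _ _ (x * x ^- k * `|nu k t|)).
      by rewrite ler_wpM2r//; exact: (wB k).2.
    rewrite -mulrA ler_pM2l// mulrC (le_trans (HCz _ _))// ler_wpM2l// zV//.
    by rewrite lt0n; apply: contra k0 => /eqP e; apply/eqP/val_inj.
  rewrite sumr_const card_ord.
  rewrite (_ : _ *+ m = x * (m%:R * C1 / z)); last by rewrite -mulr_natl; ring.
  rewrite ler_pM2l// ler_pdivrMr//.
  have : a0 / 2 * (1 + 2 * m%:R * C1 / a0) <= a0 / 2 * z.
    by rewrite ler_pM2l// divr_gt0.
  apply: le_trans; rewrite [leRHS](_ : _ = a0 / 2 + m%:R * C1).
    by rewrite lerDr divr_ge0// ltW.
  by field; rewrite gt_eqF.
pose f : {poly R} -> {poly R[i]} := map_poly (real_complex R).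
pose c := wkb_c x.
have evalE (q : {poly R}) n : (size q <= n)%N ->
    (f q).[c] = \sum_(k < n) (q`_k)%:C%C * c ^+ k.
  move=> sq; rewrite (@horner_coef_wide _ n); last by rewrite size_map_poly.
  by apply: eq_bigr => k _; rewrite coef_map.
have sumwE (F : nat -> R) : \sum_(k < m) (F k)%:C%C * w k =
    (0 +i* x)%C * (f (\poly_(k < m) F k)).[c].
  rewrite (evalE _ m) ?size_poly// big_distrr/=; apply: eq_bigr => k _.
  by rewrite coef_poly ltn_ord /w mulrCA.
have ixc : (0 +i* x)%C = (- x ^+ 2)%:C%C * c.
  rewrite /c /wkb_c; congr (_ +i* _)%C; rewrite !(mul0r, mulr0, addr0, subr0)//.
  by field; rewrite gt_eqF.
have E : \sum_(k < m) (nu' k t)%:C%C * w k + (\sum_(k < m) (nu k t)%:C%C * w k) ^+ 2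
    + (a t ^+ 2 * x ^+ 2)%:C%C =
    \sum_(n < m.*2.+1) (- x ^+ 2 * (P t)`_n)%:C%C * c ^+ n.
  have -> : \sum_(n < m.*2.+1) (- x ^+ 2 * (P t)`_n)%:C%C * c ^+ n =
      (- x ^+ 2)%:C%C * (f (P t)).[c].
    rewrite (evalE _ m.*2.+1)// big_distrr/=; apply: eq_bigr => n _.
    by rewrite rmorphM mulrA.
  rewrite (sumwE (nu'^~ t)) (sumwE (nu^~ t)) -/(p t) -/(p' t) /P.
  rewrite /f rmorphB rmorphD !rmorphM/= map_polyX map_polyC/= -/f.
  rewrite !(hornerD, hornerN, hornerM, hornerX, hornerC)/=.
  have ex : (- x ^+ 2)%:C%C = - (x%:C%C * x%:C%C) :> R[i].
    by rewrite -rmorphM -rmorphN expr2.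
  have e2 : (0 +i* x)%C ^+ 2 = - (x%:C%C * x%:C%C) :> R[i].
    by rewrite -ex expr2; congr (_ +i* _)%C; ring.
  by rewrite exprMn e2 ixc ex; ring.
have zm0 : 0 <= z ^- m by rewrite invr_ge0 exprn_ge0// ltW.
have resB (A : nat -> R) : (forall n, `|A n| <= x ^- n) ->
    `|\sum_(n < m.*2.+1) A n * (- x ^+ 2 * (P t)`_n)| <= m.*2.+1%:R * C2 * x ^+ 2 * z ^- m.
  move=> HA; rewrite (le_trans (ler_norm_sum _ _ _))//.
  have -> : m.*2.+1%:R * C2 * x ^+ 2 * z ^- m = \sum_(n < m.*2.+1) x ^+ 2 * (C2 * z ^- m).
    by rewrite sumr_const card_ord -mulr_natl; ring.
  apply: ler_sum => n _; have [nm|mn] := ltnP n m.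
    by rewrite P0// !mulr0 normr0 mulr_ge0 ?sqr_ge0// mulr_ge0.
  rewrite mulrC !normrM normrN (ger0_norm (sqr_ge0 _)) -mulrA ler_pM2l ?exprn_gt0//.
  have n0 : (0 < n)%N by exact: leq_trans mn.
  have := HC2 n t (ltn_ord n) t0; rewrite n0 mulr1n => h.
  apply: (@le_trans _ _ (C2 * Xi t ^- n * x ^- n)); first exact: ler_pM.
  rewrite -mulrA ler_wpM2l// -invfM -exprMn mulrC -/z.
  by rewrite lef_pV2 ?posrE ?exprn_gt0// ler_weXn2l.
have B2 : m.*2.+1%:R * C2 * x ^+ 2 * z ^- m <= B * x ^+ 2 * z ^- m.
  by rewrite ler_wpM2r// ler_wpM2r// sqr_ge0.
split => //.
- rewrite (le_trans al_bnd)// ler_pM2l//.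
- have := sumB (fun k => complex.Im (w k)) (fun k => (wB k).2).
  move=> /ler_normlW h1; apply/andP; split; last first.
    by rewrite (le_trans h1)// ler_pM2l.
  move: be_bnd; rewrite ler_norml => /andP[+ _].
  have : x * a0 <= x * a t by rewrite ler_pM2l// a_ge.
  by rewrite mulrA; move: (x * a0) (x * a t) => u v; lra.
- rewrite (le_trans _ B2)//.
  have : `|complex.Re (\sum_(n < m.*2.+1) (- x ^+ 2 * (P t)`_n)%:C%C * c ^+ n)| <=
      m.*2.+1%:R * C2 * x ^+ 2 * z ^- m.
    by rewrite complex_Re_sum; exact: (resB _ (fun n => (wkb_cX_bound n x0).1)).
  rewrite -E !raddfD/= expr2.
  rewrite -!complex_Re_sum -!complex_Im_sum.
  case: (\sum_(k < m) (nu k t)%:C%C * w k) => u v /=.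
  by congr (`|_| <= _); ring.
- rewrite (le_trans _ B2)//.
  have : `|complex.Im (\sum_(n < m.*2.+1) (- x ^+ 2 * (P t)`_n)%:C%C * c ^+ n)| <=
      m.*2.+1%:R * C2 * x ^+ 2 * z ^- m.
    by rewrite complex_Im_sum; exact: (resB _ (fun n => (wkb_cX_bound n x0).2)).
  rewrite -E !raddfD/= expr2.
  rewrite -!complex_Re_sum -!complex_Im_sum.
  case: (\sum_(k < m) (nu k t)%:C%C * w k) => u v /=.
  by congr (`|_| <= _); ring.
Qed.
End riccati.

(** * Growth of the two energies of a single mode *)

Section zones.
Context {R : realType}.
Implicit Types (y v f : R -> R) (x a ainf d s t T : R).

Definition hint s t f : R := \int[lebesgue_measure]_(r in `[s, t]) f r.

Lemma hintxx s f : hint s s f = 0.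
Proof. by rewrite /hint set_itv1 Rintegral_set1. Qed.

Lemma hint_ge0 s t f : (forall r, s <= r -> 0 <= f r) -> 0 <= hint s t f.
Proof.
move=> f0; apply: Rintegral_ge0 => r /=.
by rewrite in_itv/= => /andP[+ _]; exact: f0.
Qed.

Lemma hint_nondecr s t r f : s <= t -> t <= r -> hcont s f ->
  (forall u, s <= u -> 0 <= f u) -> hint s t f <= hint s r f.
Proof.
move=> st tr cf f0; rewrite -lerN2.
apply: (@hder_le0 R t r (fun u => - hint s u f) (fun u => - f u)) => //.
  by apply: hderN; apply: hder_le st _; exact: hder_primitive.
by move=> u tu; rewrite oppr_le0 f0// (le_trans st)// ltW.
Qed.

Definition wave (a : R -> R) x y v f := [/\ hder 0 y v,
  hder 0 v (fun t => f t - a t ^+ 2 * x ^+ 2 * y t) & hcont 0 f].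

(** The derivative of the energy is 2 v f + 2 v y x^2 (ainf^2 - a^2). The second term factors as a
    difference of squares, and 2 |v| ainf x |y| is at most the energy; the first is split by Young's
    inequality with the free weight [d]. *)
Lemma energy_growth_stabilized (a : R -> R) ainf x d y v f T :
  hcont 0 a -> 0 < ainf -> 0 < x -> 0 < d -> 0 <= T -> wave a x y v f ->
  forall a1, (forall t, 0 <= t -> 0 <= a t <= a1) ->
  v T ^+ 2 + ainf ^+ 2 * x ^+ 2 * y T ^+ 2 <=
  expR (x * ((a1 + ainf) / ainf) * hint 0 T (fun t => `|a t - ainf|) + d * T) *
  (v 0 ^+ 2 + ainf ^+ 2 * x ^+ 2 * y 0 ^+ 2 + d^-1 * hint 0 T (fun t => f t ^+ 2)).
Proof.
move=> ca ainf0 x0 d0 T0 [dy dv cf] a1 ha1.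
have cF : hder 0 (fun t => v t ^+ 2 + ainf ^+ 2 * x ^+ 2 * y t ^+ 2)
   (fun t => 2 * v t * (f t - a t ^+ 2 * x ^+ 2 * y t) +
             ainf ^+ 2 * x ^+ 2 * (2 * y t * v t)).
  by apply: hderD; [exact: hderX2|apply: hderZ; exact: hderX2].
have cabs : hcont 0 (fun t => `|a t - ainf|).
  by apply: hcont_norm; apply: hcontB => //; exact: hcont_cst.
have dG : hder 0 (fun t => x * ((a1 + ainf) / ainf) * hint 0 t (fun t => `|a t - ainf|) + d * t)
    (fun t => x * ((a1 + ainf) / ainf) * `|a t - ainf| + d * 1).
  apply: hderD; apply: hderZ; first exact: hder_primitive.
  exact: hder_id.
have dP : hder 0 (fun t => d^-1 * hint 0 t (fun t => f t ^+ 2)) (fun t => d^-1 * f t ^+ 2).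
  by apply: hderZ; apply: hder_primitive; exact: hcontX.
have a10 : 0 <= a1 by have /andP[h1 h2] := ha1 0 (lexx 0); exact: le_trans h2.
have := gronwall T0 cF dG dP.
rewrite !hintxx !mulr0 addr0 !subr0; apply.
- move=> t _; apply: addr_ge0; last by rewrite mulr1 ltW.
  by rewrite mulr_ge0// mulr_ge0 ?(ltW x0)// divr_ge0 ?(ltW ainf0)// addr_ge0// ltW.
- by move=> t _; rewrite mulr_ge0 ?sqr_ge0// invr_ge0 ltW.
move=> t /ltW t0; have /andP[at0 at1] := ha1 t t0.
have young : 2 * v t * f t <= d * v t ^+ 2 + d^-1 * f t ^+ 2.
  have : 0 <= d^-1 * (d * v t - f t) ^+ 2 by rewrite mulr_ge0 ?sqr_ge0// invr_ge0 ltW.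
  rewrite [X in 0 <= X](_ : _ = d * v t ^+ 2 + d^-1 * f t ^+ 2 - 2 * v t * f t);
    first by rewrite subr_ge0.
  by field; rewrite gt_eqF.
have cross : 2 * v t * y t * x ^+ 2 * (ainf ^+ 2 - a t ^+ 2) <=
   x * ((a1 + ainf) / ainf) * `|a t - ainf| * (v t ^+ 2 + ainf ^+ 2 * x ^+ 2 * y t ^+ 2).
  set S := v t ^+ 2 + _.
  have S2 : `|2 * v t * (ainf * x * y t)| <= S.
    rewrite ler_norml /S; apply/andP; split.
      by have := sqr_ge0 (v t + ainf * x * y t); lra.
    by have := sqr_ge0 (v t - ainf * x * y t); lra.
  have -> : 2 * v t * y t * x ^+ 2 * (ainf ^+ 2 - a t ^+ 2) =
      2 * v t * (ainf * x * y t) * (x / ainf * (ainf ^+ 2 - a t ^+ 2)).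
    by field; rewrite gt_eqF.
  rewrite (le_trans (ler_norm _))// normrM mulrC ler_pM//.
  rewrite subr_sqr !normrM (ger0_norm (_ : 0 <= x)) ?(ltW x0)//.
  rewrite (ger0_norm (_ : 0 <= ainf^-1)) ?invr_ge0 ?(ltW ainf0)//.
  rewrite (ger0_norm (_ : 0 <= ainf + a t)) ?addr_ge0// ?(ltW ainf0)// distrC.
  rewrite mulrA [leRHS](_ : _ = x / ainf * `|a t - ainf| * (a1 + ainf)); last by ring.
  rewrite ler_wpM2l//; last by rewrite [leRHS]addrC lerD2l.
  by rewrite mulr_ge0// divr_ge0// ltW.
have : d * v t ^+ 2 <= d * (v t ^+ 2 + ainf ^+ 2 * x ^+ 2 * y t ^+ 2).
  by rewrite ler_pM2l// lerDl mulr_ge0 ?sqr_ge0// mulr_ge0 ?sqr_ge0.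
by move: young cross; set g := _ * `|_|; lra.
Qed.

(** With lambda = al + i be, [F] is |v - lambda y|^2 / be. Up to the residuals [p], [q] and the
    source, the numerator changes at the relative rate - 2 al, and so does the denominator, because
    be' = - 2 al be + q: dividing by [be] removes this drift. What remains involves [2 * A * y] and
    [be * y ^+ 2], both bounded by [F]. In the rate |p| + 3 |q| the 3 is 2 + 1, with 2 from the
    numerator and 1 from the denominator. *)
Lemma energy_growth_wkb (a al be al' be' F p q : R -> R) x d b y v f s T :
  0 <= s -> s <= T -> 0 < b -> 0 < d -> hcont 0 a -> wave a x y v f ->
  hder 0 al al' -> hder 0 be be' -> hcont 0 al' -> hcont 0 be' ->
  (forall t, s <= t -> b <= be t) ->
  F = (fun t => ((v t - al t * y t) ^+ 2 + be t ^+ 2 * y t ^+ 2) / be t) ->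
  p = (fun t => al' t + al t ^+ 2 - be t ^+ 2 + a t ^+ 2 * x ^+ 2) ->
  q = (fun t => be' t + 2 * al t * be t) ->
  F T <= expR (b^-1 * hint s T (fun t => `|p t| + 3 * `|q t|) + d * (T - s)) *
    (F s + (b * d)^-1 * hint s T (fun t => f t ^+ 2)).
Proof.
move=> s0 sT b0 d0 ca [dy dv cf] dal dbe cal' cbe' bbe FE0 pE qE.
have be0 t : s <= t -> 0 < be t by move=> /bbe; exact: lt_le_trans.
have bn0 t : s <= t -> be t != 0 by move=> /be0/lt0r_neq0.
pose A t := v t - al t * y t.
pose A' t := f t - p t * y t - al t * A t - be t ^+ 2 * y t.
have dA : hder s A A'.
  apply: hder_eq (hderB (hder_le s0 dv) (hderM (hder_le s0 dal) (hder_le s0 dy))) _.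
  by move=> t _; rewrite /A' pE /A; ring.
have dF : hder s F (fun t => (be t)^-1 * (2 * A t * f t - 2 * p t * A t * y t
    + 2 * be t * q t * y t ^+ 2 - q t * F t)).
  rewrite {1}FE0; apply: hder_eq (hderM (hderD (hderX2 dA) (hderM (hderX2 (hder_le s0 dbe))
    (hderX2 (hder_le s0 dy)))) (hderV bn0 (hder_le s0 dbe))) _.
  move=> t st; rewrite FE0 /A' qE -/(A t).
  have -> : v t = A t + al t * y t by rewrite /A; ring.
  by field; rewrite bn0// ltW.
have cp : hcont 0 p.
  rewrite pE;   apply: hcontD; last first.
    by apply: hcontM; [exact: hcontX|exact: hcont_cst].
  apply: hcontB; last by apply: hcontX; case: dbe.
  by apply: hcontD => //; apply: hcontX; case: dal.
have cq : hcont 0 q.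
  rewrite qE;   apply: hcontD => //; apply: hcontM; last by case: dbe.
  by apply: hcontM; [exact: hcont_cst|case: dal].
have cpq : hcont s (fun t => `|p t| + 3 * `|q t|).
  apply: hcont_le s0 _; apply: hcontD; first exact: hcont_norm.
  by apply: hcontM; [exact: hcont_cst|exact: hcont_norm].
have dG : hder s (fun t => b^-1 * hint s t (fun t => `|p t| + 3 * `|q t|) + d * (t - s))
    (fun t => b^-1 * (`|p t| + 3 * `|q t|) + d * (1 - 0)).
  apply: hderD; apply: hderZ; first exact: hder_primitive.
  by apply: hderB; [exact: hder_id|exact: hder_cst].
have dP : hder s (fun t => (b * d)^-1 * hint s t (fun t => f t ^+ 2))
    (fun t => (b * d)^-1 * f t ^+ 2).
  by apply: hderZ; apply: hder_primitive; apply: hcontX; exact: hcont_le cf.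
have bV0 : 0 <= b^-1 by rewrite invr_ge0 ltW.
have := gronwall sT dF dG dP.
rewrite !hintxx !mulr0 subrr mulr0 addr0 !subr0; apply.
- by move=> t _; rewrite addr_ge0 ?mulr_ge0 ?addr_ge0// ltW.
- by move=> t _; rewrite mulr_ge0 ?sqr_ge0// invr_ge0 mulr_ge0 ?ltW.
move=> t /ltW st; have bt0 := be0 t st; rewrite mulr1.
have btV : (be t)^-1 <= b^-1 by rewrite lef_pV2 ?posrE// bbe.
have btV0 : 0 <= (be t)^-1 by rewrite invr_ge0 ltW.
have F0 : 0 <= F t by rewrite FE0 mulr_ge0// addr_ge0 ?sqr_ge0// mulr_ge0 ?sqr_ge0.
have FE : be t * F t = A t ^+ 2 + be t ^+ 2 * y t ^+ 2.
  by rewrite FE0 /= /A mulrCA divff ?mulr1// gt_eqF.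
have Ay : `|2 * A t * y t| <= F t.
  rewrite -(ler_pM2l bt0) FE -{1}(gtr0_norm bt0) -normrM ler_norml; apply/andP; split.
    by have := sqr_ge0 (A t + be t * y t); lra.
  by have := sqr_ge0 (A t - be t * y t); lra.
have by2 : be t * y t ^+ 2 <= F t.
  by rewrite -(ler_pM2l bt0) FE mulrA -expr2 lerDr sqr_ge0.
have h1 : - (2 * p t * A t * y t) <= `|p t| * F t.
  rewrite (_ : - _ = - p t * (2 * A t * y t)); last by ring.
  by rewrite (le_trans (ler_norm _))// normrM normrN ler_wpM2l.
have h2 : 2 * be t * q t * y t ^+ 2 - q t * F t <= 3 * `|q t| * F t.
  have : 2 * q t * (be t * y t ^+ 2) <= 2 * `|q t| * F t.
    apply: (@le_trans _ _ (2 * `|q t| * (be t * y t ^+ 2))).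
      rewrite ler_wpM2r//; first by rewrite mulr_ge0 ?sqr_ge0// ltW.
      by rewrite ler_pM2l// ler_norm.
    by rewrite ler_wpM2l// mulr_ge0.
  have : - q t * F t <= `|q t| * F t by rewrite ler_wpM2r// -normrN ler_norm.
  lra.
have h3 : (be t)^-1 * (2 * A t * f t) <= d * F t + (b * d)^-1 * f t ^+ 2.
  have : 2 * A t * f t <= d * A t ^+ 2 + d^-1 * f t ^+ 2.
    have : 0 <= d^-1 * (d * A t - f t) ^+ 2 by rewrite mulr_ge0 ?sqr_ge0// invr_ge0 ltW.
    rewrite [X in 0 <= X](_ : _ = d * A t ^+ 2 + d^-1 * f t ^+ 2 - 2 * A t * f t);
      first by rewrite subr_ge0.
    by field; rewrite gt_eqF.
  move=> /(ler_wpM2l btV0)/le_trans; apply; rewrite mulrDr; apply: lerD.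
    rewrite mulrCA ler_pM2l// -(ler_pM2l bt0) FE mulrA divff ?mul1r ?gt_eqF//.
    by rewrite lerDl mulr_ge0 ?sqr_ge0.
  by rewrite mulrA invfM ler_wpM2r ?sqr_ge0// ler_wpM2r// invr_ge0 ltW.
have h4 : (be t)^-1 * (`|p t| * F t + 3 * `|q t| * F t) <= b^-1 * (`|p t| + 3 * `|q t|) * F t.
  by rewrite -mulrDl mulrA ler_wpM2r// ler_wpM2r// addr_ge0// mulr_ge0.
have h5 : (be t)^-1 * (- (2 * p t * A t * y t) + (2 * be t * q t * y t ^+ 2 - q t * F t))
   <= (be t)^-1 * (`|p t| * F t + 3 * `|q t| * F t).
  by rewrite ler_wpM2l// lerD.
rewrite (_ : (be t)^-1 * _ = (be t)^-1 * (2 * A t * f t) +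
  (be t)^-1 * (- (2 * p t * A t * y t) + (2 * be t * q t * y t ^+ 2 - q t * F t))); last by ring.
apply: le_trans (lerD h3 (le_trans h5 h4)) _.
by rewrite le_eqVlt; apply/orP; left; apply/eqP; ring.
Qed.

End zones.

(** * Comparison of the WKB energy with the standard one *)

Section norm_equivalence.
Context {R : realFieldType}.
Implicit Types v y k be b : R.

(** This comparison and the converse one are applied to [x * y], [al / x] and [be / x], whose bounds
    do not involve [x]; the constants are therefore uniform in the frequency. *)
Lemma le_wkb_energy v y k be b B a2 : 0 < b -> b <= be -> be <= B -> `|k| <= B ->
  0 <= a2 ->
  v ^+ 2 + a2 * y ^+ 2 <=
  (2 * B + (2 * B ^+ 2 + a2) / b) * ((v - k * y) ^+ 2 / be + be * y ^+ 2).
Proof.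
move=> b0 bbe beB kB a20; have be0 : 0 < be by exact: lt_le_trans bbe.
have B0 : 0 <= B by rewrite (le_trans _ beB)// ltW.
have k2 : k ^+ 2 <= B ^+ 2 by rewrite -[k ^+ 2]real_normK ?num_real// ler_pXn2r ?nnegrE.
have y2 := sqr_ge0 y.
have h1 : v ^+ 2 <= 2 * (v - k * y) ^+ 2 + 2 * B ^+ 2 * y ^+ 2.
  have : k ^+ 2 * y ^+ 2 <= B ^+ 2 * y ^+ 2 by rewrite ler_wpM2r.
  by have := sqr_ge0 (v - k * y - k * y); lra.
have h2 : 2 * (v - k * y) ^+ 2 <= 2 * B * ((v - k * y) ^+ 2 / be).
  set q := _ / be; have -> : (v - k * y) ^+ 2 = q * be by rewrite divfK// gt_eqF.
  have q0 : 0 <= q by rewrite divr_ge0 ?sqr_ge0// ltW.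
  by have := ler_wpM2l q0 beB; lra.
have h3 : (2 * B ^+ 2 + a2) * y ^+ 2 <= (2 * B ^+ 2 + a2) / b * (be * y ^+ 2).
  rewrite [leRHS]mulrA ler_wpM2r// -[leRHS]mulrA ler_peMr ?addr_ge0 ?mulr_ge0 ?sqr_ge0//.
  by rewrite mulrC ler_pdivlMr// mul1r.
have h4 : 0 <= (2 * B ^+ 2 + a2) / b * ((v - k * y) ^+ 2 / be).
  have c0 : 0 <= 2 * B ^+ 2 + a2 by rewrite addr_ge0// mulr_ge0 ?sqr_ge0.
  by apply: mulr_ge0; apply: divr_ge0; rewrite ?sqr_ge0// ltW.
have h5 : 0 <= 2 * B * (be * y ^+ 2).
  by apply: mulr_ge0; [exact: mulr_ge0|apply: mulr_ge0 => //; exact: ltW].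
move: h1 h2 h3 h4 h5; set q := _ / be; set u := (v - _) ^+ 2.
move: u q ((_ + _) / b) => u q D; lra.
Qed.

Lemma wkb_energy_le v y k be b B a2 c : 0 < b -> b <= be -> be <= B -> `|k| <= B ->
  0 < c -> c <= a2 ->
  (v - k * y) ^+ 2 / be + be * y ^+ 2 <=
  (2 / b + (2 * B ^+ 2 / b + B) / c) * (v ^+ 2 + a2 * y ^+ 2).
Proof.
move=> b0 bbe beB kB c0 ca; have be0 : 0 < be by exact: lt_le_trans bbe.
have B0 : 0 <= B by rewrite (le_trans _ beB)// ltW.
have k2 : k ^+ 2 <= B ^+ 2 by rewrite -[k ^+ 2]real_normK ?num_real// ler_pXn2r ?nnegrE.
have y2 := sqr_ge0 y; have a20 : 0 < a2 by exact: lt_le_trans ca.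
have h1 : (v - k * y) ^+ 2 <= 2 * v ^+ 2 + 2 * B ^+ 2 * y ^+ 2.
  have : k ^+ 2 * y ^+ 2 <= B ^+ 2 * y ^+ 2 by rewrite ler_wpM2r.
  by have := sqr_ge0 (v + k * y); lra.
have h2 : (v - k * y) ^+ 2 / be <= 2 / b * v ^+ 2 + 2 * B ^+ 2 / b * y ^+ 2.
  have -> : 2 / b * v ^+ 2 + 2 * B ^+ 2 / b * y ^+ 2 = (2 * v ^+ 2 + 2 * B ^+ 2 * y ^+ 2) / b.
    by field; rewrite gt_eqF.
  by rewrite ler_pM ?sqr_ge0 ?invr_ge0 ?(ltW be0)// lef_pV2 ?posrE.
have h3 : be * y ^+ 2 <= B * y ^+ 2 by rewrite ler_wpM2r.
have D0 : 0 <= 2 * B ^+ 2 / b + B.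
  by rewrite addr_ge0// divr_ge0 ?(ltW b0)// mulr_ge0 ?sqr_ge0.
have h4 : (2 * B ^+ 2 / b + B) * y ^+ 2 <= (2 * B ^+ 2 / b + B) / c * (a2 * y ^+ 2).
  rewrite [leRHS]mulrA ler_wpM2r// -[leRHS]mulrA ler_peMr//.
  by rewrite mulrC ler_pdivlMr// mul1r.
have h5 : 0 <= 2 / b * (a2 * y ^+ 2).
  by apply: mulr_ge0; [rewrite divr_ge0// ltW|apply: mulr_ge0 => //; exact: ltW].
have h6 : 0 <= (2 * B ^+ 2 / b + B) / c * v ^+ 2.
  by rewrite mulr_ge0 ?sqr_ge0// divr_ge0// ltW.
move: h2 h3 h4 h5 h6; move: ((v - _) ^+ 2 / be) => u2.
lra.
Qed.

End norm_equivalence.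

(** * The inverse of Lam and the absorption of constants in the exponent *)

Section inverse.
Context {R : realType}.
Variables (Theta Lam : R -> R).
Hypothesis Theta_gt0 : forall t : R, 0 <= t -> 0 < Theta t.
Hypothesis Theta_mono : forall s t : R, 0 <= s -> s <= t -> Theta s <= Theta t.
Hypothesis Lam_gt0 : forall t : R, 0 <= t -> 0 < Lam t.
Hypothesis Lam_cont : hcont 0 Lam.
Hypothesis Lam_mono : forall s t : R, 0 <= s -> s < t -> Lam s < Lam t.
Hypothesis Lam_lim : Lam t @[t --> +oo] --> +oo.
Hypothesis ThetaLam_mono : forall s t : R, 0 <= s -> s <= t ->
  Theta s / Lam s <= Theta t / Lam t.
Implicit Types r s t x c : R.

Lemma Linv_lt r : r < Lam 0 -> Linv Lam r = 0.
Proof. by rewrite /Linv => ->. Qed.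

Lemma LinvK r : Lam 0 <= r -> 0 <= Linv Lam r /\ Lam (Linv Lam r) = r.
Proof.
move=> r0; rewrite /Linv ltNge r0/=.
suff [t Pt] : exists t, is_inverse_at Lam r t by case: xgetP => [y _ []|/(_ t)].
have [M [_ HM]] : \forall t \near +oo, r <= Lam t.
  by move/cvgryPge : Lam_lim => /(_ r).
pose b := Num.max 0 M + 1.
have b0 : 0 <= b by rewrite addr_ge0// le_max lexx.
have rb : r <= Lam b.
  by apply: HM; rewrite /b ltr_pwDr// le_max lexx orbT.
have [||t] := @IVT R Lam 0 b r b0.
- apply: continuous_subspaceW Lam_cont => x /=; rewrite !in_itv/= andbT.
  by case/andP.
- by rewrite ge_min r0 le_max rb orbT.
by rewrite in_itv/= => /andP[t0 _] <-; exists t.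
Qed.

Lemma Linv_ge0 r : 0 <= Linv Lam r.
Proof. by have [/Linv_lt ->//|/LinvK[]] := ltP r (Lam 0). Qed.

(** An inequality instead of an equality, so as to include the convention [Linv Lam r = 0] for
    [r < Lam 0]. *)
Lemma Lam_Linv_ge r : r <= Lam (Linv Lam r).
Proof. by have [h|/LinvK[_ ->]//] := ltP r (Lam 0); rewrite Linv_lt// ltW. Qed.

Lemma Lam_le s t : 0 <= s -> s <= t -> Lam s <= Lam t.
Proof. by move=> s0; rewrite le_eqVlt => /predU1P[->//|st]; rewrite ltW// Lam_mono. Qed.

Lemma Linv_le r s : r <= s -> Linv Lam r <= Linv Lam s.
Proof.
move=> rs; have [h|h] := ltP r (Lam 0); first by rewrite Linv_lt// Linv_ge0.
have [r0 er] := LinvK h; have [s0 es] := LinvK (le_trans h rs).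
by rewrite leNgt; apply/negP => /(Lam_mono s0); rewrite er es ltNge rs.
Qed.

(** Since Theta / Lam increases, multiplying [N / x] by kappa = 1 + c / 2 multiplies the value of
    Theta at its inverse image by at least kappa, and 2 kappa >= c. This argument requires
    [Lam 0 <= N / x]; below that value [Linv] is 0 and the left side is at most
    [c * X * Theta 0]. *)
Lemma weight_absorb c N x X : 0 <= c -> 0 < N -> 0 < x -> x <= X ->
  c * x * Theta (Linv Lam (N / x)) <=
  c * X * Theta 0 + 2 * x * Theta (Linv Lam (N * (1 + c / 2) / x)).
Proof.
move=> c0 N0 x0 xX.
have T0 r : 0 <= Theta (Linv Lam r) by rewrite ltW// Theta_gt0// Linv_ge0.
have T00 := ltW (Theta_gt0 (lexx 0)).
have [h|h] := ltP (N / x) (Lam 0).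
  rewrite Linv_lt// ler_wpDr ?mulr_ge0 ?(ltW x0)//.
  by rewrite ler_wpM2r// ler_wpM2l.
apply: (@le_trans _ _ (2 * x * Theta (Linv Lam (N * (1 + c / 2) / x)))); last first.
  by rewrite lerDr !mulr_ge0// (le_trans _ xX)// ltW.
have k1 : 1 <= 1 + c / 2 by rewrite lerDl divr_ge0.
have Nx : N / x <= N * (1 + c / 2) / x.
  by rewrite ler_pM2r ?invr_gt0// ler_peMr// ltW.
have [t0 et] := LinvK h; have [s0 es] := LinvK (le_trans h Nx).
have := ThetaLam_mono t0 (Linv_le Nx); rewrite et es.
rewrite ler_pdivlMr; last by rewrite divr_gt0// mulr_gt0// (lt_le_trans ltr01).
rewrite (_ : _ * (_ / x) = Theta (Linv Lam (N / x)) * (1 + c / 2)); last first.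
  by field; rewrite !gt_eqF.
move=> /(ler_wpM2l (ltW x0)); have := T0 (N / x).
set u := Theta _; set w := Theta (Linv Lam (N * _ / x)) => u0 h1.
have : 0 <= x * u by rewrite mulr_ge0// ltW.
lra.
Qed.

End inverse.

(** * Energy estimate for one mode, uniform in the frequency *)

Section scalar_estimate.
Context {R : realType}.
Variables (a Theta Xi Lam : R -> R) (a0 a1 ainf C0 M : R) (m : nat).
Hypothesis m_gt0 : (0 < m)%N.
Hypothesis a0_gt0 : 0 < a0.
Hypothesis a_bnd : forall t : R, 0 <= t -> a0 <= a t <= a1.
Hypothesis a_symbol : symbol Xi m 0 a.
Hypothesis ainf_gt0 : 0 < ainf.
Hypothesis Theta_gt0 : forall t : R, 0 <= t -> 0 < Theta t.
Hypothesis Theta_mono : forall s t : R, 0 <= s -> s <= t -> Theta s <= Theta t.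
Hypothesis Xi_gt0 : forall t : R, 0 <= t -> 0 < Xi t.
Hypothesis Lam_gt0 : forall t : R, 0 <= t -> 0 < Lam t.
Hypothesis Lam_cont : hcont 0 Lam.
Hypothesis Lam_mono : forall s t : R, 0 <= s -> s < t -> Lam s < Lam t.
Hypothesis Lam_lim : Lam t @[t --> +oo] --> +oo.
Hypothesis ThetaLam_mono : forall s t : R, 0 <= s -> s <= t ->
  Theta s / Lam s <= Theta t / Lam t.
Hypothesis C0_gt0 : 0 < C0.
Hypothesis Lam_Xi : forall t : R, 0 <= t -> Lam t <= C0 * Xi t.
Hypothesis a_stab : forall t : R, 0 <= t -> hint 0 t (fun s => `|a s - ainf|) <= Theta t.
Hypothesis M_ge0 : 0 <= M.
Hypothesis Xi_tail : forall (s t c : R) (g : R -> R), 0 <= s -> s <= t -> 0 <= c ->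
  hcont s g -> (forall u, s <= u -> 0 <= g u <= c * Xi u ^- m) ->
  hint s t g <= c * (M * Theta s / Lam s ^+ m).

Let energy_compare (v y A B I : R) : 0 <= y -> 0 <= v -> A <= B -> 0 <= B -> 0 < I ->
  v + A * y <= (1 + B / I) * (v + I * y).
Proof.
move=> y0 v0 AB B0 I0; have : 0 <= B / I * v by rewrite mulr_ge0// divr_ge0// ltW.
have : 0 <= I * y by rewrite mulr_ge0// ltW.
have : A * y <= B / I * (I * y) by rewrite [leRHS]mulrA divfK ?gt_eqF// ler_wpM2r.
by lra.
Qed.

Definition scalar_energy (x y v t : R) := v ^+ 2 + a t ^+ 2 * x ^+ 2 * y ^+ 2.

Let acont : hcont 0 a. Proof. exact: symbol_hcont a_symbol. Qed.
Let a1_gt0 : 0 < a1.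
Proof. by have /andP[h1 h2] := a_bnd (lexx 0); rewrite (lt_le_trans a0_gt0)// (le_trans h1). Qed.
Let a2_ge t : 0 <= t -> a0 ^+ 2 <= a t ^+ 2.
Proof.
move=> /a_bnd/andP[h1 h2].
by rewrite ler_pXn2r ?nnegrE ?(ltW a0_gt0)// (le_trans _ h1)// ltW.
Qed.
Let a2_le t : 0 <= t -> a t ^+ 2 <= a1 ^+ 2.
Proof.
move=> /a_bnd/andP[h1 h2].
by rewrite ler_pXn2r ?nnegrE ?(ltW a1_gt0)// (le_trans _ h1)// ltW.
Qed.

(** [energy_growth_stabilized] with [d = (1 + T)^-1]: Young's inequality then adds at most 1 to the
    exponent and puts the weight [1 + T] on the source. The first prefactor replaces [a t] by [ainf]
    at the final time, the second [ainf] by [a 0] at the initial time. *)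
Lemma pseudo_zone x y v f T t : 0 < x -> wave a x y v f -> 0 <= t -> t <= T ->
  scalar_energy x (y t) (v t) t <=
  (1 + a1 ^+ 2 / ainf ^+ 2) * (1 + ainf ^+ 2 / a0 ^+ 2) *
  expR ((a1 + ainf) / ainf * x * Theta t + 1) *
  (scalar_energy x (y 0) (v 0) 0 + (1 + T) * hint 0 T (fun t => f t ^+ 2)).
Proof.
move=> x0 w t0 tT; have T0 : 0 <= T by exact: le_trans tT.
have T1 : 0 < 1 + T by rewrite ltr_pwDl.
have d0 : 0 < (1 + T)^-1 by rewrite invr_gt0.
have a01 r : 0 <= r -> 0 <= a r <= a1.
  by move=> /a_bnd/andP[h1 ->]; rewrite andbT (le_trans _ h1)// ltW.
have := energy_growth_stabilized acont ainf_gt0 x0 d0 t0 w a01.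
rewrite invrK.
have [_ _ cf] := w.
have cf2 : hcont 0 (fun t => f t ^+ 2) by exact: hcontX.
have H0 r : 0 <= hint 0 r (fun t => f t ^+ 2) by apply: hint_ge0 => u _; exact: sqr_ge0.
have HT : hint 0 t (fun t => f t ^+ 2) <= hint 0 T (fun t => f t ^+ 2).
  by apply: hint_nondecr => // u _; exact: sqr_ge0.
set H := hint 0 T _ in HT *; set Ht := hint 0 t (fun t => f t ^+ 2) in HT *.
set F0 := _ + ainf ^+ 2 * x ^+ 2 * y 0 ^+ 2.
set Ft := _ + ainf ^+ 2 * x ^+ 2 * y t ^+ 2.
set E0 := scalar_energy x (y 0) (v 0) 0; set Et := scalar_energy x (y t) (v t) t.
move=> hF.
have i2 : 0 < ainf ^+ 2 by rewrite exprn_gt0.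
have j2 : 0 < a0 ^+ 2 by rewrite exprn_gt0.
have p0 : 0 <= a1 ^+ 2 / ainf ^+ 2 by rewrite divr_ge0 ?sqr_ge0.
have q0 : 0 <= ainf ^+ 2 / a0 ^+ 2 by rewrite divr_ge0 ?sqr_ge0.
have Y0 r : 0 <= x ^+ 2 * y r ^+ 2 by rewrite mulr_ge0 ?sqr_ge0.
have hEt : Et <= (1 + a1 ^+ 2 / ainf ^+ 2) * Ft.
  rewrite /Et /scalar_energy /Ft -[_ * _ * y t ^+ 2]mulrA -[ainf ^+ 2 * _ * _]mulrA.
  by apply: energy_compare; rewrite ?sqr_ge0// a2_le.
have hF0 : F0 <= (1 + ainf ^+ 2 / a0 ^+ 2) * E0.
  apply: (@le_trans _ _ ((1 + ainf ^+ 2 / a0 ^+ 2) * (v 0 ^+ 2 + a0 ^+ 2 * (x ^+ 2 * y 0 ^+ 2)))).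
    by rewrite /F0 -[ainf ^+ 2 * _ * _]mulrA; apply: energy_compare; rewrite ?sqr_ge0.
  rewrite ler_wpM2l ?addr_ge0// /E0 /scalar_energy lerD2l -[leRHS]mulrA.
  by rewrite ler_wpM2r// a2_ge.
have cx : 0 <= (a1 + ainf) / ainf * x.
  by rewrite mulr_ge0 ?(ltW x0)// divr_ge0 ?(ltW ainf_gt0)// addr_ge0 ?(ltW ainf_gt0) ?(ltW a1_gt0).
have hexp : expR (x * ((a1 + ainf) / ainf) * hint 0 t (fun s => `|a s - ainf|) + (1 + T)^-1 * t) <=
   expR ((a1 + ainf) / ainf * x * Theta t + 1).
  rewrite ler_expR; apply: lerD; last by rewrite mulrC ler_pdivrMr// mul1r ler_wpDl.
  by rewrite [x * _]mulrC ler_wpM2l// a_stab.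
set P := 1 + a1 ^+ 2 / _ in hEt *; set Q := 1 + ainf ^+ 2 / _ in hF0 *.
have P0 : 0 < P by rewrite ltr_pwDl.
have Q1 : 1 <= Q by rewrite lerDl.
apply: (le_trans hEt); rewrite -!(mulrA P) ler_pM2l// [Q * _]mulrC -(mulrA (expR _) Q).
apply: (le_trans hF).
have F00 : 0 <= F0.
  by rewrite /F0 addr_ge0 ?sqr_ge0// -mulrA mulr_ge0 ?sqr_ge0.
have Hd : 0 <= (1 + T) * Ht by apply: mulr_ge0; [exact: ltW|exact: H0].
apply: ler_pM; [exact: expR_ge0|exact: addr_ge0|exact: hexp|rewrite mulrDr].
apply: lerD => //.
apply: (@le_trans _ _ ((1 + T) * H)); first by rewrite ler_pM2l.
by rewrite ler_peMl//; apply: mulr_ge0; [exact: ltW|exact: H0].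
Qed.

Lemma hyperbolic_zone : exists N C c, [/\ 1 <= N, 0 < C, 0 <= c &
  forall x y v f s t T, 0 < x -> wave a x y v f -> 0 <= s -> s <= t -> t <= T ->
  N <= x * Lam s ->
  scalar_energy x (y t) (v t) t <= C * expR (c * x * Theta s + 1) *
   (scalar_energy x (y s) (v s) s + (1 + T) * hint 0 T (fun t => f t ^+ 2))].
Proof.
have [K [B [K1 B0 HR]]] := exists_riccati Xi_gt0 a0_gt0 a_bnd a_symbol m_gt0.
pose b := a0 / 2; have b0 : 0 < b by rewrite divr_gt0.
pose C3 := 2 * B + (2 * B ^+ 2 + a1 ^+ 2) / b.
pose C4 := 2 / b + (2 * B ^+ 2 / b + B) / a0 ^+ 2.
have C30 : 0 < C3.
  by rewrite ltr_pwDl ?mulr_gt0// divr_ge0 ?(ltW b0)// addr_ge0 ?sqr_ge0// mulr_ge0 ?sqr_ge0.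
have C40 : 0 < C4.
  rewrite ltr_pwDl ?divr_gt0// divr_ge0 ?sqr_ge0// addr_ge0 ?(ltW B0)//.
  by rewrite divr_ge0 ?(ltW b0)// mulr_ge0 ?sqr_ge0.
(* The threshold [1 + C0 * K] forces [K <= x * Xi u] for all [u >= s] as well as [1 <= x * Lam s].
   [C3] and [C4] convert between the WKB energy and [scalar_energy], and [b^-1] comes from the
   source. In the exponent, 4 is 1 + 3 from the rate |p| + 3 |q|, and [M] is the tail constant. *)
exists (1 + C0 * K), (C3 * (C4 + b^-1)), (b^-1 * (4 * B) * M); split.
- by rewrite lerDl mulr_ge0 ?(ltW C0_gt0)// (le_trans ler01).
- by rewrite mulr_gt0// ltr_pwDl// invr_ge0 ltW.
- by rewrite !mulr_ge0// ?invr_ge0 ltW.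
move=> x y v f s t T x0 w s0 st tT NxL.
have [al [be [al' [be' [[dal dbe cal' cbe'] Hric]]]]] := HR x x0.
have t0 := le_trans s0 st; have T0 := le_trans t0 tT.
have T1 : 0 < 1 + T by rewrite ltr_pwDl.
have d0 : 0 < (1 + T)^-1 by rewrite invr_gt0.
have xb0 : 0 < x * b by rewrite mulr_gt0.
have xX u : s <= u -> K <= x * Xi u /\ 1 <= x * Lam s.
  move=> su; have h : x * Lam s <= x * (C0 * Xi u).
    rewrite ler_pM2l// (le_trans _ (Lam_Xi (le_trans s0 su)))//.
      exact: (@Lam_le _ Lam Lam_mono).
  split; last by rewrite (le_trans _ NxL)// lerDl mulr_ge0 ?(ltW C0_gt0)// (le_trans ler01).
  rewrite -(ler_pM2l C0_gt0); by have := le_trans NxL h; lra.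
have {}Hric u : s <= u ->
   [/\ `|al u| <= x * B, x * (a0 / 2) <= be u <= x * B,
       `|al' u + al u ^+ 2 - be u ^+ 2 + a u ^+ 2 * x ^+ 2| <= B * x ^+ 2 * (x * Xi u) ^- m &
       `|be' u + 2 * al u * be u| <= B * x ^+ 2 * (x * Xi u) ^- m].
  by move=> su; apply: Hric; [exact: le_trans su|have [] := xX u su].
have bbe u : s <= u -> x * b <= be u by move=> /Hric[_ /andP[]].
have := energy_growth_wkb s0 st xb0 d0 acont w dal dbe cal' cbe' bbe erefl erefl erefl.
set g := (fun u => `| _ | + _) => hF.
have xn0 : x != 0 by rewrite gt_eqF.
(* Multiplied by [x], the WKB energy becomes a quadratic form in [v] and [x * y] whose coefficients
   depend only on [al / x] and [be / x], quantities of size 1. *)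
have eqF u : s <= u -> x * (((v u - al u * y u) ^+ 2 + be u ^+ 2 * y u ^+ 2) / be u) =
    (v u - al u / x * (x * y u)) ^+ 2 / (be u / x) + be u / x * (x * y u) ^+ 2.
  move=> /bbe/(lt_le_trans xb0) be0; field.
  by rewrite xn0 gt_eqF.
have bnds u : s <= u -> [/\ b <= be u / x, be u / x <= B & `|al u / x| <= B].
  move=> /Hric[h1 /andP[h2 h3] _ _]; split.
  - by rewrite ler_pdivlMr// mulrC; exact: h2.
  - by rewrite ler_pdivrMr// mulrC.
  - by rewrite normrM (ger0_norm (_ : 0 <= x^-1)) ?invr_ge0 ?(ltW x0)// ler_pdivrMr// mulrC.
have eqE u : scalar_energy x (y u) (v u) u = v u ^+ 2 + a u ^+ 2 * (x * y u) ^+ 2.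
  by rewrite /scalar_energy; ring.
have Ele u : s <= u -> scalar_energy x (y u) (v u) u <=
    C3 * (x * (((v u - al u * y u) ^+ 2 + be u ^+ 2 * y u ^+ 2) / be u)).
  move=> su; rewrite eqF// eqE; have [h1 h2 h3] := bnds u su.
  apply: le_trans (le_wkb_energy _ _ b0 h1 h2 h3 (sqr_ge0 _)).
  by rewrite lerD2l ler_wpM2r ?sqr_ge0// a2_le// (le_trans s0 su).
have leE u : s <= u -> x * (((v u - al u * y u) ^+ 2 + be u ^+ 2 * y u ^+ 2) / be u) <=
    C4 * scalar_energy x (y u) (v u) u.
  move=> su; rewrite eqF// eqE; have [h1 h2 h3] := bnds u su.
  by apply: wkb_energy_le => //; rewrite ?exprn_gt0// a2_ge// (le_trans s0 su).
have Hg : (x * b)^-1 * hint s t g <= b^-1 * (4 * B) * M * x * Theta s.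
  have c0 : 0 <= 4 * B * x ^+ 2 * x ^- m.
    by rewrite divr_ge0 ?exprn_ge0 ?(ltW x0)// mulr_ge0 ?sqr_ge0// mulr_ge0// ltW.
  have hg : hint s t g <= 4 * B * x ^+ 2 * x ^- m * (M * Theta s / Lam s ^+ m).
    apply: Xi_tail => //.
      apply: hcontD; last (apply: hcontM; first exact: hcont_cst).
        apply: hcont_norm; apply: hcontD; last first.
          by apply: hcontM; [apply: hcontX; exact: hcont_le acont|exact: hcont_cst].
        apply: hcontB; last by apply: hcontX; case: dbe => /(hcont_le s0).
        apply: hcontD; first exact: hcont_le cal'.
        by apply: hcontX; case: dal => /(hcont_le s0).
      apply: hcont_norm; apply: hcontD; first exact: hcont_le cbe'.
      apply: hcontM; last by case: dbe => /(hcont_le s0).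
      by apply: hcontM; [exact: hcont_cst|case: dal => /(hcont_le s0)].
    move=> u su; have [_ _ h1 h2] := Hric u su; rewrite /g addr_ge0 ?mulr_ge0//=.
    move: h1 h2; rewrite exprMn invfM.
    set Q := x ^- m * _ => h1 h2.
    rewrite [leRHS](_ : _ = 4 * (B * x ^+ 2 * Q)); last by rewrite /Q; ring.
    by move: h1 h2; move: (B * _ * Q) => w1; lra.
  apply: (@le_trans _ _ ((x * b)^-1 * (4 * B * x ^+ 2 * x ^- m * (M * Theta s / Lam s ^+ m)))).
    by rewrite ler_wpM2l// invr_ge0 ltW.
  rewrite [leLHS](_ : _ = b^-1 * (4 * B) * M * x * Theta s * (x * Lam s) ^- m); last first.
    by rewrite exprMn; field; rewrite !expf_neq0 ?xn0 ?gt_eqF// Lam_gt0.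
  rewrite ler_piMr//.
    apply: mulr_ge0; last by rewrite ltW// Theta_gt0.
    by rewrite !mulr_ge0 ?invr_ge0// ltW.
  have [_ h] := xX s (lexx s).
  by rewrite -invr1 lef_pV2 ?posrE ?exprn_gt0 ?(lt_le_trans ltr01 h)// exprn_ege1.
have [_ _ cf] := w.
have cf2 : hcont 0 (fun u => f u ^+ 2) by exact: hcontX.
have Hf : hint s t (fun u => f u ^+ 2) <= hint 0 T (fun u => f u ^+ 2).
  have f2 r : 0 <= r -> 0 <= f r ^+ 2 by move=> _; exact: sqr_ge0.
  apply: le_trans (hint_nondecr t0 tT cf2 f2).
  rewrite -subr_le0.
  (* The primitives from [s] and from 0 have the same derivative, so their difference does not
     exceed its value at [s], which is minus an integral of squares. *)
  have := @hder_le0 R s t (fun r => hint s r (fun u => f u ^+ 2) - hint 0 r (fun u => f u ^+ 2))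
    (fun r => f r ^+ 2 - f r ^+ 2) st.
  rewrite hintxx sub0r => h; apply: le_trans (h _ _) _.
  - apply: hderB; first by apply: hder_primitive; exact: hcont_le cf2.
    by apply: hder_le s0 _; exact: hder_primitive.
  - by move=> r _; rewrite subrr.
  - by rewrite oppr_le0 hint_ge0.
have H0 : 0 <= hint 0 T (fun t => f t ^+ 2) by apply: hint_ge0 => u _; exact: sqr_ge0.
set H := hint 0 T _ in Hf H0 *.
apply: (le_trans (Ele t st)); rewrite -!(mulrA C3) ler_pM2l//.
move: hF (leE s (lexx s)).
set Ft := _ / be t; set Fs := _ / be s; set Es := scalar_energy _ _ _ _ => hF hFs.
have Es0 : 0 <= Es.
  by rewrite /Es eqE addr_ge0 ?sqr_ge0// mulr_ge0 ?sqr_ge0.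
rewrite -(ler_pM2l x0) in hF; apply: (le_trans hF); rewrite mulrCA [(C4 + _) * _]mulrC.
rewrite -(mulrA (expR _) (C4 + _)).
have bV0 : 0 < b^-1 by rewrite invr_gt0.
apply: (@le_trans _ _ (expR ((x * b)^-1 * hint s t g + (1 + T)^-1 * (t - s)) *
    ((C4 + b^-1) * (Es + (1 + T) * H)))).
  rewrite ler_wpM2l ?expR_ge0// mulrDr.
  have -> : x * ((x * b * (1 + T)^-1)^-1 * hint s t (fun u => f u ^+ 2)) =
      b^-1 * ((1 + T) * hint s t (fun u => f u ^+ 2)).
    by field; rewrite xn0 !gt_eqF.
  have h1 : b^-1 * ((1 + T) * hint s t (fun u => f u ^+ 2)) <= b^-1 * ((1 + T) * H).
    by rewrite !ler_pM2l.
  have h2 : 0 <= C4 * ((1 + T) * H) by rewrite mulr_ge0 ?(ltW C40)// mulr_ge0// ltW.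
  have h3 : 0 <= b^-1 * Es by rewrite mulr_ge0// ltW.
  by lra.
rewrite ler_wpM2r//.
  apply: mulr_ge0; first by apply: addr_ge0; exact: ltW.
  by apply: addr_ge0 => //; apply: mulr_ge0 => //; exact: ltW.
rewrite ler_expR; apply: lerD => //.
by rewrite mulrC ler_pdivrMr// mul1r; move: s0 t0 tT; lra.
Qed.

Theorem scalar_energy_estimate X : 0 < X -> exists N0 C, [/\ 0 < N0, 0 < C &
  forall x y v f T, 0 < x -> x <= X -> wave a x y v f -> 0 <= T ->
  scalar_energy x (y T) (v T) T <=
  C * expR (2 * x * Theta (Linv Lam (N0 / x))) *
  (scalar_energy x (y 0) (v 0) 0 + (1 + T) * hint 0 T (fun t => f t ^+ 2))].
Proof.
move=> X0; have [N [Ch [ch [N1 Ch0 ch0 hyp]]]] := hyperbolic_zone.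
pose Cp := (1 + a1 ^+ 2 / ainf ^+ 2) * (1 + ainf ^+ 2 / a0 ^+ 2).
pose cp := (a1 + ainf) / ainf.
have cp0 : 0 <= cp by rewrite divr_ge0 ?(ltW ainf_gt0)// addr_ge0// ltW.
have Cp0 : 0 < Cp by rewrite mulr_gt0// ltr_pwDl// divr_ge0 ?sqr_ge0.
have N0 : 0 < N by exact: lt_le_trans N1.
pose c := ch + cp; have c0 : 0 <= c by exact: addr_ge0.
(* The factor [1 + c / 2] is the one that [weight_absorb] requires for the sum [c] of the two
   exponents. The first summand of the constant serves times after the threshold, the second times
   before it; each zone that is crossed adds 1 to the exponent, hence [+ 2] and [+ 1]. *)
exists (N * (1 + c / 2)), (Ch * (Cp + 1) * expR (c * X * Theta 0 + 2) + Cp * expR (c * X * Theta 0 + 1)); split.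
- by rewrite mulr_gt0// ltr_pwDl// divr_ge0.
- apply: addr_gt0; last by rewrite mulr_gt0 ?expR_gt0.
  by rewrite mulr_gt0 ?expR_gt0// mulr_gt0// ltr_wpDl// ltW.
move=> x y v f T x0 xX w T0.
have T1 : 0 < 1 + T by rewrite ltr_pwDl.
have H0 : 0 <= hint 0 T (fun t => f t ^+ 2) by apply: hint_ge0 => u _; exact: sqr_ge0.
have E0 r : 0 <= scalar_energy x (y r) (v r) r.
  by rewrite /scalar_energy addr_ge0 ?sqr_ge0// -exprMn mulr_ge0 ?sqr_ge0.
pose tau := Linv Lam (N / x); have tau0 : 0 <= tau by exact: Linv_ge0.
have absorb := weight_absorb Theta_gt0 Lam_cont Lam_mono Lam_lim ThetaLam_mono c0 N0 x0 xX.
rewrite -/tau in absorb.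
set W := expR (2 * x * _); set S := scalar_energy x (y 0) (v 0) 0 + _.
have S0 : 0 <= S by apply: addr_ge0 => //; apply: mulr_ge0 => //; exact: ltW.
have Wabs k : expR (c * x * Theta tau + k) <= expR (c * X * Theta 0 + k) * W.
  by rewrite -expRD ler_expR addrAC lerD2r.
have pz t : 0 <= t -> t <= T -> t <= tau ->
    scalar_energy x (y t) (v t) t <= Cp * expR (cp * x * Theta tau + 1) * S.
  move=> t0 tT tt; apply: le_trans (pseudo_zone x0 w t0 tT) _.
  rewrite ler_wpM2r// ler_pM2l// ler_expR lerD2r ler_wpM2l ?Theta_mono//.
  by rewrite mulr_ge0// ltW.
have [tT|tT] := leP T tau.
  apply: le_trans (pz T T0 (lexx T) tT) _; rewrite ler_wpM2r// mulrDl ler_wpDl//.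
    rewrite mulr_ge0 ?expR_ge0// mulr_ge0 ?expR_ge0// mulr_ge0 ?(ltW Ch0)//.
    by rewrite addr_ge0// ltW.
  rewrite -[leRHS]mulrA ler_pM2l// (le_trans _ (Wabs 1))// ler_expR lerD2r -(mulrA cp) -(mulrA c).
  by rewrite ler_wpM2r ?lerDr// mulr_ge0 ?(ltW x0)// ltW// Theta_gt0.
(* If [N / x < Lam 0], then [tau] is 0 by convention and the inequality still holds: the WKB
   estimate covers all of [[0, T]]. *)
have h1 : N <= x * Lam tau.
  by rewrite -ler_pdivrMl// mulrC; exact: Lam_Linv_ge.
apply: le_trans (hyp x y v f tau T T x0 w tau0 (ltW tT) (lexx T) h1) _.
pose H := (1 + T) * hint 0 T (fun t => f t ^+ 2); rewrite -/H.
have H0' : 0 <= H by apply: mulr_ge0 => //; exact: ltW.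
have HS : H <= S by rewrite /S lerDr.
have xT0 : 0 <= x * Theta tau by rewrite mulr_ge0 ?(ltW x0)// ltW// Theta_gt0.
have e1 : 1 <= expR (cp * x * Theta tau + 1).
  by rewrite -expR0 ler_expR addr_ge0// -mulrA mulr_ge0.
have h2 : scalar_energy x (y tau) (v tau) tau + H <=
    (Cp + 1) * expR (cp * x * Theta tau + 1) * S.
  rewrite -mulrA mulrDl mul1r mulrA; apply: lerD; first by apply: pz => //; exact: ltW.
  by rewrite (le_trans HS)// ler_peMl.
apply: (@le_trans _ _ (Ch * expR (ch * x * Theta tau + 1) *
   ((Cp + 1) * expR (cp * x * Theta tau + 1) * S))).
  by rewrite ler_wpM2l// mulr_ge0 ?expR_ge0// ltW.
have -> : Ch * expR (ch * x * Theta tau + 1) * ((Cp + 1) * expR (cp * x * Theta tau + 1) * S) =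
    Ch * (Cp + 1) * expR (c * x * Theta tau + 2) * S.
  have -> : c * x * Theta tau + 2 = (ch * x * Theta tau + 1) + (cp * x * Theta tau + 1).
    by rewrite /c; ring.
  by rewrite (expRD (ch * x * _ + 1)); ring.
rewrite ler_wpM2r// [leRHS]mulrDl ler_wpDr//.
  by rewrite mulr_ge0 ?expR_ge0// mulr_ge0 ?expR_ge0// ltW.
rewrite -[leRHS]mulrA ler_wpM2l//.
by rewrite mulr_ge0 ?(ltW Ch0)// addr_ge0// ltW.
Qed.

End scalar_estimate.

(** * Tonelli's theorem on measurable rectangles *)

Section tonelli_rectangle.
Context d1 d2 (T1 : measurableType d1) (T2 : measurableType d2) (R : realType).
Variables (m1 : {sigma_finite_measure set T1 -> \bar R})
          (m2 : {sigma_finite_measure set T2 -> \bar R}).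
Variables (D1 : set T1) (D2 : set T2).
Hypotheses (mD1 : measurable D1) (mD2 : measurable D2).
Variable h : T1 * T2 -> \bar R.
Hypothesis mh : measurable_fun (D1 `*` D2) h.
Hypothesis h0 : forall p, (0 <= h p)%E.

(** Extension by zero, which reduces a rectangle to the whole product space. *)
Let hr := h \_ (D1 `*` D2).

Let mhr : measurable_fun setT hr.
Proof.
apply/(measurable_restrictT _ _).1 => //; exact: measurableX.
Qed.

Let hr0 p : (0 <= hr p)%E.
Proof. by rewrite /hr patchE; case: ifP. Qed.

Lemma tonelli_rectangle1 :
  (\int[m1 \x m2]_(p in D1 `*` D2) h p =
   \int[m1]_(x in D1) \int[m2]_(y in D2) h (x, y))%E.
Proof.
rewrite integral_mkcond fubini_tonelli1//.
rewrite [RHS]integral_mkcond; apply: eq_integral => x _.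
rewrite /fubini_F patchE; case: ifPn => [|].
  rewrite inE => D1x; rewrite [RHS]integral_mkcond; apply: eq_integral => y _.
  rewrite !patchE; case: ifPn => [|].
    by rewrite inE => -[_ D2y]; rewrite mem_set.
  by rewrite notin_setE => nD; rewrite memNset// => D2y; apply: nD.
rewrite notin_setE => nD1; apply: integral0_eq => y _.
by rewrite patchE memNset// => -[].
Qed.

Lemma tonelli_rectangle2 :
  (\int[m1 \x m2]_(p in D1 `*` D2) h p =
   \int[m2]_(y in D2) \int[m1]_(x in D1) h (x, y))%E.
Proof.
rewrite integral_mkcond fubini_tonelli2//.
rewrite [RHS]integral_mkcond; apply: eq_integral => y _.
rewrite /fubini_G patchE; case: ifPn => [|].
  rewrite inE => D2y; rewrite [RHS]integral_mkcond; apply: eq_integral => x _.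
  rewrite !patchE; case: ifPn => [|].
    by rewrite inE => -[D1x _]; rewrite mem_set.
  by rewrite notin_setE => nD; rewrite memNset// => D1x; apply: nD.
rewrite notin_setE => nD2; apply: integral0_eq => x _.
by rewrite patchE memNset// => -[].
Qed.

Lemma measurable_tonelli_rectangle :
  measurable_fun D2 (fun y => \int[m1]_(x in D1) h (x, y))%E.
Proof.
have mG : measurable_fun D2 (fubini_G m1 hr).
  by apply: measurable_funTS; exact: measurable_fun_fubini_tonelli_G.
apply: eq_measurable_fun mG => y; rewrite inE => D2y.
rewrite /fubini_G [RHS]integral_mkcond; apply: eq_integral => x _.
rewrite /hr !patchE; case: ifPn => [|].
  by rewrite inE => -[D1x _]; rewrite mem_set.
by rewrite notin_setE => nD; rewrite memNset// => D1x; apply: nD.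
Qed.

Lemma measurable_tonelli_rectangle1 :
  measurable_fun D1 (fun x => \int[m2]_(y in D2) h (x, y))%E.
Proof.
have mF : measurable_fun D1 (fubini_F m2 hr).
  by apply: measurable_funTS; exact: measurable_fun_fubini_tonelli_F.
apply: eq_measurable_fun mF => x; rewrite inE => D1x.
rewrite /fubini_F [RHS]integral_mkcond; apply: eq_integral => y _.
rewrite /hr !patchE; case: ifPn => [|].
  by rewrite inE => -[_ D2y]; rewrite mem_set.
by rewrite notin_setE => nD; rewrite memNset// => D2y; apply: nD.
Qed.

End tonelli_rectangle.

(** * The torus and integrals of cosines over it *)

Section torus.
Context {R : realType}.
Local Notation pi := (@pi R).

Lemma torus_consE d :
  @consT R d @^-1` torus d.+1 = [set x | x \in `[- pi, pi]] `*` torus d :> set (R * d.-tuple R).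
Proof.
apply/seteqP; split=> -[x y] /= H.
  split; first exact: (H ord0).
  by move=> j; have := H (lift ord0 j); rewrite tnthS.
by move=> j; case: (unliftP ord0 j) => [i ->|->]; [rewrite tnthS; exact: H.2|exact: H.1].
Qed.

Lemma measurable_torus d : measurable (torus d : set (d.-tuple R)).
Proof.
rewrite (_ : torus d = \bigcap_(i in [set: 'I_d])
    ((fun y : d.-tuple R => tnth y i) @^-1` [set` `[- pi, pi]])).
  apply: fin_bigcap_measurable => // i _.
  by rewrite -[X in measurable X]setTI; exact: measurable_tnth.
by apply/seteqP; split => y /= H i; [move=> _; exact: H|exact: H].
Qed.

Lemma measurable_angle d (p : R) (k : 'I_d -> int) (D : set (d.-tuple R)) :
  measurable_fun D (fun y : d.-tuple R => p + \sum_(j < d) (k j)%:~R * tnth y j).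
Proof.
apply: measurable_funTS; apply: measurable_funD; first exact: measurable_cst.
by apply: measurable_sum => j; apply: measurable_funM => //; exact: measurable_tnth.
Qed.

Lemma measurable_trig (f : R -> R) d (p : R) (k : 'I_d -> int) (D : set (d.-tuple R)) :
  continuous f ->
  measurable_fun D (fun y : d.-tuple R => f (p + \sum_(j < d) (k j)%:~R * tnth y j)).
Proof.
move=> cf; apply: measurableT_comp; last exact: measurable_angle.
exact: continuous_measurable_fun.
Qed.

Lemma sin_intpi (k : int) : sin (k%:~R * pi) = 0 :> R.
Proof.
have sn (n : nat) : sin (n%:R * pi) = 0 :> R.
  elim: n => [|n IH]; first by rewrite mul0r sin0.
  by rewrite -natr1 mulrDl mul1r sinD IH sinpi mulr0 mul0r addr0.
case: k => n; first exact: sn.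
by rewrite NegzE mulrNz mulNr sinN sn oppr0.
Qed.

Lemma integral_cos1 (k : int) (p : R) :
  (\int[lebesgue_measure]_(x in `[(- pi)%R, pi%R]) (1 + cos (p + k%:~R * x))%:E =
   (2 * pi * (1 + (k == 0)%:R * cos p))%:E)%E.
Proof.
have pi0 : 0 < pi := pi_gt0 R.
have [->|k0] := eqVneq k 0.
  rewrite (eq_integral (cst (1 + cos p)%:E)); last by move=> x _; rewrite mul0r addr0.
  rewrite integral_cst//= lebesgue_measure_itv/=.
  by rewrite lte_fin gtrN// -EFinD -EFinM opprK mul1r; congr EFin; ring.
have kR0 : k%:~R != 0 :> R by rewrite intr_eq0.
pose F x : R := x + sin (p + k%:~R * x) / k%:~R.
have dang x : is_derive x (1:R) (fun x : R => p + k%:~R * x) k%:~R.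
  rewrite (_ : (fun _ => _) = cst p + k%:~R \*: id)//.
  by apply: is_derive_eq; rewrite add0r /GRing.scale/= mulr1.
have dF x : is_derive x (1:R) F (1 + cos (p + k%:~R * x)).
  have dsin := @is_derive1_comp _ sin _ x _ _ (is_derive_sin _) (dang x).
  rewrite (_ : F = id + k%:~R^-1 \*: (sin \o (fun x => p + k%:~R * x))); last first.
    by apply/funext => y; rewrite /F mulrC.
  by apply: is_derive_eq; rewrite /GRing.scale/= mulrCA mulVf// mulr1.
have cF : continuous F.
  by move=> x; apply/differentiable_continuous/derivable1_diffP; have [] := dF x.
rewrite (@continuous_FTC2 _ _ F) ?gtrN//.
- rewrite -EFinB /F !mulrN; congr EFin.
  by rewrite !sinD sinN cosN sin_intpi mul0r addr0; ring.
- apply: continuous_subspaceT => x; apply: cvgD; first exact: cvg_cst.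
  apply: continuous_comp; last exact: continuous_cos.
  by apply/differentiable_continuous/derivable1_diffP; have [] := dang x.
- split.
  + by move=> x _; have [] := dF x.
  + exact/cvg_at_right_filter/cF.
  + exact/cvg_at_left_filter/cF.
- by move=> x _; rewrite derive1E derive_val.
Qed.

Lemma ge0_integral_lebesgue_cons d (f : d.+1.-tuple R -> \bar R) :
  measurable_fun (torus d.+1) f -> (forall y, 0 <= f y)%E ->
  (\int[lebesgueT d.+1]_(y in torus d.+1) f y =
   \int[lebesgue_measure]_(x in `[(- pi)%R, pi%R]) \int[lebesgueT d]_(y in torus d) f (consT (x, y)))%E.
Proof.
move=> mf f0; have mcons := @measurable_consT R d.
transitivity (\int[pushforward (lebesgue_measure \x lebesgueT d)%E (@consT R d)]_(y in torus d.+1) f y)%E.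
  exact: eq_measure_integral.
rewrite ge0_integral_pushforward//; last exact: measurable_torus.
rewrite torus_consE (@tonelli_rectangle1 _ _ _ _ _ lebesgue_measure (lebesgueT d)) //.
  exact: measurable_torus.
apply: measurable_comp mf _ => //; first exact: measurable_torus.
  by rewrite -torus_consE => _ [p + <-].
  exact: measurable_funTS.
by move=> p; exact: f0.
Qed.

(** The summand 1 makes the integrand nonnegative, so that Tonelli's theorem peels off one
    coordinate at a time; the phase [p] takes up the coordinate that has been split off. *)
Lemma integral_torus_cos d (k : 'I_d -> int) (p : R) :
  (\int[lebesgueT d]_(y in torus d) (1 + cos (p + \sum_(j < d) (k j)%:~R * tnth y j))%:E =
   ((2 * pi) ^+ d * (1 + [forall j, k j == 0]%:R * cos p))%:E)%E.
Proof.
have cos1 (x : R) : 0 <= 1 + cos x by have := cos_geN1 x; lra.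
elim: d k p => [|d IH] k p.
  transitivity (\int[\d_([tuple] : 0.-tuple R)]_(y in torus 0)
      (1 + cos (p + \sum_(j < 0) (k j)%:~R * tnth y j))%:E)%E.
    exact: eq_measure_integral.
  rewrite integral_dirac; [|exact: measurable_torus|].
    rewrite diracE mem_set//=; last by case.
    rewrite mul1e big_ord0 addr0 expr0 mul1r.
    by rewrite (_ : [forall j, _])// ?mul1r//; apply/forallP => -[].
  apply/measurable_EFinP; apply: measurable_funD; first exact: measurable_cst.
  by apply: measurable_trig; exact: continuous_cos.
rewrite ge0_integral_lebesgue_cons; last first.
- by move=> y; rewrite lee_fin.
- apply/measurable_EFinP; apply: measurable_funD; first exact: measurable_cst.
  by apply: measurable_trig; exact: continuous_cos.
pose k' j := k (lift ord0 j).
transitivity (\int[lebesgue_measure]_(x in `[(- pi)%R, pi%R])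
    ((2 * pi) ^+ d * (1 + [forall j, k' j == 0]%:R * cos (p + (k ord0)%:~R * x)))%:E)%E.
  apply: eq_integral => x _; rewrite -IH; apply: eq_integral => y _.
  congr (1 + cos _)%:E; rewrite big_ord_recl addrA.
  by congr (_ + _); apply: eq_bigr => j _; rewrite tnthS.
have f0 : [forall j, k j == 0] = (k ord0 == 0) && [forall j, k' j == 0].
  apply/idP/idP => [/forallP H|/andP[H0 /forallP H]].
    by rewrite H; apply/forallP => j; exact: H.
  by apply/forallP => j; case: (unliftP ord0 j) => [i ->|->//]; exact: H.
under eq_integral do rewrite EFinM.
rewrite ge0_integralZl//; last 3 first.
- apply/measurable_EFinP; apply: measurable_funD; first exact: measurable_cst.
  apply: measurable_funM; first exact: measurable_cst.
  apply: measurableT_comp; first by apply: continuous_measurable_fun; exact: continuous_cos.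
  by apply: measurable_funD; [exact: measurable_cst|exact: measurable_funM].
- by move=> x _; rewrite lee_fin; case: [forall j, _]; rewrite ?mul1r// mul0r addr0.
- by rewrite lee_fin exprn_ge0// mulr_ge0// pi_ge0.
rewrite f0; case: [forall j, k' j == 0]; rewrite ?andbT ?andbF.
  under eq_integral do rewrite mul1r.
  by rewrite integral_cos1 -EFinM exprSr; congr EFin; ring.
rewrite (eq_integral (cst 1)%E); last by move=> x _; rewrite mulr0n mul0r addr0.
rewrite integral_cst//= mul1e lebesgue_measure_itv/= lte_fin gtrN ?pi_gt0//.
by rewrite -EFinD -EFinM opprK; congr EFin; rewrite exprSr mulr0n; ring.
Qed.

End torus.

(** * Trigonometric polynomials and Parseval's identity for finite sums *)

Section trigonometric_polynomials.
Context {R : realType} {d : nat}.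
Local Notation pi := (@pi R).
Local Notation mu := (lebesgueT d : set (d.-tuple R) -> \bar R).
Implicit Types (k l : 'rV[int]_d) (p : R) (y : d.-tuple R).

Lemma normc_sqrE (z : R[i]) : normc z ^+ 2 = complex.Re z ^+ 2 + complex.Im z ^+ 2.
Proof. by case: z => u v /=; rewrite sqr_sqrtr// addr_ge0 ?sqr_ge0. Qed.

Lemma dotpB k l y : dotp (k - l) y = dotp k y - dotp l y.
Proof.
rewrite /dotp -sumrB; apply: eq_bigr => j _.
by rewrite !mxE rmorphB mulrBl.
Qed.

Lemma lebesgueT_torus : lebesgueT d (torus d) = ((2 * pi) ^+ d)%:E :> \bar R.
Proof.
rewrite (lebesgueT_box (A := fun=> [set` `[- pi, pi]])); last by move=> i.
under eq_bigr do rewrite lebesgue_measure_itv/= lte_fin gtrN ?pi_gt0// -EFinD opprK.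
rewrite (eq_bigr (fun=> (2 * pi)%:E)); last by move=> i _; congr EFin; ring.
by rewrite prodEFin prodr_const card_ord.
Qed.

Lemma lebesgueT_torus_lty : (lebesgueT d (torus d : set (d.-tuple R)) < +oo)%E.
Proof. by rewrite lebesgueT_torus ltry. Qed.

Lemma integrable_bounded (f : d.-tuple R -> R) (M : R) :
  measurable_fun (torus d) f -> (forall y, `|f y| <= M) ->
  (lebesgueT d).-integrable (torus d) (EFin \o f).
Proof.
move=> mf fM; apply: measurable_bounded_integrable => //.
- exact: measurable_torus.
- exact: lebesgueT_torus_lty.
- exists M; split; first exact: num_real.
  by move=> x Mx y _ /=; rewrite (le_trans (fM y))// ltW.
Qed.

Lemma measurable_cos_dotp p k (D : set (d.-tuple R)) :
  measurable_fun D (fun y => cos (p + dotp k y)).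
Proof. by apply: measurable_trig; exact: continuous_cos. Qed.

Lemma integrable_cos_dotp p k :
  (lebesgueT d).-integrable (torus d) (EFin \o (fun y => cos (p + dotp k y))).
Proof.
apply: (@integrable_bounded _ 1); first exact: measurable_cos_dotp.
by move=> y; rewrite ler_norml cos_geN1 cos_le1.
Qed.

Lemma Rintegral_cos_dotp p k :
  \int[lebesgueT d]_(y in torus d) cos (p + dotp k y) =
  (2 * pi) ^+ d * ((k == 0)%:R * cos p).
Proof.
have := integral_torus_cos (fun j => k 0 j) p.
under eq_integral do rewrite EFinD.
have mt := @measurable_torus R d.
have i1 : (lebesgueT d).-integrable (torus d) (EFin \o (cst 1 : d.-tuple R -> R)).
  by apply: (@integrable_bounded (fun=> 1) 1) => // y; rewrite normr1.
have ic := integrable_cos_dotp p k.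
have c1 : (\int[lebesgueT d]_(y in torus d) (EFin \o cst 1%R) y = ((2 * pi) ^+ d)%:E)%E.
  by rewrite (integral_cst _ mt 1%:E) mul1e; exact: lebesgueT_torus.
rewrite integralD_EFin// c1.
rewrite (_ : [forall j, _] = (k == 0)); last first.
  apply/forallP/eqP => [H|-> j]; last by rewrite mxE.
  by apply/rowP => j; rewrite mxE; apply/eqP/H.
rewrite /Rintegral => H.
have fi := integrable_fin_num mt ic.
have {}H : (2 * pi) ^+ d + fine (\int[lebesgueT d]_(x in torus d) (cos (p + dotp k x))%:E)%E =
    (2 * pi) ^+ d * (1 + (k == 0)%:R * cos p).
  by apply: EFin_inj; rewrite EFinD fineK.
by apply: (@addrI _ ((2 * pi) ^+ d)); rewrite H; ring.
Qed.

Lemma integrable_torusD (f g : d.-tuple R -> R) :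
  (lebesgueT d).-integrable (torus d) (EFin \o f) ->
  (lebesgueT d).-integrable (torus d) (EFin \o g) ->
  (lebesgueT d).-integrable (torus d) (EFin \o (fun y => f y + g y)).
Proof.
move=> fi gi; rewrite (_ : _ \o _ = (EFin \o f) \+ (EFin \o g))%E//.
by apply: integrableD => //; exact: measurable_torus.
Qed.

Lemma Rintegral_sum_torus (I : Type) (s : seq I) (f : I -> d.-tuple R -> R) :
  (forall i, (lebesgueT d).-integrable (torus d) (EFin \o f i)) ->
  (lebesgueT d).-integrable (torus d) (EFin \o (fun y => \sum_(i <- s) f i y)) /\
  \int[lebesgueT d]_(y in torus d) (\sum_(i <- s) f i y) =
  \sum_(i <- s) \int[lebesgueT d]_(y in torus d) f i y.
Proof.
move=> fi; have mt := @measurable_torus R d; elim: s => [|i s [IH1 IH2]].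
  under [X in EFin \o X]eq_fun do rewrite big_nil.
  split; first by apply: (@integrable_bounded (fun=> 0) 0) => // y; rewrite normr0.
  under eq_Rintegral do rewrite big_nil.
  by rewrite big_nil Rintegral_cst// mul0r.
under [X in EFin \o X]eq_fun do rewrite big_cons.
split; first exact: integrable_torusD.
under eq_Rintegral do rewrite big_cons.
by rewrite RintegralD// IH2 big_cons.
Qed.

(** Sines are written as cosines shifted by - pi / 2, so that [Rintegral_cos_dotp] integrates every
    term. *)
Lemma normc_trig_sum (s : seq 'rV[int]_d) (c : 'rV[int]_d -> R[i]) y :
  normc (\sum_(k <- s) expi (- dotp k y) * c k) ^+ 2 =
  \sum_(k <- s) \sum_(l <- s)
    ((complex.Re (c k) * complex.Re (c l) + complex.Im (c k) * complex.Im (c l)) *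
       cos (0 + dotp (k - l) y) +
     (complex.Im (c k) * complex.Re (c l) - complex.Re (c k) * complex.Im (c l)) *
       cos (- (pi / 2) + dotp (k - l) y)).
Proof.
rewrite normc_sqrE !raddf_sum/= !expr2 !big_distrl -big_split/=.
apply: eq_bigr => k _; rewrite !big_distrr -big_split/=; apply: eq_bigr => l _.
rewrite add0r [- _ + _]addrC cosB cos_pihalf sin_pihalf mulr0 mulr1 add0r.
rewrite dotpB cosB sinB.
case: (c k) => u v; case: (c l) => u' v' /=.
by rewrite !cosN !sinN; ring.
Qed.

Lemma integral_normc_trig_sum (s : seq 'rV[int]_d) (c : 'rV[int]_d -> R[i]) :
  uniq s ->
  (\int[lebesgueT d]_(y in torus d) (normc (\sum_(k <- s) expi (- dotp k y) * c k) ^+ 2)%:E =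
   ((2 * pi) ^+ d * \sum_(k <- s) normc (c k) ^+ 2)%:E)%E.
Proof.
move=> us; under eq_integral do rewrite normc_trig_sum.
pose A k l := complex.Re (c k) * complex.Re (c l) + complex.Im (c k) * complex.Im (c l).
pose B k l := complex.Im (c k) * complex.Re (c l) - complex.Re (c k) * complex.Im (c l).
pose f k l y := A k l * cos (0 + dotp (k - l) y) + B k l * cos (- (pi / 2) + dotp (k - l) y).
have mt := @measurable_torus R d.
have iZ (r p : R) k : (lebesgueT d).-integrable (torus d)
    (EFin \o (fun y => r * cos (p + dotp k y))).
  rewrite (_ : _ \o _ = fun y => (r%:E * (EFin \o (fun y => cos (p + dotp k y))) y)%E)//.
  by apply: integrableZl => //; exact: integrable_cos_dotp.
have fi k l : (lebesgueT d).-integrable (torus d) (EFin \o f k l).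
  exact: integrable_torusD.
have If k l : \int[lebesgueT d]_(y in torus d) f k l y = (2 * pi) ^+ d * ((k == l)%:R * A k l).
  rewrite RintegralD//; [|exact: iZ..].
  rewrite !RintegralZl//; [|exact: integrable_cos_dotp..].
  by rewrite !Rintegral_cos_dotp cos0 cosN cos_pihalf subr_eq0; ring.
have [fs1 fs2] := Rintegral_sum_torus s (fun k => (Rintegral_sum_torus s (fi k)).1).
rewrite -(fineK (integrable_fin_num mt fs1)); congr EFin.
transitivity (\int[lebesgueT d]_(y in torus d) (\sum_(k <- s) \sum_(l <- s) f k l y)) => //.
rewrite fs2 big_distrr/=; apply: eq_big_seq => k ks.
rewrite (Rintegral_sum_torus s (fi k)).2.
under eq_bigr do rewrite If.
rewrite (bigD1_seq k)//= eqxx mul1r big1 ?addr0.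
  by rewrite /A normc_sqrE !expr2.
by move=> l lk; rewrite eq_sym (negbTE lk) mul0r mulr0.
Qed.

End trigonometric_polynomials.

(** * Square-summable functions on the lattice and their tails *)

Section square_summable.
Context {R : realType} {d : nat}.
Local Notation pi := (@pi R).
Implicit Types (f g h : 'rV[int]_d -> R[i]) (k l : 'rV[int]_d) (s : seq 'rV[int]_d).

Lemma sqr_normcD (z w : R[i]) : normc (z + w) ^+ 2 <= 2 * normc z ^+ 2 + 2 * normc w ^+ 2.
Proof.
rewrite !normc_sqrE; case: z => a b; case: w => a' b' /=.
by have := sqr_ge0 (a - a'); have := sqr_ge0 (b - b'); lra.
Qed.

Lemma sqr_normcM (z w : R[i]) : normc (z * w) ^+ 2 = normc z ^+ 2 * normc w ^+ 2.
Proof. by rewrite !normc_sqrE; case: z => a b; case: w => a' b' /=; ring. Qed.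

Lemma sqr_normcN (z : R[i]) : normc (- z) ^+ 2 = normc z ^+ 2.
Proof. by rewrite !normc_sqrE; case: z => a b /=; rewrite !sqrrN. Qed.

Lemma normc0_ : normc (0 : R[i]) = 0.
Proof. by rewrite /= expr0n/= addr0 sqrtr0. Qed.

Lemma sqnorm_ge0 f : (0 <= sqnorm f)%E.
Proof. by apply: esum_ge0 => k _; rewrite lee_fin sqr_ge0. Qed.

Lemma le_sqnorm f g : (forall k, normc (f k) ^+ 2 <= normc (g k) ^+ 2) ->
  (sqnorm f <= sqnorm g)%E.
Proof. by move=> fg; apply: le_esum => k _; rewrite lee_fin. Qed.

Lemma sum_le_sqnorm f s : uniq s ->
  ((\sum_(k <- s) normc (f k) ^+ 2)%:E <= sqnorm f)%E.
Proof.
move=> us; rewrite -sumEFin.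
have -> : (\sum_(k <- s) (normc (f k) ^+ 2)%:E)%E =
   (\sum_(k \in [set` s]) (normc (f k) ^+ 2)%:E)%E by rewrite fsbig_seq.
apply: esum_ge; exists [set` s] => //.
by split => //; exact: finite_seq.
Qed.

Lemma sqnorm_le f (M : \bar R) :
  (forall s, uniq s -> ((\sum_(k <- s) normc (f k) ^+ 2)%:E <= M)%E) ->
  (sqnorm f <= M)%E.
Proof.
move=> H; apply: ge_ereal_sup => _ [/= A [finA _] <-].
rewrite fsbig_finite//= sumEFin; apply: H; exact: finmap.fset_uniq.
Qed.

Lemma sqnormD f g : (sqnorm (fun k => f k + g k)%R <= 2%:E * sqnorm f + 2%:E * sqnorm g)%E.
Proof.
apply: sqnorm_le => s us.
apply: (@le_trans _ _ (2%:E * (\sum_(k <- s) normc (f k) ^+ 2)%:E +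
   2%:E * (\sum_(k <- s) normc (g k) ^+ 2)%:E)%E).
  rewrite -!EFinM -EFinD lee_fin !big_distrr -big_split/=.
  by apply: ler_sum => k _; exact: sqr_normcD.
by apply: leeD; rewrite lee_pmul2l// sum_le_sqnorm.
Qed.

Lemma finite_box n : finite_set (@box d n).
Proof.
pose F (M : 'rV['I_(n + n).+1]_d) : 'rV[int]_d := map_mx (fun i : 'I_(n + n).+1 => (i : nat)%:Z - n%:Z) M.
apply: (@sub_finite_set _ _ (F @` setT)); last exact: finite_image.
move=> k kn; exists (\row_(j < d) inord `|(k ord0 j + n%:Z)%R|%N) => //.
apply/rowP => j; rewrite !mxE.
have := kn j; rewrite ler_norml => /andP[h1 h2].
have h0 : 0 <= k 0 j + n%:Z by rewrite -lerBlDr sub0r.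
rewrite inordK ?gez0_abs// ?addrK//.
rewrite ltnS -lez_nat gez0_abs// PoszD lerD2r//.
Qed.

Definition boxs n : seq 'rV[int]_d := finmap.enum_fset (fset_set (@box d n)).

Lemma boxs_uniq n : uniq (boxs n).
Proof. exact: finmap.fset_uniq. Qed.

Lemma mem_boxs n k : (k \in boxs n) = (k \in box n).
Proof. by rewrite /boxs in_fset_set//; exact: finite_box. Qed.

Lemma box_le m n k : (m <= n)%N -> k \in box m -> k \in box n.
Proof.
move=> mn /set_mem km; apply/mem_set => j; apply: le_trans (km j) _.
by rewrite lez_nat.
Qed.

Lemma fourier_sumE f n y : fourier_sum f n y = \sum_(k <- boxs n) expi (- dotp k y) * f k.
Proof. by rewrite /fourier_sum fsbig_finite//; exact: finite_box. Qed.

Definition off n f k : R[i] := if k \in box n then 0 else f k.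

Lemma offD n f g k : off n (fun k => f k + g k) k = off n f k + off n g k.
Proof. by rewrite /off; case: ifP; rewrite ?addr0. Qed.

Lemma off_normc n f k : normc (off n f k) ^+ 2 <= normc (f k) ^+ 2.
Proof. by rewrite /off; case: ifP => // _; rewrite normc0_ expr0n sqr_ge0. Qed.

Lemma seq_box s : exists n, {subset s <= box n}.
Proof.
elim: s => [|k s [n sn]]; first by exists 0%N.
exists (maxn n (\max_(j < d) `|k ord0 j|%N)) => l; rewrite inE => /predU1P[->|ls].
  apply/mem_set => j; rewrite -abszE lez_nat leq_max; apply/orP; right.
  exact: (leq_bigmax (F := fun j => `|k ord0 j|%N)).
by apply: box_le (sn _ ls); exact: leq_maxl.
Qed.

(** Some finite set [s] carries all of the norm but [e], and some box contains [s]. A finite set of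
    points outside that box is disjoint from [s], so adding its sum to that of [s] cannot exceed the
    full norm. *)
Lemma sqnorm_off_small f (e : R) : l2 f -> 0 < e ->
  exists N, forall n, (N <= n)%N -> (sqnorm (off n f) <= e%:E)%E.
Proof.
move=> f2 e0.
have fin : sqnorm f \is a fin_num by rewrite ge0_fin_numE// sqnorm_ge0.
have [s us hs] : exists2 s, uniq s &
    (sqnorm f - e%:E <= (\sum_(k <- s) normc (f k) ^+ 2)%:E)%E.
  apply: contrapT => /forall2NP H.
  suff : (sqnorm f <= sqnorm f - e%:E)%E.
    by rewrite -(fineK fin) -EFinB lee_fin; lra.
  apply: sqnorm_le => s us; have [//|/negP] := H s.
  by rewrite -ltNge => /ltW.
have [N sN] := seq_box s; exists N => n Nn.
apply: sqnorm_le => r ur.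
pose r' := [seq k <- r | k \notin box n].
have -> : \sum_(k <- r) normc (off n f k) ^+ 2 = \sum_(k <- r') normc (f k) ^+ 2.
  rewrite big_filter [RHS]big_mkcond/=; apply: eq_bigr => k _.
  by rewrite /off; case: ifP => // _; rewrite normc0_ expr0n.
have : ((\sum_(k <- s ++ r') normc (f k) ^+ 2)%:E <= sqnorm f)%E.
  apply: sum_le_sqnorm; rewrite cat_uniq us filter_uniq// andbT/=.
  apply/hasPn => k; rewrite mem_filter => /andP[kn _].
  by apply: contra kn => /sN; exact: box_le.
move: hs; rewrite -(fineK fin) -EFinB !lee_fin big_cat/=; lra.
Qed.

End square_summable.

(** * Consequences of Fatou's lemma and completeness of L^2 *)

Section L2_complete.
Context dT (T : measurableType dT) (R : realType) (mu : {measure set T -> \bar R}).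
Variable D : set T.
Hypothesis mD : measurable D.

Lemma ge0_integral_le0_ae (f : T -> \bar R) : measurable_fun D f ->
  (forall x, D x -> 0 <= f x)%E -> (\int[mu]_(x in D) f x <= 0)%E ->
  {ae mu, forall x, D x -> f x = 0%E}.
Proof.
move=> mf f0 If; apply/(ae_eq_integral_abs mu mD mf).
rewrite (eq_integral f); last by move=> x /set_mem Dx; rewrite gee0_abs ?f0.
by apply/eqP; rewrite eq_le If integral_ge0.
Qed.

Lemma fatou_le (f : nat -> T -> \bar R) (e : \bar R) N :
  (forall n, measurable_fun D (f n)) -> (forall n x, D x -> 0 <= f n x)%E ->
  (forall n, (N <= n)%N -> \int[mu]_(x in D) f n x <= e)%E ->
  (\int[mu]_(x in D) limn_einf (f^~ x) <= e)%E.
Proof.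
move=> mf f0 fe; apply: le_trans (fatou mu mD mf f0) _.
rewrite limn_einf_lim; apply: lime_le; first exact: is_cvg_einfs.
apply: nearW => n; apply: le_trans (fe (maxn n N) (leq_maxr _ _)).
by apply: ereal_inf_lbound; exists (maxn n N) => //=; exact: leq_maxl.
Qed.

Lemma measurable_limn_einf (f : nat -> T -> \bar R) :
  (forall n, measurable_fun D (f n)) ->
  measurable_fun D (fun x => limn_einf (f^~ x)).
Proof.
move=> mf; apply: measurableT_comp => //.
by apply: measurable_fun_limn_esup => n; exact: measurableT_comp.
Qed.

Lemma limn_einf_ge (u : nat -> \bar R) (e : \bar R) N :
  (forall n, (N <= n)%N -> e <= u n)%E -> (e <= limn_einf u)%E.
Proof.
move=> eu; rewrite limn_einf_lim; apply: lime_ge; first exact: is_cvg_einfs.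
exists N => // n /= Nn; apply: le_ereal_inf_tmp => _ [k /= nk <-].
by apply: eu; exact: leq_trans nk.
Qed.

(** By Fatou's lemma the lower limit of [f n] vanishes almost everywhere. This replaces the
    extraction of an almost everywhere convergent subsequence: the index [n] may depend on the
    point, but one null set serves all [e] and [N]. *)
Lemma integral_small_ae (f : nat -> T -> R) :
  (forall n, measurable_fun D (f n)) -> (forall n x, D x -> 0 <= f n x) ->
  (forall e : R, 0 < e -> exists N, forall n, (N <= n)%N ->
     (\int[mu]_(x in D) (f n x)%:E <= e%:E)%E) ->
  {ae mu, forall x, D x -> forall (e : R) N, 0 < e -> exists2 n, (N <= n)%N & f n x < e}.
Proof.
move=> mf f0 fe.
have mfE n : measurable_fun D (EFin \o f n) by exact/measurable_EFinP.
have f0E n x : D x -> (0 <= (EFin \o f n) x)%E by move=> Dx; rewrite lee_fin f0.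
have : {ae mu, forall x, D x -> limn_einf (fun n => (EFin \o f n) x) = 0%E}.
  apply: ge0_integral_le0_ae.
  - exact: measurable_limn_einf.
  - by move=> x Dx; apply: (@limn_einf_ge _ _ 0%N) => n _; exact: f0E.
  - apply/lee_addgt0Pr => e e0; rewrite add0e.
    by have [N HN] := fe e e0; apply: fatou_le HN.
apply: filterS => x H Dx e N e0; apply: contrapT => /forall2NP h.
have : (e%:E <= limn_einf (fun n => (EFin \o f n) x))%E.
  apply: (@limn_einf_ge _ _ N) => n Nn; rewrite lee_fin leNgt; apply/negP.
  by have [|] := h n.
by rewrite H// lee_fin leNgt e0.
Qed.

(** The Riesz-Fischer argument: a fast subsequence converges almost everywhere because its
    increments are dominated by a geometric series, and Fatou's lemma shows that the pointwise limit
    is also the limit in mean square of the whole sequence. *)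
Lemma L2_complete (u : nat -> T -> R) :
  (forall n, measurable_fun D (u n)) ->
  (forall e : R, 0 < e -> exists N, forall m n, (N <= m)%N -> (N <= n)%N ->
     (\int[mu]_(x in D) ((u m x - u n x) ^+ 2)%:E <= e%:E)%E) ->
  exists2 g : T -> R, measurable_fun D g &
    forall e : R, 0 < e -> exists N, forall n, (N <= n)%N ->
     (\int[mu]_(x in D) ((u n x - g x) ^+ 2)%:E <= e%:E)%E.
Proof.
move=> mu_ cu.
(* After multiplication by [4 ^+ j] the squared increments still have summable integrals. At almost
   every point these weighted squares are then bounded in [j], so the increments are O(2^-j). *)
pose eps j : R := (1 / (2 ^ j.+1)%:R) / 4 ^+ j.
have eps0 j : 0 < eps j by rewrite !divr_gt0 ?ltr0n ?expn_gt0 ?exprn_gt0.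
have [N HN] := choice (fun j => cu (eps j) (eps0 j)).
(* The sum of the [N i] makes [K j] exceed all thresholds up to [j]; the summand [j] makes [K j] at
   least [j]. *)
pose K j := (j + \sum_(i < j.+1) N i)%N.
have NK i j : (i <= j)%N -> (N i <= K j)%N.
  by move=> ij; rewrite /K (bigD1 (Ordinal (ij : (i < j.+1)%N)))//= addnCA leq_addr.
pose v j := u (K j).
have mv j : measurable_fun D (v j) by exact: mu_.
pose h j x := 4 ^+ j * (v j.+1 x - v j x) ^+ 2.
have h0 j x : 0 <= h j x by rewrite mulr_ge0 ?sqr_ge0// exprn_ge0.
have mh j : measurable_fun D (EFin \o h j).
  apply/measurable_EFinP; apply: measurable_funM; first exact: measurable_cst.
  by apply: measurable_funX; exact: measurable_funB.
have Ih j : (\int[mu]_(x in D) (h j x)%:E <= (1 / (2 ^ j.+1)%:R)%:E)%E.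
  under eq_integral do rewrite EFinM.
  rewrite ge0_integralZl//; last 2 first.
  - by apply/measurable_EFinP; apply: measurable_funX; exact: measurable_funB.
  - by move=> x _; rewrite lee_fin sqr_ge0.
  apply: (@le_trans _ _ ((4 ^+ j)%:E * (eps j)%:E)%E).
    by rewrite lee_pmul2l ?lte_fin ?exprn_gt0//; apply: HN; exact: NK.
  by rewrite -EFinM lee_fin /eps mulrC divfK// expf_neq0.
have Hfin : {ae mu, forall x, D x -> (\sum_(j <oo) (h j x)%:E)%E \is a fin_num}.
  apply: integrable_ae => //; apply/integrableP; split.
    apply: (@ge0_emeasurable_sum _ _ _ D (fun j => EFin \o h j) xpredT) => //.
    by move=> j x _ _; rewrite lee_fin.
  rewrite (eq_integral (fun x => \sum_(j <oo) (h j x)%:E)%E); last first.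
    by move=> x _; rewrite gee0_abs// nneseries_ge0// => j _ _; rewrite lee_fin.
  rewrite integral_nneseries//; last by move=> j x _; rewrite lee_fin.
  apply: (@le_lt_trans _ _ (\sum_(j <oo) (1 / (2 ^ j.+1)%:R)%:E)%E).
    by apply: lee_nneseries => [j _ _|j _]; [apply: integral_ge0 => x _; rewrite lee_fin|exact: Ih].
  by apply: le_lt_trans (epsilon_trick0 _ ler01) _; rewrite ltry.
have vcvg : {ae mu, forall x, D x -> cvgn (v^~ x)}.
  apply: filterS Hfin => x Hx Dx; have {}Hx := Hx Dx.
  pose r := fine (\sum_(j <oo) (h j x)%:E)%E.
  have hr j : h j x <= r.
    rewrite -lee_fin fineK//.
    apply: le_trans (@nneseries_lim_ge _ _ xpredT 0%N j.+1 _); last first.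
      by move=> i _ _; rewrite lee_fin.
    by rewrite big_nat_recr//= leeDr// sume_ge0// => i _; rewrite lee_fin.
  have r0 : 0 <= r by exact: le_trans (hr 0%N).
  have dB j : `|v j.+1 x - v j x| <= geometric (1 + r) (1 / 2) j.
    have h1 : 2 ^+ j * `|v j.+1 x - v j x| <= 1 + r.
      rewrite -(@ler_pXn2r _ 2) ?nnegrE ?mulr_ge0 ?addr_ge0 ?exprn_ge0//.
      rewrite exprMn real_normK ?num_real// -exprM mulnC exprM.
      have -> : 2 ^+ 2 = 4 :> R by ring.
      by apply: le_trans (hr j) _; have := sqr_ge0 r; lra.
    rewrite /= expr_div_n expr1n mul1r ler_pdivlMr ?exprn_gt0//.
    by rewrite mulrC.
  have cs : cvgn (series (telescope (v^~ x))).
    apply: normed_cvg; apply: series_le_cvg dB _ => [j//|j|].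
      by rewrite /= mulr_ge0 ?addr_ge0// exprn_ge0.
    by apply: is_cvg_geometric_series; rewrite ger0_norm//; lra.
  rewrite (_ : v^~ x = (fun n => v 0%N x + series (telescope (v^~ x)) n)); last first.
    by apply/funext => n; exact: (eq_sum_telescope (v^~ x)).
  by apply: is_cvgD => //; exact: is_cvg_cst.
(* The upper limit is measurable without any convergence and equals the limit wherever the
   subsequence converges; its other values concern a null set. *)
pose g x := fine (limn_esup (fun j => (v j x)%:E)).
have mg : measurable_fun D g.
  apply: measurableT_comp; first exact: fine_measurable.
  by apply: measurable_fun_limn_esup => j; exact/measurable_EFinP.
exists g => // e e0; have [M HM] := cu e e0; exists M => n Mn.
have ms j : measurable_fun D (fun x => ((u n x - v j x) ^+ 2)%:E).
  apply/measurable_EFinP; apply: measurable_funX; exact: measurable_funB.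
apply: (@le_trans _ _ (\int[mu]_(x in D) limn_einf (fun j => ((u n x - v j x) ^+ 2)%:E))%E); last first.
  apply: (@fatou_le _ _ M) => //.
  - by move=> j x _; rewrite lee_fin sqr_ge0.
  - move=> j Mj; apply: HM => //.
    by rewrite (leq_trans Mj)// leq_addr.
apply: ae_ge0_le_integral => //.
- by move=> x _; rewrite lee_fin sqr_ge0.
- apply/measurable_EFinP; apply: measurable_funX; exact: measurable_funB.
- by move=> x _; apply: (@limn_einf_ge _ _ 0%N) => j _; rewrite lee_fin sqr_ge0.
- exact: measurable_limn_einf.
apply: filterS vcvg => x H Dx; have {H}cv := H Dx.
have cvE : ((v j x)%:E @[j --> \oo] --> (limn (v^~ x))%:E)%E.
  by apply: cvg_EFin => //; exact: nearW.
have gE : g x = limn (v^~ x) by rewrite /g (cvg_limn_einf_sup cvE).2.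
rewrite gE; have -> // : (limn_einf (fun j => ((u n x - v j x) ^+ 2)%:E) = ((u n x - limn (v^~ x)) ^+ 2)%:E)%E.
apply: (fun c => (cvg_limn_einf_sup c).1).
apply: cvg_EFin; first exact: nearW.
by apply: cvgM; apply: cvgB => //; exact: cvg_cst.
Qed.

End L2_complete.

(** * Measurable complex-valued functions *)

Section complex_measurable.
Context dT (T : measurableType dT) (R : realType).
Variable D : set T.
Implicit Types (g h : T -> R[i]).

Definition cmeasurable g := measurable_fun D (fun y => complex.Re (g y)) /\
  measurable_fun D (fun y => complex.Im (g y)).

Lemma measurable_normc2 g : cmeasurable g ->
  measurable_fun D (fun y => normc (g y) ^+ 2).
Proof.
move=> [m1 m2]; under eq_fun do rewrite normc_sqrE.
by apply: measurable_funD; exact: measurable_funX.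
Qed.

Lemma cmeas_eq g h : (forall y, g y = h y) -> cmeasurable g -> cmeasurable h.
Proof. by move=> /funext ->. Qed.

Lemma cmeasD g h : cmeasurable g -> cmeasurable h -> cmeasurable (fun y => g y + h y).
Proof.
move=> [g1 g2] [h1 h2]; split.
  rewrite (_ : (fun _ => _) = fun y => complex.Re (g y) + complex.Re (h y)).
    exact: measurable_funD.
  by apply/funext => y; rewrite raddfD.
rewrite (_ : (fun _ => _) = fun y => complex.Im (g y) + complex.Im (h y)).
  exact: measurable_funD.
by apply/funext => y; rewrite raddfD.
Qed.

Lemma cmeasM g h : cmeasurable g -> cmeasurable h -> cmeasurable (fun y => g y * h y).
Proof.
move=> [g1 g2] [h1 h2]; split.
  rewrite (_ : (fun _ => _) = fun y => complex.Re (g y) * complex.Re (h y) -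
      complex.Im (g y) * complex.Im (h y)).
    by apply: measurable_funB; exact: measurable_funM.
  by apply/funext => y; case: (g y) => a b; case: (h y).
rewrite (_ : (fun _ => _) = fun y => complex.Re (g y) * complex.Im (h y) +
      complex.Im (g y) * complex.Re (h y)).
  by apply: measurable_funD; exact: measurable_funM.
by apply/funext => y; case: (g y) => a b; case: (h y).
Qed.

Lemma cmeas_cst (c : R[i]) : cmeasurable (fun=> c).
Proof. by split; exact: measurable_cst. Qed.

Lemma cmeasB g h : cmeasurable g -> cmeasurable h -> cmeasurable (fun y => g y - h y).
Proof.
move=> mg mh; apply: (@cmeas_eq (fun y => g y + (-1) * h y)).
  by move=> y; rewrite mulN1r.
by apply: cmeasD => //; apply: cmeasM => //; exact: cmeas_cst.
Qed.

Lemma cmeas_sum (I : Type) (s : seq I) (g : I -> T -> R[i]) :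
  (forall i, cmeasurable (g i)) -> cmeasurable (fun y => \sum_(i <- s) g i y).
Proof.
move=> mg; elim: s => [|k s IH].
  by under eq_fun do rewrite big_nil; exact: cmeas_cst.
by under eq_fun do rewrite big_cons; exact: cmeasD.
Qed.

End complex_measurable.
Arguments cmeas_cst {dT T R D} c.

(** * Square integrals over the torus and partial Fourier sums *)

Section fourier_transform.
Context {R : realType} {d : nat}.
Local Notation pi := (@pi R).
Local Notation tup := (d.-tuple R).
Implicit Types (f : 'rV[int]_d -> R[i]) (g h : tup -> R[i]) (k l : 'rV[int]_d)
  (s : seq 'rV[int]_d) (y : tup).

Lemma ereal_cvg0P (u : nat -> \bar R) : (forall n, 0 <= u n)%E ->
  u n @[n --> \oo] --> 0%E <->
  (forall e : R, 0 < e -> exists N, forall n, (N <= n)%N -> (u n <= e%:E)%E).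
Proof.
move=> u0; split=> [cu e e0|H].
  have [N _ HN] : \forall n \near \oo, (u n < e%:E)%E.
    apply: (cu [set x | (x < e%:E)%E]); apply: open_nbhs_nbhs; split; first exact: open_ereal_lt_ereal.
    by rewrite /= lte_fin.
  by exists N => n Nn; apply: ltW; exact: HN.
apply/fine_cvgP; split.
  have [N HN] := H 1 ltr01; exists N => // n /= Nn.
  by rewrite ge0_fin_numE// (le_lt_trans (HN n Nn))// ltry.
apply/cvgr0Pnorm_le => e e0; have [N HN] := H e e0; exists N => // n /= Nn.
have fn : u n \is a fin_num.
  by rewrite ge0_fin_numE// (le_lt_trans (HN n Nn))// ltry.
by rewrite ger0_norm ?fine_ge0// -lee_fin fineK// HN.
Qed.

Local Notation cmeas := (cmeasurable (torus d : set tup)).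

Definition L2sq g : \bar R := (\int[lebesgueT d]_(y in torus d) (normc (g y) ^+ 2)%:E)%E.

Let mt : measurable (torus d : set tup) := @measurable_torus R d.

Lemma L2sq_ge0 g : (0 <= L2sq g)%E.
Proof. by apply: integral_ge0 => y _; rewrite lee_fin sqr_ge0. Qed.

Lemma cmeas_expi k : cmeas (fun y => expi (- dotp k y)).
Proof.
split => /=.
  under eq_fun do rewrite cosN -[dotp _ _]add0r.
  exact: measurable_cos_dotp.
under eq_fun do rewrite sinN -[dotp _ _](addr0) .
apply: measurableT_comp => //.
under eq_fun do rewrite addr0 -[dotp _ _]add0r.
by apply: measurable_trig; exact: continuous_sin.
Qed.

Lemma cmeas_trig s (c : 'rV[int]_d -> R[i]) :
  cmeas (fun y => \sum_(k <- s) expi (- dotp k y) * c k).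
Proof.
elim: s => [|k s IH].
  by under eq_fun do rewrite big_nil; exact: cmeas_cst.
under eq_fun do rewrite big_cons.
by apply: cmeasD => //; apply: cmeasM; [exact: cmeas_expi|exact: cmeas_cst].
Qed.

Lemma cmeas_fourier_sum f n : cmeas (fourier_sum f n).
Proof. by apply: cmeas_eq (cmeas_trig (boxs n) f) => y; rewrite fourier_sumE. Qed.

Lemma L2sq_eq g h : (forall y, normc (g y) ^+ 2 = normc (h y) ^+ 2) -> L2sq g = L2sq h.
Proof. by move=> gh; apply: eq_integral => y _; rewrite gh. Qed.

Lemma L2sqD g h : cmeas g -> cmeas h ->
  (L2sq (fun y => g y + h y)%R <= 2%:E * L2sq g + 2%:E * L2sq h)%E.
Proof.
move=> mg mh; rewrite /L2sq -!ge0_integralZl//; last 4 first.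
- by apply/measurable_EFinP; exact: measurable_normc2.
- by move=> y _; rewrite lee_fin sqr_ge0.
- by apply/measurable_EFinP; exact: measurable_normc2.
- by move=> y _; rewrite lee_fin sqr_ge0.
rewrite -ge0_integralD//; last 4 first.
- by move=> y _; rewrite -EFinM lee_fin mulr_ge0 ?sqr_ge0.
- by apply/measurable_EFinP; apply: measurable_funM => //; exact: measurable_normc2.
- by move=> y _; rewrite -EFinM lee_fin mulr_ge0 ?sqr_ge0.
- by apply/measurable_EFinP; apply: measurable_funM => //; exact: measurable_normc2.
apply: ge0_le_integral => //.
- by move=> y _; rewrite lee_fin sqr_ge0.
- by apply/measurable_EFinP; apply: measurable_normc2; exact: cmeasD.
- by apply/measurable_EFinP; apply: measurable_funD;
    apply: measurable_funM => //; exact: measurable_normc2.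
- by move=> y _; rewrite -!EFinM -EFinD lee_fin sqr_normcD.
Qed.

Lemma L2sqB g h : cmeas g -> cmeas h ->
  (L2sq (fun y => g y - h y)%R <= 2%:E * L2sq g + 2%:E * L2sq h)%E.
Proof.
move=> mg mh; rewrite -(@L2sq_eq (fun y => 0 - h y) h); last first.
  by move=> y; rewrite sub0r sqr_normcN.
have m0 := cmeasB (cmeas_cst 0) mh.
apply: le_trans (L2sqD mg m0).
by rewrite le_eqVlt (L2sq_eq (h := fun y => g y + (0 - h y))) ?eqxx// => y; rewrite sub0r.
Qed.

Lemma L2sqM_le g h (M : R) : cmeas g -> cmeas h -> 0 <= M ->
  (forall y, normc (h y) ^+ 2 <= M) -> (L2sq (fun y => h y * g y)%R <= M%:E * L2sq g)%E.
Proof.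
move=> mg mh M0 hM; rewrite /L2sq -ge0_integralZl//; last 2 first.
- by apply/measurable_EFinP; exact: measurable_normc2.
- by move=> y _; rewrite lee_fin sqr_ge0.
apply: ge0_le_integral => //.
- by move=> y _; rewrite lee_fin sqr_ge0.
- by apply/measurable_EFinP; apply: measurable_normc2; exact: cmeasM.
- by apply/measurable_EFinP; apply: measurable_funM => //; exact: measurable_normc2.
- by move=> y _; rewrite -EFinM lee_fin sqr_normcM ler_wpM2r// sqr_ge0.
Qed.

Lemma L2sq_trig s (c : 'rV[int]_d -> R[i]) : uniq s ->
  L2sq (fun y => \sum_(k <- s) expi (- dotp k y) * c k) =
  ((2 * pi) ^+ d * \sum_(k <- s) normc (c k) ^+ 2)%:E.
Proof. exact: integral_normc_trig_sum. Qed.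

Let Cpi : R := (2 * pi) ^+ d.
Let Cpi_gt0 : 0 < Cpi. Proof. by rewrite exprn_gt0// mulr_gt0// pi_gt0. Qed.

Lemma L2sq_trig_le s (c : 'rV[int]_d -> R[i]) : uniq s ->
  (L2sq (fun y => \sum_(k <- s) expi (- dotp k y) * c k)%R <= ((2 * pi) ^+ d)%:E * sqnorm c)%E.
Proof.
by move=> us; rewrite L2sq_trig// EFinM lee_pmul2l ?lte_fin// sum_le_sqnorm.
Qed.

(** Partial sums over different boxes are put over a common index set, so that they can be
    subtracted term by term. *)
Lemma fourier_sum_widen f m n y : (m <= n)%N ->
  fourier_sum f m y = \sum_(k <- boxs n) expi (- dotp k y) * (if k \in box m then f k else 0).
Proof.
move=> mn; rewrite fourier_sumE.
rewrite [RHS](eq_bigr (fun k => if k \in box m then expi (- dotp k y) * f k else 0)); last first.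
  by move=> k _; case: ifP => //; rewrite mulr0.
rewrite -[in RHS]big_mkcond/= -[in RHS]big_filter; apply: perm_big; apply: uniq_perm.
- exact: boxs_uniq.
- by rewrite filter_uniq// boxs_uniq.
- move=> k; rewrite mem_filter !mem_boxs.
  by apply/idP/andP => [km|[]//]; split => //; exact: box_le km.
Qed.

Lemma L2sq_fourier_sumB f m n : (m <= n)%N ->
  (L2sq (fun y => fourier_sum f n y - fourier_sum f m y)%R <= ((2 * pi) ^+ d)%:E * sqnorm (off m f))%E.
Proof.
move=> mn; apply: le_trans (L2sq_trig_le (off m f) (boxs_uniq n)).
rewrite le_eqVlt (L2sq_eq (h := fun y => \sum_(k <- boxs n) expi (- dotp k y) * off m f k)) ?eqxx//.
move=> y; congr (normc _ ^+ 2).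
rewrite (fourier_sum_widen f y mn) fourier_sumE -sumrB; apply: eq_bigr => k _.
by rewrite /off; case: ifP; rewrite -mulrBr ?subrr ?subr0.
Qed.

End fourier_transform.

(** * Existence of the transform and Parseval's inequalities in both directions *)

Section is_fourier_theory.
Context {R : realType} {d : nat}.
Local Notation pi := (@pi R).
Local Notation tup := (d.-tuple R).
Local Notation cmeas := (cmeasurable (torus d : set tup)).
Implicit Types (f : 'rV[int]_d -> R[i]) (g h : tup -> R[i]) (k l : 'rV[int]_d)
  (s : seq 'rV[int]_d) (y : tup).

Let mt : measurable (torus d : set tup) := @measurable_torus R d.
Let Cpi : R := (2 * pi) ^+ d.
Let Cpi_gt0 : 0 < Cpi. Proof. by rewrite exprn_gt0// mulr_gt0// pi_gt0. Qed.

Lemma is_fourierP f g : is_fourier f g <-> cmeas g /\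
  (forall e : R, 0 < e -> exists N, forall n, (N <= n)%N ->
    (L2sq (fun y => fourier_sum f n y - g y)%R <= e%:E)%E).
Proof.
have L0 n : (0 <= L2sq (fun y => fourier_sum f n y - g y)%R)%E by exact: L2sq_ge0.
split=> [[m1 m2 /(ereal_cvg0P L0) H]|[[m1 m2] H]]; first by split.
by split => //; apply/(ereal_cvg0P L0).
Qed.

Lemma L2sq_Cauchy f : l2 f -> forall e : R, 0 < e -> exists N, forall m n,
  (N <= m)%N -> (N <= n)%N ->
  (L2sq (fun y => fourier_sum f m y - fourier_sum f n y)%R <= e%:E)%E.
Proof.
move=> f2 e e0; have [N HN] := sqnorm_off_small f2 (divr_gt0 e0 Cpi_gt0).
have hyp m n : (N <= m)%N -> (m <= n)%N ->
    (L2sq (fun y => fourier_sum f n y - fourier_sum f m y)%R <= e%:E)%E.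
  move=> Nm mn; apply: le_trans (L2sq_fourier_sumB f mn) _.
  apply: (@le_trans _ _ (Cpi%:E * (e / Cpi)%:E)%E).
    by rewrite lee_pmul2l ?lte_fin ?HN.
  by rewrite -EFinM mulrC divfK// gt_eqF.
exists N => m n Nm Nn; have [mn|/ltnW nm] := leqP m n; last exact: hyp.
apply: le_trans (hyp m n Nm mn).
rewrite le_eqVlt (L2sq_eq (h := fun y => fourier_sum f n y - fourier_sum f m y)) ?eqxx// => y.
by rewrite -[in LHS]opprB sqr_normcN.
Qed.

(** Completeness is applied separately to the real and imaginary parts, whose squares are dominated
    by that of the modulus. *)
Lemma is_fourier_exists f : l2 f -> exists g, is_fourier f g.
Proof.
move=> f2; have cu := L2sq_Cauchy f2.
have mF n : cmeas (fourier_sum f n) := cmeas_fourier_sum f n.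
have part (r : R[i] -> R) : (forall z w, r (z - w) = r z - r w) ->
    (forall z, r z ^+ 2 <= normc z ^+ 2) ->
    (forall n, measurable_fun (torus d) (fun y => r (fourier_sum f n y))) ->
    exists2 g : tup -> R, measurable_fun (torus d) g &
    forall e : R, 0 < e -> exists N, forall n, (N <= n)%N ->
     (\int[lebesgueT d]_(y in torus d) ((r (fourier_sum f n y) - g y) ^+ 2)%:E <= e%:E)%E.
  move=> rB rn mr; apply: L2_complete => // e e0; have [N HN] := cu e e0.
  exists N => m n Nm Nn; apply: le_trans (HN m n Nm Nn).
  apply: ge0_le_integral => //.
  - by move=> y _; rewrite lee_fin sqr_ge0.
  - by apply/measurable_EFinP; apply: measurable_funX; exact: measurable_funB.
  - by apply/measurable_EFinP; apply: measurable_normc2; exact: cmeasB.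
  - by move=> y _; rewrite lee_fin -rB rn.
have [g1 m1 H1] := part (@complex.Re R) (fun z w => raddfB _ z w) (fun z => ltac:(by rewrite normc_sqrE lerDl sqr_ge0)) (fun n => (mF n).1).
have [g2 m2 H2] := part (@complex.Im R) (fun z w => raddfB _ z w) (fun z => ltac:(by rewrite normc_sqrE lerDr sqr_ge0)) (fun n => (mF n).2).
exists (fun y => (g1 y +i* g2 y)%C); apply/is_fourierP; split; first by split.
move=> e e0; have e20 : 0 < e / 2 by rewrite divr_gt0.
have [N1 HN1] := H1 _ e20; have [N2 HN2] := H2 _ e20.
exists (maxn N1 N2) => n; rewrite geq_max => /andP[n1 n2].
rewrite [e]splitr EFinD; apply: le_trans (leeD (HN1 n n1) (HN2 n n2)).
rewrite -ge0_integralD//; last 4 first.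
- by move=> y _; rewrite lee_fin sqr_ge0.
- by apply/measurable_EFinP; apply: measurable_funX; apply: measurable_funB => //; exact: (mF n).1.
- by move=> y _; rewrite lee_fin sqr_ge0.
- by apply/measurable_EFinP; apply: measurable_funX; apply: measurable_funB => //; exact: (mF n).2.
rewrite le_eqVlt; apply/orP; left; apply/eqP; apply: eq_integral => y _.
by rewrite -EFinD normc_sqrE; case: (fourier_sum f n y).
Qed.

Lemma fourierP f : l2 f -> is_fourier f (fourier f).
Proof. by move=> /is_fourier_exists[g gf]; exact: (xgetPex _ (ex_intro _ g gf)). Qed.

Lemma le_of_le_eps (u v : \bar R) (c : R) : 0 < c ->
  (forall e : R, 0 < e -> (u <= v + (c * e)%:E)%E) -> (u <= v)%E.
Proof.
move=> c0 H; apply/lee_addgt0Pr => e e0.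
by have := H (e / c) (divr_gt0 e0 c0); rewrite mulrC divfK// gt_eqF.
Qed.

Lemma is_fourier_bound f g : is_fourier f g ->
  (L2sq g <= (2 * Cpi)%:E * sqnorm f)%E.
Proof.
move=> /is_fourierP[mg Hg]; apply: (@le_of_le_eps _ _ 2) => // e e0.
have [N HN] := Hg e e0; have mF := cmeas_fourier_sum f N.
rewrite (L2sq_eq (h := fun y => fourier_sum f N y - (fourier_sum f N y - g y))); last first.
  by move=> y; congr (normc _ ^+ 2); ring.
apply: le_trans (L2sqB mF (cmeasB mF mg)) _.
apply: leeD; last by rewrite EFinM lee_pmul2l// HN.
rewrite EFinM -muleA lee_pmul2l//.
apply: le_trans (L2sq_trig_le f (boxs_uniq N)).
rewrite le_eqVlt (L2sq_eq (h := fun y => \sum_(k <- boxs N) expi (- dotp k y) * f k)) ?eqxx//.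
by move=> y; rewrite fourier_sumE.
Qed.

(* Not sharp: the factor 2 avoids passing to the limit in Parseval's identity. *)
Lemma sqnorm_le_is_fourier f g : is_fourier f g ->
  (Cpi%:E * sqnorm f <= 2%:E * L2sq g)%E.
Proof.
move=> /is_fourierP[mg Hg].
have CV : (Cpi%:E * (Cpi^-1)%:E = 1)%E by rewrite -EFinM divff ?gt_eqF.
have H s : uniq s -> ((\sum_(k <- s) normc (f k) ^+ 2)%:E <= (Cpi^-1)%:E * (2%:E * L2sq g))%E.
  move=> us; have [M sM] := seq_box s.
  rewrite -(@lee_pmul2l _ Cpi%:E)// [leRHS]muleA CV mul1e -EFinM.
  apply: (@le_of_le_eps _ _ 2) => // e e0.
  (* For this index the box contains [s] and the partial sum is already close to [g]. *)
  have [N HN] := Hg e e0; pose n := maxn N M.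
  have mF := cmeas_fourier_sum f n.
  apply: (@le_trans _ _ (L2sq (fourier_sum f n))).
    rewrite (L2sq_eq (h := fun y => \sum_(k <- boxs n) expi (- dotp k y) * f k)); last first.
      by move=> y; rewrite fourier_sumE.
    rewrite L2sq_trig ?boxs_uniq// lee_fin ler_pM2l//.
    have -> : \sum_(k <- s) normc (f k) ^+ 2 = \sum_(k <- boxs n | k \in s) normc (f k) ^+ 2.
      rewrite -[RHS]big_filter; apply: perm_big.
      apply: uniq_perm; rewrite ?filter_uniq ?boxs_uniq// => k.
      rewrite mem_filter mem_boxs; apply/idP/andP => [ks|[]//]; split => //.
      by apply: box_le (sM _ ks); exact: leq_maxr.
    rewrite [leRHS](bigID (mem s))/= lerDl sumr_ge0// => k _; exact: sqr_ge0.
  rewrite (L2sq_eq (h := fun y => g y + (fourier_sum f n y - g y))); last first.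
    by move=> y; congr (normc _ ^+ 2); ring.
  apply: le_trans (L2sqD mg (cmeasB mF mg)) _.
  by rewrite leeD2l// EFinM lee_pmul2l// HN// leq_maxl.
rewrite -[leRHS]mul1e -CV -muleA lee_pmul2l//.
exact: sqnorm_le.
Qed.

End is_fourier_theory.

(** * Shifts, differences and their Fourier multipliers *)

Section shifts.
Context {R : realType} {d : nat}.
Local Notation pi := (@pi R).
Local Notation tup := (d.-tuple R).
Local Notation cmeas := (cmeasurable (torus d : set tup)).
Implicit Types (f : 'rV[int]_d -> R[i]) (g h : tup -> R[i]) (k l : 'rV[int]_d)
  (s : seq 'rV[int]_d) (y : tup).

Let Cpi : R := (2 * pi) ^+ d.
Let Cpi_gt0 : 0 < Cpi. Proof. by rewrite exprn_gt0// mulr_gt0// pi_gt0. Qed.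

Lemma expiD (x y : R) : expi (x + y) = expi x * expi y.
Proof. by rewrite /expi cosD sinD; congr (_ +i* _)%C; ring. Qed.

Lemma normc_expi (x : R) : normc (expi x) ^+ 2 = 1.
Proof. by rewrite normc_sqrE /= cos2Dsin2. Qed.

Lemma dotpD k l y : dotp (k + l) y = dotp k y + dotp l y.
Proof. by rewrite -[k in RHS](addrK l) dotpB subrK. Qed.

Lemma dotpN l y : dotp (- l) y = - dotp l y.
Proof.
rewrite -[- l]sub0r dotpB (_ : dotp 0 y = 0) ?sub0r//.
by rewrite /dotp big1// => j _; rewrite mxE mul0r.
Qed.

Lemma dotp_e_ (j : 'I_d) y : dotp (e_ j) y = tnth y j.
Proof.
rewrite /dotp /e_ (bigD1 j)//= mxE !eqxx mul1r big1 ?addr0// => i ij.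
by rewrite mxE (negbTE ij) andbF mul0r.
Qed.

(** Such a shift moves a box into the next larger one; the notion covers both [e_ j] and
    [- e_ j]. *)
Definition unitary_shift l := forall j, `|l 0 j| <= 1.

Lemma unitary_shiftN l : unitary_shift l -> unitary_shift (- l).
Proof. by move=> ul j; rewrite mxE normrN. Qed.

Lemma unitary_shift_e_ j : unitary_shift (e_ j : 'rV[int]_d).
Proof. by move=> i; rewrite mxE; case: (_ && _). Qed.

Lemma boxD n k l : unitary_shift l -> k \in box n -> k + l \in box n.+1.
Proof.
move=> ul /set_mem kn; apply/mem_set => j; rewrite mxE.
rewrite (le_trans (ler_normD _ _))// intS addrC.
by apply: lerD; [exact: ul|exact: kn].
Qed.

Lemma boxB n k l : unitary_shift l -> k \in box n -> k - l \in box n.+1.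
Proof. by move=> /unitary_shiftN; exact: boxD. Qed.

(** The failure of truncation to a box to commute with the shift by [l]. *)
Definition shift_defect l f n y :=
  fourier_sum (fun k => f (k + l)) n y - expi (dotp l y) * fourier_sum f n y.

Lemma cmeas_expi_dotp l : cmeas (fun y : tup => expi (dotp l y)).
Proof. by apply: cmeas_eq (cmeas_expi (- l)) => y; rewrite dotpN opprK. Qed.

Lemma cmeas_shift_defect l f n : cmeas (shift_defect l f n).
Proof.
apply: cmeasB; first exact: cmeas_fourier_sum.
by apply: cmeasM; [exact: cmeas_expi_dotp|exact: cmeas_fourier_sum].
Qed.

(** After a change of index the defect has coefficients [c k], up to a factor of modulus 1. They
    vanish on the box [n], because [k] and [k - l] then both lie in the box [n.+1]. *)
Lemma L2sq_shift_defect l f n : unitary_shift l ->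
  (L2sq (shift_defect l f n.+1) <= ((2 * pi) ^+ d)%:E * sqnorm (off n f))%E.
Proof.
move=> ul.
pose c k := ((k - l \in box n.+1)%:R - (k \in box n.+1)%:R) * f k.
apply: (@le_trans _ _ (((2 * pi) ^+ d)%:E * sqnorm c)%E); last first.
  rewrite lee_pmul2l ?lte_fin//; apply: le_sqnorm => k.
  rewrite /c /off; case: ifPn => kn.
    rewrite (boxB ul kn) (box_le (leqnSn n) kn) subrr mul0r normc0_.
    by rewrite expr0n.
  rewrite sqr_normcM ler_piMl ?sqr_ge0// normc_sqrE.
  by case: (_ - l \in _); case: (k \in _) => /=; lra.
apply: le_trans (L2sq_trig_le c (boxs_uniq n.+2)).
rewrite le_eqVlt; apply/orP; left; apply/eqP.
transitivity (L2sq (fun y => expi (dotp l y) * (\sum_(k <- boxs n.+2) expi (- dotp k y) * c k))); last first.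
  by apply: L2sq_eq => y; rewrite sqr_normcM normc_expi mul1r.
apply: L2sq_eq => y; congr (normc _ ^+ 2).
rewrite /shift_defect (fourier_sum_widen f y (leqnSn n.+1)) !big_distrr/=.
(* The box [n.+2] contains both the box [n.+1] and its translate by [l], so it serves as the common
   index set. *)
rewrite (_ : fourier_sum _ _ _ = \sum_(k <- boxs n.+2) expi (dotp l y) *
   (expi (- dotp k y) * ((k - l \in box n.+1)%:R * f k))); last first.
  rewrite fourier_sumE.
  transitivity (\sum_(k <- [seq k + l | k <- boxs n.+1]) expi (dotp l y) * (expi (- dotp k y) * f k)).
    rewrite big_map; apply: eq_bigr => k _; rewrite mulrA -expiD dotpD.
    by congr (expi _ * _); ring.
  transitivity (\sum_(k <- [seq k <- boxs n.+2 | k - l \in box n.+1]) expi (dotp l y) * (expi (- dotp k y) * f k)).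
    apply: perm_big; apply: uniq_perm.
    - by rewrite map_inj_uniq ?boxs_uniq//; exact: addIr.
    - by rewrite filter_uniq// boxs_uniq.
    move=> k; rewrite mem_filter mem_boxs; apply/mapP/andP => [[k' + ->]|[kl _]].
      by rewrite mem_boxs addrK => kn; split => //; exact: boxD.
    by exists (k - l); rewrite ?mem_boxs ?subrK.
  rewrite big_filter big_mkcond/=; apply: eq_bigr => k _.
  by case: ifP; rewrite ?mul1r// !(mul0r, mulr0).
rewrite -sumrB; apply: eq_bigr => k _; rewrite /c.
by case: (k \in _); case: (_ \in _) => /=; ring.
Qed.

Lemma is_fourierB f f' g g' : is_fourier f g -> is_fourier f' g' ->
  is_fourier (fun k => f k - f' k) (fun y => g y - g' y).
Proof.
move=> /is_fourierP[mg Hg] /is_fourierP[mg' Hg']; apply/is_fourierP.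
split; first exact: cmeasB.
move=> e e0; have e40 : 0 < e / 4 by rewrite divr_gt0.
have [N1 HN1] := Hg _ e40; have [N2 HN2] := Hg' _ e40.
exists (maxn N1 N2) => n; rewrite geq_max => /andP[n1 n2].
rewrite (L2sq_eq (h := fun y => (fourier_sum f n y - g y) - (fourier_sum f' n y - g' y))).
  apply: le_trans (L2sqB (cmeasB (cmeas_fourier_sum _ _) mg) (cmeasB (cmeas_fourier_sum _ _) mg')) _.
  rewrite (_ : e%:E = (2%:E * (e / 4)%:E + 2%:E * (e / 4)%:E)%E).
    by apply: leeD; rewrite lee_pmul2l//; [exact: HN1|exact: HN2].
  by rewrite -!EFinM -EFinD; congr EFin; field.
move=> y; congr (normc _ ^+ 2).
rewrite !fourier_sumE (eq_bigr (fun k => expi (- dotp k y) * f k - expi (- dotp k y) * f' k)).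
  by rewrite sumrB; ring.
by move=> k _; rewrite mulrBr.
Qed.

Lemma is_fourierZ f g (c : R[i]) : is_fourier f g ->
  is_fourier (fun k => c * f k) (fun y => c * g y).
Proof.
move=> /is_fourierP[mg Hg]; apply/is_fourierP.
split; first by apply: cmeasM => //; exact: cmeas_cst.
move=> e e0; pose r := 1 + normc c ^+ 2.
have r0 : 0 < r by rewrite ltr_pwDl// sqr_ge0.
have [N HN] := Hg _ (divr_gt0 e0 r0); exists N => n Nn.
rewrite (L2sq_eq (h := fun y => c * (fourier_sum f n y - g y))).
  apply: le_trans (L2sqM_le (cmeasB (cmeas_fourier_sum _ _) mg) (cmeas_cst c) (ltW r0) _) _.
    by move=> y; rewrite lerDr.
  rewrite (_ : e%:E = (r%:E * (e / r)%:E)%E); first by rewrite lee_pmul2l ?lte_fin//; exact: HN.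
  by rewrite -EFinM; congr EFin; field; rewrite gt_eqF.
move=> y; congr (normc _ ^+ 2); rewrite mulrBr !fourier_sumE big_distrr/=.
by congr (_ - _); apply: eq_bigr => k _; rewrite mulrCA.
Qed.

Lemma is_fourier_shift f g l : unitary_shift l -> l2 f -> is_fourier f g ->
  is_fourier (fun k => f (k + l)) (fun y => expi (dotp l y) * g y).
Proof.
move=> ul f2 /is_fourierP[mg Hg]; apply/is_fourierP.
have me := cmeas_expi_dotp l.
split; first exact: cmeasM.
move=> e e0; have e40 : 0 < e / 4 by rewrite divr_gt0.
have [N1 HN1] := Hg _ e40; have [N2 HN2] := sqnorm_off_small f2 (divr_gt0 e40 Cpi_gt0).
exists (maxn N1 N2.+1) => n; rewrite geq_max => /andP[n1 n2].
have mF := cmeasB (cmeas_fourier_sum f n) mg.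
rewrite (L2sq_eq (h := fun y => shift_defect l f n y + expi (dotp l y) * (fourier_sum f n y - g y))).
  apply: le_trans (L2sqD (cmeas_shift_defect _ _ _) (cmeasM me mF)) _.
  rewrite (_ : e%:E = (2%:E * (e / 4)%:E + 2%:E * (e / 4)%:E)%E).
    apply: leeD; rewrite lee_pmul2l//.
      case: n n1 n2 mF => // n n1 n2 mF.
      apply: le_trans (L2sq_shift_defect _ _ ul) _.
      rewrite (_ : (e / 4)%:E = (Cpi%:E * (e / 4 / Cpi)%:E)%E).
        by rewrite lee_pmul2l ?lte_fin//; exact: HN2.
      by rewrite -EFinM; congr EFin; field; rewrite gt_eqF.
    rewrite (L2sq_eq (h := fun y => fourier_sum f n y - g y)); first exact: HN1.
    by move=> y; rewrite sqr_normcM normc_expi mul1r.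
  by rewrite -!EFinM -EFinD; congr EFin; field.
by move=> y; congr (normc _ ^+ 2); rewrite /shift_defect; ring.
Qed.

Lemma is_fourier_Dplus f g j : l2 f -> is_fourier f g ->
  is_fourier (Dplus j f) (fun y => (expi (tnth y j) - 1) * g y).
Proof.
move=> f2 fg; have := is_fourierB (is_fourier_shift (unitary_shift_e_ j) f2 fg) fg.
congr is_fourier; apply/funext => y.
by rewrite dotp_e_ mulrBl mul1r.
Qed.

Lemma normc_expi1 (x : R) : normc (expi x - 1) ^+ 2 = (2 * sin (x / 2)) ^+ 2.
Proof.
rewrite normc_sqrE /=.
have -> : cos x = cos (x / 2) ^+ 2 - sin (x / 2) ^+ 2.
  by rewrite [in LHS](splitr x) cosD !expr2.
have -> : sin x = 2 * (sin (x / 2) * cos (x / 2)).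
  by rewrite [in LHS](splitr x) sinD; ring.
have := cos2Dsin2 (x / 2); move: (cos (x / 2)) (sin (x / 2)) => c s h.
transitivity ((c ^+ 2 + s ^+ 2) ^+ 2 - 2 * (c ^+ 2 - s ^+ 2) + 1); first by ring.
have -> : c ^+ 2 = 1 - s ^+ 2 by lra.
by ring.
Qed.

End shifts.

(** * One-sided difference quotients *)

Section half_line_derivatives.
Context {R : realType}.
Implicit Types (f : R -> R) (s t : R).

Lemma hderivable_near f t : hderivable f t -> forall e, 0 < e ->
  \forall s \near t, 0 <= s -> s != t -> `|hderive f t - hquot f t s| < e.
Proof.
move=> df e e0.
have : hquot f t @ within `[0, +oo[ t^' --> hderive f t by exact: df.
move=> /cvgrPdist_lt/(_ e e0) H.
have H' : \forall s \near t, s != t -> s \in `[0, +oo[ -> `|hderive f t - hquot f t s| < e := H.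
by near=> s => s0 st; apply: (near H' s) => //; rewrite in_itv/= s0.
Unshelve. all: by end_near. Qed.

Lemma hderivable_cvg f t : hderivable f t ->
  f @ within `[0, +oo[ (nbhs t) --> f t.
Proof.
move=> df; apply/cvgrPdist_lt => e e0.
pose C := `|hderive f t| + 1.
have C0 : 0 < C by rewrite ltr_wpDl.
have h1 := hderivable_near df ltr01.
have h2 : \forall s \near t, `|t - s| < e / C.
  by apply: (@nbhsx_ballx _ R); rewrite divr_gt0.
suff H : \forall s \near t, s \in `[0, +oo[ -> `|f t - f s| < e by exact: H.
near=> s => s0.
have [->|st] := eqVneq s t; first by rewrite subrr normr0.
have s0' : 0 <= s by move: s0; rewrite in_itv/= andbT.
have q1 : `|hderive f t - hquot f t s| < 1 by apply: (near h1 s) => //.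
have q2 : `|t - s| < e / C by near: s.
have -> : f t - f s = hquot f t s * (t - s).
  by rewrite /hquot; field; rewrite subr_eq0.
rewrite normrM -(divfK (lt0r_neq0 C0) e) mulrC; apply: ltr_pM => //.
rewrite /C; have := ler_normB (hderive f t) (hderive f t - hquot f t s).
by rewrite opprB addrC subrK; lra.
Unshelve. all: by end_near. Qed.

(** For [t > 0] the restriction to [[0, +oo[] disappears near [t]. *)
Lemma hderivable_is_derive f t : 0 < t -> hderivable f t ->
  is_derive t (1:R) f (hderive f t).
Proof.
move=> t0 df.
have H : h^-1 *: (f (h *: 1 + t) - f t) @[h --> 0^'] --> hderive f t.
  apply/cvgrPdist_lt => e e0.
  have h1 := hderivable_near df e0.
  have h2 : \forall s \near t, 0 < s by exact: lt_nbhsr.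
  have h3 : \forall s \near t, s != t -> `|hderive f t - hquot f t s| < e.
    near=> s => st; apply: (near h1 s) => //; apply: ltW; near: s; exact: h2.
  have ct : (fun h : R => h + t) @ nbhs (0 : R) --> t.
    rewrite -[X in _ --> X]add0r; apply: cvgD; [exact: cvg_id|exact: cvg_cst].
  have h4 : \forall h \near (0 : R), h + t != t -> `|hderive f t - hquot f t (h + t)| < e.
    exact: ct h3.
  have h5 : \forall h \near (0 : R), h != 0 ->
      `|hderive f t - h^-1 *: (f (h *: 1 + t) - f t)| < e.
    near=> h => h0; have : h + t != t by rewrite -subr_eq0 addrK.
    move=> /(near h4 h _); rewrite /hquot addrK /GRing.scale/= mulr1 [h^-1 * _]mulrC; apply.
    by [].
  exact: h5.
apply: DeriveDef; first by apply/cvg_ex; exists (hderive f t); exact: H.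
exact: cvg_lim.
Unshelve. all: by end_near. Qed.

Lemma hder_hderive f : (forall t, 0 <= t -> hderivable f t) -> hder 0 f (hderive f).
Proof.
move=> df; split; first by apply/hcontP => x x0; apply: hderivable_cvg; exact: df.
by move=> t t0; apply: hderivable_is_derive => //; apply: df; exact: ltW.
Qed.

End half_line_derivatives.

(** * Difference quotients and uniform tails in l^2 *)

Section l2_calculus.
Context {R : realType} {d : nat}.
Implicit Types (u : R -> 'rV[int]_d -> R[i]) (s : seq 'rV[int]_d) (t h e r T : R).

Lemma chder_Re (g : R -> R[i]) : (forall t, 0 <= t -> chderivable g t) ->
  hder 0 (fun r => complex.Re (g r)) (fun r => complex.Re (chderive g r)).
Proof. by move=> dg; apply: hder_hderive => t /dg[]. Qed.

Lemma chder_Im (g : R -> R[i]) : (forall t, 0 <= t -> chderivable g t) ->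
  hder 0 (fun r => complex.Im (g r)) (fun r => complex.Im (chderive g r)).
Proof. by move=> dg; apply: hder_hderive => t /dg[]. Qed.

(* The mean value theorem is applied to the scalar product of the increment with
   a fixed vector, since the intermediate points of its coordinates differ. *)
Lemma sqnorm_diff_quotient u t h e :
  (forall r k, 0 <= r -> chderivable (u^~ k) r) -> 0 <= t -> 0 < h ->
  (forall r, t <= r <= t + h -> (sqnorm (fun k => dt u r k - dt u t k)%R <= e%:E)%E) ->
  (sqnorm (fun k => (h^-1)%:C%C * (u (t + h) k - u t k) - dt u t k)%R <= e%:E)%E.
Proof.
move=> du t0 h0 He; apply: sqnorm_le => s us; rewrite lee_fin.
pose D k := (h^-1)%:C%C * (u (t + h) k - u t k) - dt u t k.
pose P k := complex.Re (D k); pose Q k := complex.Im (D k).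
have PE k : P k = h^-1 * (complex.Re (u (t + h) k) - complex.Re (u t k)) - complex.Re (dt u t k).
  rewrite /P /D; case: (u (t + h) k) => x1 y1; case: (u t k) => x2 y2.
  by case: (dt u t k) => x3 y3 /=; ring.
have QE k : Q k = h^-1 * (complex.Im (u (t + h) k) - complex.Im (u t k)) - complex.Im (dt u t k).
  rewrite /Q /D; case: (u (t + h) k) => x1 y1; case: (u t k) => x2 y2.
  by case: (dt u t k) => x3 y3 /=; ring.
pose psi r := \sum_(k <- s) (P k * (complex.Re (u r k) - r * complex.Re (dt u t k)) +
   Q k * (complex.Im (u r k) - r * complex.Im (dt u t k))).
pose psi' r := \sum_(k <- s) (P k * (complex.Re (dt u r k) - complex.Re (dt u t k)) +
   Q k * (complex.Im (dt u r k) - complex.Im (dt u t k))).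
have dpsi : hder 0 psi psi'.
  apply: hder_sum => k; apply: hderD; apply: hderZ; apply: hderB.
  - by apply: chder_Re => r; exact: du.
  - by apply: hder_eq (hderM (hder_id _) (hder_cst _ _)) _ => r _; ring.
  - by apply: chder_Im => r; exact: du.
  - by apply: hder_eq (hderM (hder_id _) (hder_cst _ _)) _ => r _; ring.
have [c1 c2] := hder_le t0 dpsi.
have th : t < t + h by rewrite ltrDl.
have [||c] := @MVT R psi psi' t (t + h) th.
- by move=> x; rewrite in_itv/= => /andP[tx _]; exact: c2.
- apply: continuous_subspaceW c1 => x /=; rewrite !in_itv/= andbT.
  by case/andP.
rewrite in_itv/= => /andP[tc cth] E.
set S := \sum_(k <- s) _.
have SE : S = \sum_(k <- s) (P k ^+ 2 + Q k ^+ 2).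
  by apply: eq_bigr => k _; rewrite normc_sqrE.
have ES : psi (t + h) - psi t = h * S.
  rewrite SE /psi -sumrB big_distrr/=; apply: eq_bigr => k _.
  have -> : P k ^+ 2 = P k * (h^-1 * (complex.Re (u (t + h) k) - complex.Re (u t k)) - complex.Re (dt u t k)).
    by rewrite -PE expr2.
  have -> : Q k ^+ 2 = Q k * (h^-1 * (complex.Im (u (t + h) k) - complex.Im (u t k)) - complex.Im (dt u t k)).
    by rewrite -QE expr2.
  by move: (P k) (Q k) => p q /=; field; rewrite gt_eqF.
have Spsi : S = psi' c.
  apply: (mulfI (lt0r_neq0 h0)); rewrite -ES E.
  by rewrite [t + h - t]addrAC subrr add0r mulrC.
(* [S] equals the scalar product of the vector [D] with the increment of [dt u] between [t] and [c];
   Young's inequality returns half of [S], which is the squared norm of [D]. *)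
have : S <= S / 2 + e / 2.
  have Hc : \sum_(k <- s) normc (dt u c k - dt u t k) ^+ 2 <= e.
    rewrite -lee_fin; apply: le_trans (He c _); last by rewrite !ltW.
    exact: sum_le_sqnorm.
  apply: (@le_trans _ _ (S / 2 + (\sum_(k <- s) normc (dt u c k - dt u t k) ^+ 2) / 2)).
    rewrite {1}Spsi SE /psi' !big_distrl -big_split; apply: ler_sum => k _.
    rewrite normc_sqrE; case: (dt u c k) => x1 y1; case: (dt u t k) => x2 y2 /=.
    have := sqr_ge0 (P k - (x1 - x2)); have := sqr_ge0 (Q k - (y1 - y2)).
    by move: (P k) (Q k) => p q; lra.
  by rewrite lerD2l ler_pM2r.
by lra.
Qed.

(** Compactness of [[0, T]]: near each time [t] the tail of [u r] is controlled by the tail of [u t]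
    and by the norm of [u r - u t], so one box works in a neighbourhood. *)
Lemma sqnorm_off_uniform u T e : 0 < e ->
  (forall t, 0 <= t -> l2 (u t)) -> (forall t, 0 <= t -> l2_continuous_at u t) ->
  exists N, forall n t, (N <= n)%N -> 0 <= t <= T -> (sqnorm (off n (u t)) <= e%:E)%E.
Proof.
move=> e0 u2 cu.
have /compact_near_coveringP := @segment_compact R 0 T.
move=> /(_ nat \oo (fun n t => 0 <= t -> (sqnorm (off n (u t)) <= e%:E)%E)) H.
have [|N _ HN] := H eventually_filter _.
  move=> t; rewrite /= in_itv/= => /andP[t0 tT].
  have e40 : 0 < e / 4 by rewrite divr_gt0.
  have [N HN] := sqnorm_off_small (u2 t t0) e40.
  have near_t : \forall r \near t, r \in `[0, +oo[ ->
      (sqnorm (fun k => u r k - u t k)%R < (e / 4)%:E)%E.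
    apply: (cu t t0 [set x | (x < (e / 4)%:E)%E]); apply: open_nbhs_nbhs.
    by split; [exact: open_ereal_lt_ereal|rewrite /= lte_fin].
  near=> r n => r0.
  have rI : r \in `[0, +oo[ by rewrite in_itv/= r0.
  have h1 : (sqnorm (fun k => u r k - u t k)%R < (e / 4)%:E)%E.
    by move: rI; near: r; exact: near_t.
  have h2 : (sqnorm (off n (u t)) <= (e / 4)%:E)%E.
    by apply: HN; near: n; exists N.
  apply: (@le_trans _ _ (2%:E * sqnorm (off n (fun k => u r k - u t k)%R) +
    2%:E * sqnorm (off n (u t)))%E).
    apply: le_trans (sqnormD _ _); apply: le_sqnorm => k.
    by rewrite -offD (_ : (fun k => _) = u r)//; apply/funext => l; rewrite subrK.
  rewrite (_ : e%:E = (2%:E * (e / 4)%:E + 2%:E * (e / 4)%:E)%E); last first.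
    by rewrite -!EFinM -EFinD; congr EFin; field.
  apply: leeD; rewrite lee_pmul2l//.
  by apply: le_trans (ltW h1); apply: le_sqnorm => k; exact: off_normc.
exists N => n t Nn /andP[t0 tT]; apply: (HN n Nn t) => //.
by rewrite /= in_itv/= t0.
Unshelve. all: by end_near. Qed.

End l2_calculus.

(** * Truncated Fourier sums as solutions of the mode equation with a source *)

Section galerkin.
Context {R : realType} {d : nat}.
Local Notation tup := (d.-tuple R).
Implicit Types (f : 'rV[int]_d -> R[i]) (k l : 'rV[int]_d) (y : tup) (r t T x : R)
  (z w : R -> R[i]).

Definition chcont z := hcont 0 (fun t => complex.Re (z t)) /\
  hcont 0 (fun t => complex.Im (z t)).

Definition chder z w :=
  hder 0 (fun t => complex.Re (z t)) (fun t => complex.Re (w t)) /\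
  hder 0 (fun t => complex.Im (z t)) (fun t => complex.Im (w t)).

Lemma ReD (z w : R[i]) : complex.Re (z + w) = complex.Re z + complex.Re w.
Proof. exact: raddfD. Qed.

Lemma ImD (z w : R[i]) : complex.Im (z + w) = complex.Im z + complex.Im w.
Proof. exact: raddfD. Qed.

Lemma ReM (z w : R[i]) :
  complex.Re (z * w) = complex.Re z * complex.Re w - complex.Im z * complex.Im w.
Proof. by case: z => a b; case: w. Qed.

Lemma ImM (z w : R[i]) :
  complex.Im (z * w) = complex.Re z * complex.Im w + complex.Im z * complex.Re w.
Proof. by case: z => a b; case: w. Qed.

Lemma chcont_cst (c : R[i]) : chcont (fun=> c).
Proof. by split; exact: hcont_cst. Qed.

Lemma chcontD z w : chcont z -> chcont w -> chcont (fun t => z t + w t).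
Proof.
move=> [z1 z2] [w1 w2]; split.
  by under eq_fun do rewrite ReD; exact: hcontD.
by under eq_fun do rewrite ImD; exact: hcontD.
Qed.

Lemma chcontM z w : chcont z -> chcont w -> chcont (fun t => z t * w t).
Proof.
move=> [z1 z2] [w1 w2]; split.
  by under eq_fun do rewrite ReM; apply: hcontB; exact: hcontM.
by under eq_fun do rewrite ImM; apply: hcontD; exact: hcontM.
Qed.

Lemma chcontB z w : chcont z -> chcont w -> chcont (fun t => z t - w t).
Proof.
move=> cz cw; rewrite (_ : (fun _ => _) = fun t => z t + (-1) * w t).
  by apply: chcontD => //; apply: chcontM => //; exact: chcont_cst.
by apply/funext => t; rewrite mulN1r.
Qed.

Lemma chcont_sum (I : Type) (s : seq I) (z : I -> R -> R[i]) :
  (forall i, chcont (z i)) -> chcont (fun t => \sum_(i <- s) z i t).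
Proof.
move=> cz; elim: s => [|i s IH].
  by under eq_fun do rewrite big_nil; exact: chcont_cst.
by under eq_fun do rewrite big_cons; exact: chcontD.
Qed.

Lemma chcont_real (g : R -> R) : hcont 0 g -> chcont (fun t => (g t)%:C%C).
Proof. by move=> cg; split => //=; exact: hcont_cst. Qed.

Lemma chcont_normc2 z : chcont z -> hcont 0 (fun t => normc (z t) ^+ 2).
Proof.
move=> [z1 z2]; under eq_fun do rewrite normc_sqrE.
by apply: hcontD; exact: hcontX.
Qed.

Lemma chderD z z' w w' : chder z z' -> chder w w' ->
  chder (fun t => z t + w t) (fun t => z' t + w' t).
Proof.
move=> [z1 z2] [w1 w2]; split.
  under eq_fun do rewrite ReD; apply: hder_eq (hderD z1 w1) _ => t _.
  by rewrite ReD.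
under eq_fun do rewrite ImD; apply: hder_eq (hderD z2 w2) _ => t _.
by rewrite ImD.
Qed.

Lemma chderZ (c : R[i]) z z' : chder z z' ->
  chder (fun t => c * z t) (fun t => c * z' t).
Proof.
move=> [z1 z2]; split.
  under eq_fun do rewrite ReM.
  apply: hder_eq (hderB (hderZ (complex.Re c) z1) (hderZ (complex.Im c) z2)) _ => t _.
  by rewrite ReM.
under eq_fun do rewrite ImM.
apply: hder_eq (hderD (hderZ (complex.Re c) z2) (hderZ (complex.Im c) z1)) _ => t _.
by rewrite ImM.
Qed.

Lemma chder_sum (I : Type) (s : seq I) (z z' : I -> R -> R[i]) :
  (forall i, chder (z i) (z' i)) ->
  chder (fun t => \sum_(i <- s) z i t) (fun t => \sum_(i <- s) z' i t).
Proof.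
move=> dz; elim: s => [|i s [IH1 IH2]].
  split; under eq_fun do rewrite big_nil; apply: hder_eq (hder_cst _ _) _ => t _;
    by rewrite big_nil.
have [h1 h2] := chderD (dz i) (conj IH1 IH2).
split; under eq_fun do rewrite big_cons; [apply: hder_eq h1 _|apply: hder_eq h2 _] => t _;
  by rewrite big_cons.
Qed.

Lemma chder_chcont z z' : chder z z' -> chcont z.
Proof. by move=> [[? _] [? _]]. Qed.

Lemma chder_fourier_sum (v v' : R -> 'rV[int]_d -> R[i]) n y :
  (forall k, chder (fun t => v t k) (fun t => v' t k)) ->
  chder (fun t => fourier_sum (v t) n y) (fun t => fourier_sum (v' t) n y).
Proof.
move=> dv; under [X in chder X]eq_fun do rewrite fourier_sumE.
under [X in chder _ X]eq_fun do rewrite fourier_sumE.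
by apply: chder_sum => k; exact: chderZ.
Qed.

Lemma chcont_fourier_sum (v : R -> 'rV[int]_d -> R[i]) n y :
  (forall k, chcont (fun t => v t k)) -> chcont (fun t => fourier_sum (v t) n y).
Proof.
move=> dv; under eq_fun do rewrite fourier_sumE.
by apply: chcont_sum => k; apply: chcontM => //; exact: chcont_cst.
Qed.

Definition laplacian f k : R[i] :=
  \sum_(j < d) (f (k + e_ j) - 2%:R * f k + f (k - e_ j)).

(** The boundary terms of the discrete Laplacian on the box [n]. *)
Definition galerkin_defect f n y :=
  \sum_(j < d) (shift_defect (e_ j) f n y + shift_defect (- e_ j) f n y).

Lemma xi_norm2 y : xi_norm y ^+ 2 = \sum_(j < d) xi y j ^+ 2.
Proof. by rewrite sqr_sqrtr// sumr_ge0// => j _; exact: sqr_ge0. Qed.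

Lemma expiDN r : expi r + expi (- r) = 2 - ((2 * sin (r / 2)) ^+ 2)%:C%C.
Proof.
rewrite /expi cosN sinN.
have -> : cos r = 1 - 2 * sin (r / 2) ^+ 2.
  rewrite [in LHS](splitr r) cosD -!expr2.
  by have := cos2Dsin2 (r / 2); lra.
by apply/eqP; rewrite eq_complex/=; apply/andP; split; apply/eqP; ring.
Qed.

(** Apart from the shift defects, each direction contributes the multiplier e^(i r) - 2 + e^(- i r)
    = - (2 sin(r / 2))^2 with [r = tnth y j]. *)
Lemma fourier_sum_laplacian f n y : fourier_sum (laplacian f) n y =
  galerkin_defect f n y - (xi_norm y ^+ 2)%:C%C * fourier_sum f n y.
Proof.
rewrite xi_norm2 rmorph_sum big_distrl/= /galerkin_defect -sumrB.
transitivity (\sum_(j < d) (fourier_sum (fun k => f (k + e_ j)) n y -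
    2%:R * fourier_sum f n y + fourier_sum (fun k => f (k - e_ j)) n y)).
  rewrite fourier_sumE /laplacian; under eq_bigr do rewrite big_distrr/=.
  rewrite exchange_big/=; apply: eq_bigr => j _.
  rewrite !fourier_sumE big_distrr -sumrB -big_split/=; apply: eq_bigr => k _; ring.
apply: eq_bigr => j _; rewrite /shift_defect dotpN dotp_e_.
have := expiDN (tnth y j); rewrite -/(xi y j) => /(canRL (addrK _)) ->.
by ring.
Qed.

Variables (a : R -> R) (u0 u1 : 'rV[int]_d -> R[i]) (u : R -> 'rV[int]_d -> R[i]).
Hypothesis acont : hcont 0 a.
Hypothesis hu : wave_solution a u0 u1 u.

Lemma wave_chder k : chder (fun t => u t k) (fun t => dt u t k).
Proof.
have [_ _ du _ _] := hu.
split; [apply: chder_Re|apply: chder_Im] => t t0; exact: (du t k t0).1.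
Qed.

Lemma wave_chder2 k :
  chder (fun t => dt u t k) (fun t => (a t ^+ 2)%:C%C * laplacian (u t) k).
Proof.
have [_ _ du eu _] := hu.
have E t : 0 <= t -> dt (dt u) t k = (a t ^+ 2)%:C%C * laplacian (u t) k.
  by move=> t0; apply/eqP; rewrite -subr_eq0; apply/eqP; exact: eu.
have d2 t : 0 <= t -> chderivable (fun s => dt u s k) t by move=> t0; exact: (du t k t0).2.
split.
  apply: hder_eq (chder_Re d2) _ => t t0.
  by rewrite -E// ltW.
apply: hder_eq (chder_Im d2) _ => t t0.
by rewrite -E// ltW.
Qed.

Definition galerkin_source n y t := (a t ^+ 2)%:C%C * galerkin_defect (u t) n y.

Lemma chcont_galerkin_source n y : chcont (galerkin_source n y).
Proof.
apply: chcontM; first by apply: chcont_real; exact: hcontX.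
apply: chcont_sum => j.
have cu l : chcont (fun t => shift_defect l (u t) n y).
  apply: chcontB; last apply: chcontM; [|exact: chcont_cst|].
    by apply: chcont_fourier_sum => k; exact: chder_chcont (wave_chder _).
  by apply: chcont_fourier_sum => k; exact: chder_chcont (wave_chder _).
by apply: chcontD.
Qed.

Lemma galerkin_wave n y :
  wave a (xi_norm y) (fun t => complex.Re (fourier_sum (u t) n y))
    (fun t => complex.Re (fourier_sum (dt u t) n y))
    (fun t => complex.Re (galerkin_source n y t)) /\
  wave a (xi_norm y) (fun t => complex.Im (fourier_sum (u t) n y))
    (fun t => complex.Im (fourier_sum (dt u t) n y))
    (fun t => complex.Im (galerkin_source n y t)).
Proof.
have [d1 d2] := chder_fourier_sum n y wave_chder.
have [d3 d4] := chder_fourier_sum n y wave_chder2.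
have [c1 c2] := chcont_galerkin_source n y.
have E t : fourier_sum (fun k => (a t ^+ 2)%:C%C * laplacian (u t) k) n y =
    galerkin_source n y t - (a t ^+ 2 * xi_norm y ^+ 2)%:C%C * fourier_sum (u t) n y.
  have -> : (a t ^+ 2 * xi_norm y ^+ 2)%:C%C = (a t ^+ 2)%:C%C * (xi_norm y ^+ 2)%:C%C :> R[i].
    exact: (rmorphM (real_complex R)).
  rewrite /galerkin_source -mulrA -mulrBr -fourier_sum_laplacian.
  rewrite !fourier_sumE big_distrr/=; apply: eq_bigr => k _.
  by rewrite mulrCA.
split; split => //.
  apply: hder_eq d3 _ => t _; rewrite E.
  by case: (galerkin_source n y t) => p q; case: (fourier_sum _ _ _) => p' q' /=; ring.
apply: hder_eq d4 _ => t _; rewrite E.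
by case: (galerkin_source n y t) => p q; case: (fourier_sum _ _ _) => p' q' /=; ring.
Qed.

Lemma hintD T (f g : R -> R) : hcont 0 f -> hcont 0 g ->
  hint 0 T f + hint 0 T g = hint 0 T (fun t => f t + g t).
Proof.
move=> cf cg; have ic (h : R -> R) : hcont 0 h ->
    lebesgue_measure.-integrable `[0, T] (EFin \o h).
  move=> ch; apply: continuous_compact_integrable; first exact: segment_compact.
  apply: continuous_subspaceW ch => x /=; rewrite !in_itv/= andbT.
  by case/andP.
by rewrite /hint RintegralD//; exact: ic.
Qed.

Lemma xi_norm_le y : xi_norm y <= Num.sqrt (4 * d%:R).
Proof.
rewrite ler_wsqrtr//.
have -> : 4 * d%:R = \sum_(j < d) 4 :> R by rewrite sumr_const card_ord mulr_natr.
apply: ler_sum => j _; rewrite /xi exprMn.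
have := cos2Dsin2 (tnth y j / 2); have := sqr_ge0 (cos (tnth y j / 2)).
by lra.
Qed.

Variables (C : R) (W : R -> R).
Hypothesis scalar_bound : forall x (p q g : R -> R) T, 0 < x ->
  x <= Num.sqrt (4 * d%:R) -> wave a x p q g -> 0 <= T ->
  scalar_energy a x (p T) (q T) T <=
  C * W x * (scalar_energy a x (p 0) (q 0) 0 + (1 + T) * hint 0 T (fun t => g t ^+ 2)).

Lemma galerkin_energy n y T : 0 < xi_norm y -> 0 <= T ->
  mode_energy a T y (fourier_sum (u T) n y) (fourier_sum (dt u T) n y) <=
  C * W (xi_norm y) *
  (mode_energy a 0 y (fourier_sum (u 0) n y) (fourier_sum (dt u 0) n y) +
   (1 + T) * hint 0 T (fun t => normc (galerkin_source n y t) ^+ 2)).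
Proof.
move=> x0 T0; have [w1 w2] := galerkin_wave n y.
have h1 := scalar_bound x0 (xi_norm_le y) w1 T0.
have h2 := scalar_bound x0 (xi_norm_le y) w2 T0.
have [c1 c2] := chcont_galerkin_source n y.
have E t (z w : R[i]) : mode_energy a t y z w =
    scalar_energy a (xi_norm y) (complex.Re z) (complex.Re w) t +
    scalar_energy a (xi_norm y) (complex.Im z) (complex.Im w) t.
  by rewrite /mode_energy /scalar_energy !normc_sqrE; ring.
rewrite !E; apply: le_trans (lerD h1 h2) _.
rewrite (_ : (fun t => normc _ ^+ 2) = fun t => complex.Re (galerkin_source n y t) ^+ 2 +
   complex.Im (galerkin_source n y t) ^+ 2); last first.
  by apply/funext => t; rewrite normc_sqrE.
rewrite -hintD; [|exact: hcontX..].
by rewrite le_eqVlt; apply/orP; left; apply/eqP; ring.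
Qed.

End galerkin.

(** * Vanishing of the source and the mode estimate in the limit *)

Section galerkin_limit.
Context {R : realType} {d : nat}.
Local Notation pi := (@pi R).
Local Notation tup := (d.-tuple R).
Local Notation cmeas := (cmeasurable (torus d : set tup)).
Implicit Types (f : 'rV[int]_d -> R[i]) (k l : 'rV[int]_d) (y : tup) (r t T x e : R).

Let mt : measurable (torus d : set tup) := @measurable_torus R d.
Let Cpi : R := (2 * pi) ^+ d.
Let Cpi_gt0 : 0 < Cpi. Proof. by rewrite exprn_gt0// mulr_gt0// pi_gt0. Qed.

(** On the torus |theta_j / 2| <= pi / 2, so all sines vanish only at the origin. The origin is a
    null set because [d > 0]; for [d = 0] it would be an atom. *)
Lemma xi_norm_gt0_ae : (0 < d)%N ->
  {ae lebesgueT d, forall y, torus d y -> 0 < xi_norm y}.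
Proof.
move=> d0; exists [set y | forall i : 'I_d, [set 0] (tnth y i)]; split.
- rewrite (_ : mkset _ = \bigcap_(i in [set: 'I_d])
    ((fun y : tup => tnth y i) @^-1` [set 0])).
    apply: fin_bigcap_measurable => // i _.
    by rewrite -[X in measurable X]setTI; exact: measurable_tnth.
  by apply/seteqP; split => y /= Hy i; [move=> _; exact: Hy|exact: Hy].
- rewrite (lebesgueT_box (A := fun=> [set 0])) //.
  rewrite (eq_bigr (fun=> 0%E)); last by move=> i _; rewrite lebesgue_measure_set1.
  by rewrite big_const card_ord; case: d d0 => //= n _; rewrite mul0e.
move=> y /= /not_implyP[ty]; rewrite /xi_norm sqrtr_gt0 => /negP; rewrite -leNgt => H i.
have : xi y i = 0.
  have : \sum_(j < d) xi y j ^+ 2 = 0.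
    by apply/eqP; rewrite eq_le H sumr_ge0// => j _; exact: sqr_ge0.
  move=> /eqP; rewrite psumr_eq0 => [/allP/(_ i)|j _]; last exact: sqr_ge0.
  by rewrite mem_index_enum => /(_ isT); rewrite sqrf_eq0 => /eqP.
rewrite /xi => /eqP; rewrite mulf_eq0 pnatr_eq0/= => /eqP s0.
have := ty i; rewrite in_itv/= => /andP[h1 h2].
have pi0 := pi_gt0 R.
have [yi|yi|//] := ltgtP (tnth y i) 0.
- have : 0 < sin (- (tnth y i / 2)).
    by apply: sin_gt0_pi; apply/andP; split; lra.
  by rewrite sinN s0 oppr0 ltxx.
- have : 0 < sin (tnth y i / 2).
    by apply: sin_gt0_pi; apply/andP; split; lra.
  by rewrite s0 ltxx.
Qed.

(** The factor 4 per term comes from 2 + 2 4^k <= 4^(k+1); it is crude, but does not depend on the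
    truncation. *)
Lemma L2sq_sum_le (I : Type) (s : seq I) (g : I -> tup -> R[i]) (B : \bar R) :
  (0 <= B)%E -> (forall i, cmeas (g i)) -> (forall i, L2sq (g i) <= B)%E ->
  (L2sq (fun y => \sum_(i <- s) g i y)%R <= (4 ^+ size s)%:E * B)%E.
Proof.
move=> B0 mg gB; elim: s => [|i s IH].
  rewrite (L2sq_eq (h := fun=> 0)); last by move=> y; rewrite big_nil.
  rewrite /L2sq integral0_eq ?mul1e// => y _.
  by rewrite normc0_ expr0n.
rewrite (L2sq_eq (h := fun y => g i y + \sum_(j <- s) g j y)); last first.
  by move=> y; rewrite big_cons.
apply: le_trans (L2sqD (mg i) (cmeas_sum s mg)) _.
apply: (@le_trans _ _ (2%:E * B + 2%:E * ((4 ^+ size s)%:E * B))%E).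
  by apply: leeD; rewrite lee_pmul2l.
rewrite muleA -EFinM -ge0_muleDl ?lee_fin ?mulr_ge0 ?exprn_ge0// -EFinD.
rewrite lee_wpmul2r// lee_fin /= exprS.
have : 1 <= 4 ^+ size s :> R by rewrite exprn_ege1//; lra.
by lra.
Qed.

Lemma cmeas_galerkin_defect f n : cmeas (galerkin_defect f n).
Proof.
by apply: cmeas_sum => j; apply: cmeasD; exact: cmeas_shift_defect.
Qed.

Lemma L2sq_galerkin_defect f n :
  (L2sq (galerkin_defect f n.+1) <= (4 ^+ d.+1 * Cpi)%:E * sqnorm (off n f))%E.
Proof.
have B0 : (0 <= (4 * Cpi)%:E * sqnorm (off n f))%E.
  by rewrite mule_ge0 ?lee_fin ?mulr_ge0 ?(ltW Cpi_gt0)// sqnorm_ge0.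
have := @L2sq_sum_le _ (index_enum 'I_d)
  (fun j y => shift_defect (e_ j) f n.+1 y + shift_defect (- e_ j) f n.+1 y) _ B0 _ _.
have -> : size (index_enum 'I_d) = d by rewrite [index_enum _]unlock -enumT size_enum_ord.
rewrite muleA -EFinM.
have -> : 4 ^+ d.+1 * Cpi = 4 ^+ d * (4 * Cpi) by rewrite exprS; ring.
apply.
- by move=> j; apply: cmeasD; exact: cmeas_shift_defect.
- move=> j; apply: le_trans (L2sqD (cmeas_shift_defect _ _ _) (cmeas_shift_defect _ _ _)) _.
  have uj := unitary_shift_e_ j.
  rewrite (_ : ((4 * Cpi)%:E * _ = 2%:E * (Cpi%:E * sqnorm (off n f)) + 2%:E * (Cpi%:E * sqnorm (off n f)))%E).
    apply: leeD; rewrite lee_pmul2l//; apply: L2sq_shift_defect => //.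
    exact: unitary_shiftN.
  rewrite !muleA -!EFinM -ge0_muleDl ?lee_fin ?mulr_ge0 ?(ltW Cpi_gt0)// -EFinD.
  by congr (_%:E * _)%E; ring.
Qed.

Variables (a : R -> R) (a1 : R) (u0 u1 : 'rV[int]_d -> R[i]) (u : R -> 'rV[int]_d -> R[i]).
Hypothesis acont : hcont 0 a.
Hypothesis a_bnd : forall t, 0 <= t -> 0 <= a t <= a1.
Hypothesis hu : wave_solution a u0 u1 u.

Let src n y t := galerkin_source a u n y t.

(** Times are cut off below at 0: this leaves the values on [[0, T]] unchanged and yields a function
    continuous on the whole line. *)
Lemma cmeasurable_comp_fst (z : R -> R[i]) (D : set (R * tup)) : chcont z ->
  cmeasurable D (fun p => z (Num.max 0 p.1)).
Proof.
move=> [z1 z2]; split; apply: measurable_funTS.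
  apply: (@measurableT_comp _ _ _ _ _ _ (fun x => complex.Re (z (Num.max 0 x)))) => //.
  by apply: continuous_measurable_fun; exact: (hcont_continuous z1).
apply: (@measurableT_comp _ _ _ _ _ _ (fun x => complex.Im (z (Num.max 0 x)))) => //.
by apply: continuous_measurable_fun; exact: (hcont_continuous z2).
Qed.

Lemma cmeasurable_expi_snd l (D : set (R * tup)) :
  cmeasurable D (fun p => expi (dotp l p.2)).
Proof.
split; apply: measurable_funTS => /=.
  apply: (@measurableT_comp _ _ _ _ _ _ (fun y : tup => cos (dotp l y))) => //.
  under eq_fun do rewrite -[dotp _ _]add0r.
  exact: measurable_cos_dotp.
apply: (@measurableT_comp _ _ _ _ _ _ (fun y : tup => sin (dotp l y))) => //.
under eq_fun do rewrite -[dotp _ _]add0r.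
by apply: measurable_trig; exact: continuous_sin.
Qed.

Lemma cmeasurable_source n (D : set (R * tup)) :
  cmeasurable D (fun p => src n p.2 (Num.max 0 p.1)).
Proof.
apply: cmeasM.
  apply: (@cmeasurable_comp_fst (fun t => (a t ^+ 2)%:C%C)).
  by apply: chcont_real; exact: hcontX.
have mF l : cmeasurable D (fun p => fourier_sum (fun k => u (Num.max 0 p.1) (k + l)) n p.2).
  rewrite (_ : (fun p => _) = fun p => \sum_(k <- boxs n) expi (dotp (- k) p.2) * u (Num.max 0 p.1) (k + l)); last first.
    by apply/funext => p; rewrite fourier_sumE; apply: eq_bigr => k _; rewrite dotpN.
  apply: cmeas_sum => k; apply: cmeasM; first exact: cmeasurable_expi_snd.
  by apply: (cmeasurable_comp_fst _ (z := fun t => u t (k + l))); exact: chder_chcont (wave_chder hu _).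
have ms l : cmeasurable D (fun p => shift_defect l (u (Num.max 0 p.1)) n p.2).
  apply: cmeasB => //; apply: cmeasM; first exact: cmeasurable_expi_snd.
  rewrite (_ : (fun p => _) = fun p => fourier_sum (fun k => u (Num.max 0 p.1) (k + 0)) n p.2)//.
  by apply/funext => p; congr fourier_sum; apply/funext => k; rewrite addr0.
by apply: cmeas_sum => j; apply: cmeasD.
Qed.

Let Jn T n y := hint 0 T (fun t => normc (src n y t) ^+ 2).

Let hT n (p : R * tup) := (normc (src n p.2 (Num.max 0 p.1)) ^+ 2)%:E.

Let JnE T n y : (Jn T n y)%:E = (\int[lebesgue_measure]_(x in `[0%R, T]) hT n (x, y))%E.
Proof.
have cs : hcont 0 (fun t => normc (src n y t) ^+ 2).
  by apply: chcont_normc2; exact: chcont_galerkin_source hu n y.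
rewrite /Jn /hint /Rintegral fineK.
  by apply: eq_integral => x /set_mem /=; rewrite in_itv/= => /andP[x0 _]; rewrite /hT /= max_r.
apply: integrable_fin_num => //; apply: continuous_compact_integrable; first exact: segment_compact.
apply: continuous_subspaceW cs => x /=; rewrite !in_itv/= andbT.
by case/andP.
Qed.

Let mhT T n : measurable_fun ([set` `[0%R, T]] `*` torus d) (hT n).
Proof.
have [m1 m2] := cmeasurable_source n ([set` `[0%R, T]] `*` torus d).
rewrite (_ : hT n = EFin \o (fun p => complex.Re (src n p.2 (Num.max 0 p.1)) ^+ 2 +
   complex.Im (src n p.2 (Num.max 0 p.1)) ^+ 2)); last first.
  by apply/funext => p; rewrite /hT normc_sqrE.
by apply/measurable_EFinP; apply: measurable_funD; exact: measurable_funX.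
Qed.

Let hT0 n p : (0 <= hT n p)%E. Proof. by rewrite lee_fin sqr_ge0. Qed.

Let mJ T n : measurable_fun (torus d) (Jn T n).
Proof.
apply/measurable_EFinP.
have := @measurable_tonelli_rectangle _ _ _ _ R lebesgue_measure _ _
  (measurable_itv `[0%R, T]) mt (hT n) (@mhT T n) (hT0 n).
by apply: eq_measurable_fun => y _; rewrite /= -JnE.
Qed.

Let Jn_ge0 T n y : 0 <= Jn T n y.
Proof. by apply: hint_ge0 => t _; exact: sqr_ge0. Qed.

(** At each time the defect for the box [n.+1] is bounded by the tail of [u] outside the box [n],
    which is small uniformly on [[0, T]]. The two forms of Tonelli's theorem, used in succession,
    move the time integral outside. *)
Lemma integral_source_small T e : 0 <= T -> 0 < e ->
  exists N, forall n, (N <= n)%N ->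
   (\int[lebesgueT d]_(y in torus d) (Jn T n.+1 y)%:E <= e%:E)%E.
Proof.
move=> T0 e0.
(* The factor [1 + T] makes up for the length of the interval and remains positive at [T = 0];
   [1 + a1 ^+ 2 ^+ 2] is a positive bound for a^4. *)
pose Q := (1 + a1 ^+ 2 ^+ 2) * (4 ^+ d.+1 * Cpi) * (1 + T).
have P10 : 0 < 1 + a1 ^+ 2 ^+ 2 by rewrite ltr_pwDl// sqr_ge0.
have P20 : 0 < 4 ^+ d.+1 * Cpi by rewrite mulr_gt0// exprn_gt0.
have T1 : 0 < 1 + T by rewrite ltr_pwDl.
have Q0 : 0 < Q by rewrite mulr_gt0// mulr_gt0.
have [u2 cu _ _ _] := hu.
have [N HN] := @sqnorm_off_uniform _ _ u T (e / Q) (divr_gt0 e0 Q0)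
  (fun t ht => (u2 t ht).1) (fun t ht => (cu t ht).1).
exists N => n Nn.
under eq_integral do rewrite JnE.
rewrite -(@tonelli_rectangle2 _ _ _ _ R lebesgue_measure _ _ _
  (measurable_itv `[0%R, T]) mt (hT n.+1) (@mhT T n.+1) (hT0 n.+1)).
rewrite (@tonelli_rectangle1 _ _ _ _ R lebesgue_measure _ _ _
  (measurable_itv `[0%R, T]) mt (hT n.+1) (@mhT T n.+1) (hT0 n.+1)).
pose B := (1 + a1 ^+ 2 ^+ 2) * (4 ^+ d.+1 * Cpi) * (e / Q).
apply: (@le_trans _ _ (\int[lebesgue_measure]_(x in `[0%R, T]) (cst B%:E x))%E).
  apply: ge0_le_integral => //.
  - by move=> x _; apply: integral_ge0 => y _; exact: hT0.
  - exact: (@measurable_tonelli_rectangle1 _ _ _ _ R (lebesgueT d) _ _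
     (measurable_itv `[0%R, T]) mt (hT n.+1) (@mhT T n.+1) (hT0 n.+1)).
  move=> x /=; rewrite in_itv/= => /andP[x0 xT].
  have ax : normc (a x ^+ 2)%:C%C ^+ 2 <= 1 + a1 ^+ 2 ^+ 2.
    have /andP[ax0 ax1] := a_bnd x0.
    rewrite normc_sqrE /= expr0n addr0 ler_wpDl//.
    have h1 : a x ^+ 2 <= a1 ^+ 2 by rewrite ler_pXn2r ?nnegrE// (le_trans ax0).
    by rewrite ler_pXn2r ?nnegrE ?sqr_ge0.
  have -> : (\int[lebesgueT d]_(y in torus d) hT n.+1 (x, y) =
      L2sq (fun y => (a x ^+ 2)%:C%C * galerkin_defect (u x) n.+1 y)%R)%E.
    by apply: eq_integral => y _; rewrite /hT /= max_r.
  apply: le_trans (L2sqM_le (cmeas_galerkin_defect _ _) (cmeas_cst _) (ltW P10) (fun=> ax)) _.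
  rewrite /B -mulrA EFinM lee_pmul2l ?lte_fin//.
  apply: le_trans (L2sq_galerkin_defect _ _) _.
  by rewrite [leRHS]EFinM lee_pmul2l ?lte_fin//; apply: HN => //; rewrite x0.
rewrite integral_cst//= lebesgue_measure_itv/= lte_fin.
case: ifP => _; last by rewrite mule0 lee_fin ltW.
rewrite -EFinD -EFinM lee_fin subr0 /B /Q.
rewrite (_ : _ * T = e * (T / (1 + T))); last first.
  by field; rewrite !gt_eqF// ?mulr_gt0.
by rewrite ler_piMr ?(ltW e0)// ler_pdivrMr// mul1r ler_wpDl.
Qed.

Variables (C : R) (W : R -> R).
Hypothesis C_ge0 : 0 <= C.
Hypothesis W_ge0 : forall x, 0 <= W x.
Hypothesis scalar_bound : forall x (p q g : R -> R) T, 0 < x ->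
  x <= Num.sqrt (4 * d%:R) -> wave a x p q g -> 0 <= T ->
  scalar_energy a x (p T) (q T) T <=
  C * W x * (scalar_energy a x (p 0) (q 0) 0 + (1 + T) * hint 0 T (fun t => g t ^+ 2)).

Lemma mode_energy_perturb t y (v w v' w' : R[i]) e :
  normc (v - v') ^+ 2 <= e -> normc (w - w') ^+ 2 <= e ->
  mode_energy a t y v' w' <=
  2 * mode_energy a t y v w + 2 * (1 + a t ^+ 2 * xi_norm y ^+ 2) * e.
Proof.
move=> hv hw; rewrite /mode_energy.
have tri (z z' : R[i]) : normc (z - z') ^+ 2 <= e -> normc z' ^+ 2 <= 2 * normc z ^+ 2 + 2 * e.
  move=> h; have := sqr_normcD z (- (z - z')); rewrite sqr_normcN opprB addrC subrK.
  by move: (normc z' ^+ 2) (normc z ^+ 2) (normc (z - z') ^+ 2) h => *; lra.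
have A0 : 0 <= a t ^+ 2 * xi_norm y ^+ 2 by rewrite mulr_ge0 ?sqr_ge0.
have := ler_wpM2l A0 (tri _ _ hv); have := tri _ _ hw.
by move: (normc v' ^+ 2) (normc v ^+ 2) (normc w' ^+ 2) (normc w ^+ 2) => *; lra.
Qed.

(** At almost every [y] the estimate for partial sums is transferred to the limits at a single
    index, chosen for that point and for the tolerated error. The 4 consists of one factor 2 for the
    energy at [T] and another for the energy at 0. *)
Lemma mode_energy_estimate (v0 w0 v w : tup -> R[i]) T : (0 < d)%N -> 0 <= T ->
  is_fourier (u 0) v0 -> is_fourier (dt u 0) w0 ->
  is_fourier (u T) v -> is_fourier (dt u T) w ->
  {ae lebesgueT d, forall y, torus d y ->
    mode_energy a T y (v y) (w y) <=
    4 * C * W (xi_norm y) * mode_energy a 0 y (v0 y) (w0 y)}.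
Proof.
move=> d0 T0 /is_fourierP[mv0 Hv0] /is_fourierP[mw0 Hw0]
  /is_fourierP[mv Hv] /is_fourierP[mw Hw].
pose D (f : 'rV[int]_d -> R[i]) (g : tup -> R[i]) n y :=
  normc (fourier_sum f n.+1 y - g y) ^+ 2.
have mD f g n : cmeas g -> measurable_fun (torus d) (D f g n).
  by move=> mg; apply: measurable_normc2; apply: cmeasB => //; exact: cmeas_fourier_sum.
have D0 f g n y : 0 <= D f g n y by exact: sqr_ge0.
(* Adding the five nonnegative errors makes all of them small at one common index; a vanishing lower
   limit of each separately would not provide it. *)
pose H n y := D (u 0) v0 n y + D (dt u 0) w0 n y + D (u T) v n y + D (dt u T) w n y
  + Jn T n.+1 y.
have mH n : measurable_fun (torus d) (H n).
  by repeat apply: measurable_funD; first [exact: mD | exact: mJ].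
have H0 n y : torus d y -> 0 <= H n y by move=> _; rewrite !addr_ge0.
have smallH e : 0 < e -> exists N, forall n, (N <= n)%N ->
    (\int[lebesgueT d]_(y in torus d) (H n y)%:E <= e%:E)%E.
  move=> e0; have e5 : 0 < e / 5 by rewrite divr_gt0.
  have [N1 h1] := Hv0 _ e5; have [N2 h2] := Hw0 _ e5; have [N3 h3] := Hv _ e5.
  have [N4 h4] := Hw _ e5; have [N5 h5] := integral_source_small T0 e5.
  exists (N1 + N2 + N3 + N4 + N5)%N => n Nn.
  have ID (f g : tup -> R) (x1 x2 : R) : measurable_fun (torus d) f ->
      measurable_fun (torus d) g -> (forall y, 0 <= f y) -> (forall y, 0 <= g y) ->
      (\int[lebesgueT d]_(y in torus d) (f y)%:E <= x1%:E)%E ->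
      (\int[lebesgueT d]_(y in torus d) (g y)%:E <= x2%:E)%E ->
      (\int[lebesgueT d]_(y in torus d) (f y + g y)%:E <= (x1 + x2)%:E)%E.
    move=> mf mg f0 g0 hf hg; under eq_integral do rewrite EFinD.
    rewrite ge0_integralD//; last 4 first.
    - by move=> y _; rewrite lee_fin.
    - exact/measurable_EFinP.
    - by move=> y _; rewrite lee_fin.
    - exact/measurable_EFinP.
    by rewrite EFinD leeD.
  have DD f g f' g' y : 0 <= D f g n y + D f' g' n y by rewrite addr_ge0.
  have mDD f g f' g' : cmeas g -> cmeas g' ->
      measurable_fun (torus d) (fun y => D f g n y + D f' g' n y).
    by move=> mg mg'; apply: measurable_funD; exact: mD.
  rewrite (_ : e = e / 5 + e / 5 + e / 5 + e / 5 + e / 5); last by field.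
  have q1 : (\int[lebesgueT d]_(y in torus d) (D (u 0) v0 n y)%:E <= (e / 5)%:E)%E.
    by apply: h1; lia.
  have q2 : (\int[lebesgueT d]_(y in torus d) (D (dt u 0) w0 n y)%:E <= (e / 5)%:E)%E.
    by apply: h2; lia.
  have q3 : (\int[lebesgueT d]_(y in torus d) (D (u T) v n y)%:E <= (e / 5)%:E)%E.
    by apply: h3; lia.
  have q4 : (\int[lebesgueT d]_(y in torus d) (D (dt u T) w n y)%:E <= (e / 5)%:E)%E.
    by apply: h4; lia.
  have q5 : (\int[lebesgueT d]_(y in torus d) (Jn T n.+1 y)%:E <= (e / 5)%:E)%E.
    by apply: h5; lia.
  have m2 := mDD (u 0) v0 (dt u 0) w0 mv0 mw0.
  have m3 := measurable_funD m2 (mD (u T) v n mv).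
  have m4 := measurable_funD m3 (mD (dt u T) w n mw).
  have i2 := ID _ _ _ _ (mD _ _ n mv0) (mD _ _ n mw0) (D0 _ _ n) (D0 _ _ n) q1 q2.
  have p2 := DD (u 0) v0 (dt u 0) w0.
  have i3 := ID _ _ _ _ m2 (mD _ _ n mv) p2 (D0 _ _ n) i2 q3.
  have p3 y : 0 <= D (u 0) v0 n y + D (dt u 0) w0 n y + D (u T) v n y by rewrite addr_ge0.
  have i4 := ID _ _ _ _ m3 (mD _ _ n mw) p3 (D0 _ _ n) i3 q4.
  have p4 y : 0 <= D (u 0) v0 n y + D (dt u 0) w0 n y + D (u T) v n y + D (dt u T) w n y.
    by rewrite addr_ge0.
  exact: ID _ _ _ _ m4 (mJ _ _) p4 (Jn_ge0 _ _) i4 q5.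
have := integral_small_ae mt mH H0 smallH.
apply: filterS2 (xi_norm_gt0_ae d0) => y xi0 Hs ty.
have {}xi0 := xi0 ty; have {}Hs := Hs ty.
set A := a T ^+ 2 * xi_norm y ^+ 2; set A0 := a 0 ^+ 2 * xi_norm y ^+ 2.
(* [K] collects the coefficients of the five errors in the final inequality, so that errors of size
   [e / K] cost at most [e]; the last 1 makes it positive. *)
pose K := 2 * (C * W (xi_norm y) * (2 * (1 + A0) + (1 + T))) + 2 * (1 + A) + 1.
have A_ge0 : 0 <= A by rewrite mulr_ge0 ?sqr_ge0.
have A0_ge0 : 0 <= A0 by rewrite mulr_ge0 ?sqr_ge0.
have CW0 : 0 <= C * W (xi_norm y) by rewrite mulr_ge0.
have K0 : 0 < K.
  rewrite ltr_wpDl// addr_ge0 ?mulr_ge0 ?addr_ge0// ?mulr_ge0 ?addr_ge0//.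
apply/ler_addgt0Pr => e e0; have [n _ Hn] := Hs _ 0%N (divr_gt0 e0 K0).
have e'0 := divr_gt0 e0 K0; set e' := e / K in Hn e'0.
have [d1 d2 d3 d4 d5] : [/\ D (u 0) v0 n y <= e', D (dt u 0) w0 n y <= e',
   D (u T) v n y <= e', D (dt u T) w n y <= e' & Jn T n.+1 y <= e'].
  move: Hn (D0 (u 0) v0 n y) (D0 (dt u 0) w0 n y) (D0 (u T) v n y) (D0 (dt u T) w n y)
    (Jn_ge0 T n.+1 y); rewrite /H.
  by move: (D _ _ _ _) (D _ _ _ _) (D _ _ _ _) (D _ _ _ _) (Jn _ _ _) => *; split; lra.
have E1 := mode_energy_perturb T y d3 d4.
have E2 := galerkin_energy acont hu scalar_bound n.+1 xi0 T0.
have d1' : normc (v0 y - fourier_sum (u 0) n.+1 y) ^+ 2 <= e' by rewrite -sqr_normcN opprB.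
have d2' : normc (w0 y - fourier_sum (dt u 0) n.+1 y) ^+ 2 <= e' by rewrite -sqr_normcN opprB.
have E3 := mode_energy_perturb 0 y d1' d2'.
have eE : e = K * e' by rewrite /e' mulrC divfK// gt_eqF.
have E4 : C * W (xi_norm y) *
  (mode_energy a 0 y (fourier_sum (u 0) n.+1 y) (fourier_sum (dt u 0) n.+1 y) +
   (1 + T) * Jn T n.+1 y) <= C * W (xi_norm y) * (2 * mode_energy a 0 y (v0 y) (w0 y) +
     2 * (1 + A0) * e' + (1 + T) * e').
  by rewrite ler_wpM2l// lerD// ler_wpM2l// addr_ge0.
apply: (le_trans E1).
have := le_trans E2 E4; rewrite eE /K -/A.
move: (mode_energy a T y _ _) (mode_energy a 0 y (v0 y) _) => *.
lra.
Qed.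

End galerkin_limit.

(** * Total energy, pointwise time derivatives and measurability of the weight *)

Section evolution.
Context {R : realType} {d : nat}.
Local Notation pi := (@pi R).
Local Notation tup := (d.-tuple R).
Local Notation cmeas := (cmeasurable (torus d : set tup)).
Implicit Types (f : 'rV[int]_d -> R[i]) (k l : 'rV[int]_d) (y : tup) (r t T x e : R).

Let mt : measurable (torus d : set tup) := @measurable_torus R d.
Let Cpi : R := (2 * pi) ^+ d.
Let Cpi_gt0 : 0 < Cpi. Proof. by rewrite exprn_gt0// mulr_gt0// pi_gt0. Qed.

Lemma mode_energyE (a : R -> R) t y (v w : R[i]) : mode_energy a t y v w =
  normc w ^+ 2 + a t ^+ 2 * \sum_(j < d) normc ((expi (tnth y j) - 1) * v) ^+ 2.
Proof.
rewrite /mode_energy xi_norm2 -mulrA; congr (_ + _ * _).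
by rewrite big_distrl; apply: eq_bigr => j _; rewrite /= sqr_normcM normc_expi1.
Qed.

Lemma mode_energy_ge0 (a : R -> R) t y (v w : R[i]) : 0 <= mode_energy a t y v w.
Proof. by rewrite /mode_energy -exprMn addr_ge0 ?sqr_ge0// mulr_ge0// sqr_ge0. Qed.

Lemma measurable_mode_energy (a : R -> R) t (v w : tup -> R[i]) : cmeas v -> cmeas w ->
  measurable_fun (torus d) (fun y => mode_energy a t y (v y) (w y)).
Proof.
move=> mv mw; under eq_fun do rewrite mode_energyE.
apply: measurable_funD; first exact: measurable_normc2.
apply: measurable_funM; first exact: measurable_cst.
apply: measurable_sum => j; apply: measurable_normc2; apply: cmeasM => //.
apply: cmeasB; last exact: cmeas_cst.
by apply: cmeas_eq (cmeas_expi_dotp (e_ j)) => y; rewrite dotp_e_.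
Qed.

(** [sqnorm_le_is_fourier] is applied to [dt u] and to each difference [Dplus j u], whose transform
    carries the multiplier e^(i theta_j) - 1 of modulus |xi_j|. *)
Lemma energy_le_mode_energy (a : R -> R) (u : R -> 'rV[int]_d -> R[i]) t (v w : tup -> R[i]) :
  l2 (u t) -> is_fourier (u t) v -> is_fourier (dt u t) w ->
  (energy a u t <= (2 / Cpi)%:E *
     \int[lebesgueT d]_(y in torus d) (mode_energy a t y (v y) (w y))%:E)%E.
Proof.
move=> u2 fv fw; have [mv _] := (is_fourierP _ _).1 fv; have [mw _] := (is_fourierP _ _).1 fw.
have fD j := is_fourier_Dplus j u2 fv.
have mD j := ((is_fourierP _ _).1 (fD j)).1.
have CV : ((2 / Cpi)%:E = (Cpi^-1)%:E * 2%:E :> \bar R)%E by rewrite -EFinM mulrC.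
have le1 f g : is_fourier f g -> (sqnorm f <= (2 / Cpi)%:E * L2sq g)%E.
  move=> /sqnorm_le_is_fourier h.
  rewrite CV -muleA -(@lee_pmul2l _ Cpi%:E)// muleA -EFinM divff ?gt_eqF// mul1e.
  exact: h.
rewrite /energy.
have -> : (\int[lebesgueT d]_(y in torus d) (mode_energy a t y (v y) (w y))%:E =
   L2sq w + (a t ^+ 2)%:E * \sum_(j < d) L2sq (fun y => (expi (tnth y j) - 1) * v y)%R)%E.
  under eq_integral do rewrite mode_energyE EFinD (EFinM (a t ^+ 2)) -sumEFin.
  rewrite ge0_integralD//; last 4 first.
  - by move=> y _; rewrite lee_fin sqr_ge0.
  - by apply/measurable_EFinP; exact: measurable_normc2.
  - move=> y _; rewrite mule_ge0 ?lee_fin ?sqr_ge0// sume_ge0// => j _.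
    by rewrite lee_fin sqr_ge0.
  - apply: emeasurable_funM; first exact: measurable_cst.
    by apply: emeasurable_sum => j; apply/measurable_EFinP; exact: measurable_normc2.
  rewrite ge0_integralZl//; last 3 first.
  - by apply: emeasurable_sum => j; apply/measurable_EFinP; exact: measurable_normc2.
  - by move=> y _; rewrite sume_ge0// => j _; rewrite lee_fin sqr_ge0.
  - by rewrite lee_fin sqr_ge0.
  rewrite ge0_integral_sum//; last by move=> j y _; rewrite lee_fin sqr_ge0.
  by move=> j; apply/measurable_EFinP; exact: measurable_normc2.
have c0 : (0 <= (2 / Cpi)%:E :> \bar R)%E by rewrite lee_fin divr_ge0// ltW.
rewrite ge0_muleDr ?L2sq_ge0//; last first.
  rewrite mule_ge0 ?lee_fin ?sqr_ge0// sume_ge0// => j _; exact: L2sq_ge0.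
apply: leeD; first exact: le1.
rewrite muleCA lee_wpmul2l ?lee_fin ?sqr_ge0//.
rewrite ge0_sume_distrr => [|j _]; last exact: L2sq_ge0.
by apply: lee_sum => j _; exact: le1 (fD j).
Qed.

(** The difference quotients with step 1 / (n + 1) converge to the derivative wherever [uh] is
    differentiable in time, and to [w] in mean square; the two limits agree almost everywhere. This
    ties the derivative in [energy_density] to the transform of [dt u]. *)
Lemma fourier_derivative_ae (u : R -> 'rV[int]_d -> R[i]) (uh : R -> tup -> R[i])
    (w : tup -> R[i]) t :
  (forall r k, 0 <= r -> chderivable (u^~ k) r) ->
  (forall t, 0 <= t -> l2_continuous_at (dt u) t) ->
  is_fourier_evolution u uh -> 0 <= t -> is_fourier (dt u t) w ->
  {ae lebesgueT d, forall y, torus d y -> chderive (fun s => uh s y) t = w y}.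
Proof.
move=> du cu [fuh duh] ht fw; have [mw _] := (is_fourierP _ _).1 fw.
pose h n : R := n.+1%:R^-1.
have h0 n : 0 < h n by rewrite invr_gt0 ltr0n.
pose G n y := ((h n)^-1)%:C%C * (uh (t + h n) y - uh t y).
have th n : 0 <= t + h n by rewrite addr_ge0// ltW.
have fG n : is_fourier (fun k => ((h n)^-1)%:C%C * (u (t + h n) k - u t k)) (G n).
  by apply: is_fourierZ; apply: is_fourierB; exact: fuh.
have mG n := ((is_fourierP _ _).1 (fG n)).1.
have small e : 0 < e -> exists N, forall n, (N <= n)%N ->
    (\int[lebesgueT d]_(y in torus d) (normc (G n y - w y) ^+ 2)%:E <= e%:E)%E.
  move=> e0; have e'0 : 0 < e / (2 * Cpi) by rewrite divr_gt0// mulr_gt0.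
  have near_t : \forall r \near t, r \in `[0, +oo[ ->
      (sqnorm (fun k => dt u r k - dt u t k)%R < (e / (2 * Cpi))%:E)%E.
    apply: (cu t ht [set x | (x < (e / (2 * Cpi))%:E)%E]); apply: open_nbhs_nbhs.
    by split; [exact: open_ereal_lt_ereal|rewrite /= lte_fin].
  have [del /= del0 Hdel] := near_t.
  have [N _ HN] := near_infty_natSinv_lt (PosNum del0).
  exists N => n Nn.
  apply: le_trans (is_fourier_bound (is_fourierB (fG n) fw)) _.
  rewrite (_ : e%:E = (2 * Cpi)%:E * (e / (2 * Cpi))%:E)%E; last first.
    by rewrite -EFinM; congr EFin; field; rewrite gt_eqF.
  rewrite lee_pmul2l ?lte_fin ?mulr_gt0//.
  apply: sqnorm_diff_quotient => // r /andP[tr rt].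
  apply/ltW/Hdel; last by rewrite in_itv/= (le_trans ht).
  rewrite /= ltr_norml; have := HN n Nn; rewrite /= -/(h n) => hn.
  by apply/andP; split; lra.
have H := @integral_small_ae _ _ _ _ _ mt (fun n y => normc (G n y - w y) ^+ 2)
  (fun n => measurable_normc2 (cmeasB (mG n) mw)) (fun n y _ => sqr_ge0 _) small.
apply: filterS2 duh H => y dy Hy ty; have [d1 d2] := dy ty t ht.
have {}Hy := Hy ty.
set z := chderive _ _.
apply/eqP; rewrite -subr_eq0; apply/eqP/eq0_normc/eqP; rewrite -sqrf_eq0; apply/eqP.
apply/eqP; rewrite eq_le sqr_ge0 andbT; apply/ler_addgt0Pr => e e0; rewrite add0r.
(* The final sum is 2 (e1^2 + e1^2) + 2 e1 <= 6 e1 <= e, where [e1 <= 1] gives e1^2 <= e1. *)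
pose e1 := Num.min 1 (e / 8).
have e10 : 0 < e1 by rewrite lt_min ltr01 divr_gt0.
have e1e : e1 <= e / 8 by rewrite ge_min lexx orbT.
have e11 : e1 <= 1 by rewrite ge_min lexx.
have [del1 /= del10 H1] := hderivable_near d1 e10.
have [del2 /= del20 H2] := hderivable_near d2 e10.
have [N1 _ HN1] := near_infty_natSinv_lt (PosNum del10).
have [N2 _ HN2] := near_infty_natSinv_lt (PosNum del20).
have [n Nn Hn] := Hy e1 (maxn N1 N2) e10.
move: Nn; rewrite geq_max => /andP[n1 n2].
have hn1 : h n < del1 := HN1 n n1; have hn2 : h n < del2 := HN2 n n2.
have tn : t + h n != t by rewrite -subr_eq0 addrAC subrr add0r gt_eqF.
have hnn : `|t - (t + h n)| = h n by rewrite opprD addNKr normrN gtr0_norm.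
have b1 := H1 (t + h n); rewrite /= hnn in b1; have {}b1 := b1 hn1 (th n) tn.
have b2 := H2 (t + h n); rewrite /= hnn in b2; have {}b2 := b2 hn2 (th n) tn.
have zG : normc (z - G n y) ^+ 2 <= e1 ^+ 2 + e1 ^+ 2.
  have sq (r : R) : `|r| < e1 -> r ^+ 2 <= e1 ^+ 2.
    by move=> /ltW re; rewrite -(real_normK (num_real r)); apply: lerXn2r => //; rewrite nnegrE ltW.
  rewrite normc_sqrE; apply: lerD.
    apply: le_trans (sq _ b1); rewrite le_eqVlt; apply/orP; left; apply/eqP; congr (_ ^+ 2).
    rewrite /z /G /hquot (_ : t + h n - t = h n); last by rewrite addrAC subrr add0r.
    move: (uh _ _) (uh _ _) => [p q] [p' q'] /=; ring.
  apply: le_trans (sq _ b2); rewrite le_eqVlt; apply/orP; left; apply/eqP; congr (_ ^+ 2).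
  rewrite /z /G /hquot (_ : t + h n - t = h n); last by rewrite addrAC subrr add0r.
  move: (uh _ _) (uh _ _) => [p q] [p' q'] /=; ring.
have := sqr_normcD (z - G n y) (G n y - w y); rewrite addrA subrK.
have : e1 ^+ 2 <= e1 by rewrite expr2 ler_piMr// ltW.
move: zG Hn; move: (normc _ ^+ 2) (normc _ ^+ 2) (normc _ ^+ 2) => *.
lra.
Qed.

Lemma measurable_xi_norm (D : set tup) : measurable_fun D (fun y : tup => xi_norm y).
Proof.
have ms : measurable_fun [set: R] (@Num.sqrt R).
  by apply: continuous_measurable_fun; exact: sqrt_continuous.
have mn : measurable_fun [set: R] (@sin R).
  by apply: continuous_measurable_fun; exact: continuous_sin.
apply: measurable_funTS; apply: (measurableT_comp ms).
apply: measurable_sum => j; apply: measurable_funX; apply: measurable_funM => //.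
apply: (measurableT_comp mn).
by apply: measurable_funM => //; exact: measurable_tnth.
Qed.

(** The value of Theta at [Linv Lam (N / x)] is nonincreasing in [x], but its product with [x] need
    not be monotone. Hence the auxiliary [G], monotone on the whole line, from which this value is
    recovered by a logarithm; where [xi_norm] is 0 the exponent vanishes in either form. *)
Lemma measurable_weight (Theta Lam : R -> R) (N : R) : 0 < N ->
  (forall s t : R, 0 <= s -> s <= t -> Theta s <= Theta t) ->
  (forall r, 0 <= Linv Lam r) ->
  (forall r s : R, r <= s -> Linv Lam r <= Linv Lam s) ->
  measurable_fun (torus d) (fun y : tup => weight Theta Lam N y).
Proof.
move=> N0 Tm L0 Lm.
pose G x := if 0 < x then expR (- Theta (Linv Lam (N / x))) else 0.
have mG : measurable_fun setT G.
  apply: nondecreasing_measurable => // x x' xx'; rewrite /G.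
  case: ifPn => [x0|_]; last by case: ifP => // _; exact: expR_ge0.
  have x'0 := lt_le_trans x0 xx'.
  rewrite x'0 ler_expR lerN2; apply: Tm => //; apply: Lm.
  by rewrite ler_pM2l// lef_pV2.
rewrite (_ : (fun y => _) = fun y => expR (- (2 * xi_norm y * ln (G (xi_norm y))))).
  apply: measurableT_comp; first exact: measurable_expR.
  apply: measurableT_comp => //; apply: measurable_funM.
    by apply: measurable_funM => //; exact: measurable_xi_norm.
  apply: measurableT_comp; first exact: measurable_ln.
  by apply: (measurableT_comp mG); exact: measurable_xi_norm.
apply/funext => y; rewrite /weight /G; case: ifPn => [_|].
  by rewrite expRK mulrN opprK.
rewrite -leNgt => H.
have -> : xi_norm y = 0 by apply/eqP; rewrite eq_le H sqrtr_ge0.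
by rewrite !mulr0 !mul0r oppr0.
Qed.

End evolution.

(** * Translation of the assumptions on a and Xi *)

Section hypotheses.
Context {R : realType}.
Implicit Types (s t : R).

(** [hint] takes the finite part of the extended integral, with infinite values read as 0. *)
Lemma hint_le s t f (r : R) : 0 <= r ->
  (\int[lebesgue_measure]_(x in `[s, t]) (f x)%:E <= r%:E)%E -> hint s t f <= r.
Proof.
move=> r0; rewrite /hint /Rintegral; case: integral => [x| |//]; first by rewrite lee_fin.
by [].
Qed.

Lemma measurable_hcont s t f : hcont s f -> measurable_fun `[s, t] f.
Proof.
move=> cf; apply: (@eq_measurable_fun _ _ _ _ _ (fun x => f (Num.max s x))) => /=.
  by move=> x /set_mem/=; rewrite in_itv/= => /andP[sx _]; rewrite max_r.
by apply: measurable_funTS; apply: continuous_measurable_fun; exact: hcont_continuous.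
Qed.

(** Induction on the number of derivatives that remain. The top derivative is continuous by
    assumption, the lower ones because they are differentiable. *)
Lemma is_Cm_symbol (Xi : R -> R) m (f : R -> R) (A : R) :
  (forall t, 0 <= t -> 0 < Xi t) -> is_Cm m f -> 0 <= A ->
  (forall t, 0 <= t -> `|f t| <= A) ->
  (forall k, (1 <= k <= m)%N -> exists2 Ck : R, 0 < Ck &
     forall t, 0 <= t -> `|iter k hderive f t| <= Ck * Xi t ^- k) ->
  symbol Xi m 0 f.
Proof.
move=> Xi0 [df cf] A0 fA fk.
have H n i : (n + i)%N = m -> symbol Xi n i (iter i hderive f).
  elim: n i => [|n IH] i ni; rewrite symbolE; split=> //.
  - by move: ni; rewrite add0n => ->.
  - case: i ni => [|i] ni; first by exists A => // t t0; rewrite expr0 invr1 mulr1; exact: fA.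
    have /fk[C C0 HC] : (1 <= i.+1 <= m)%N by rewrite -ni/= leqnn.
    by exists C => //; exact: ltW.
  - apply/hcontP => x x0; apply: hderivable_cvg; apply: df => //.
    by rewrite -ni addSn ltnS leq_addl.
  - case: i ni => [|i] ni; first by exists A => // t t0; rewrite expr0 invr1 mulr1; exact: fA.
    have /fk[C C0 HC] : (1 <= i.+1 <= m)%N by rewrite -ni/= leq_addl.
    by exists C => //; exact: ltW.
  - exists (iter i.+1 hderive f); last by apply: IH; rewrite addnS -addSn.
    by apply: hder_hderive => t t0; apply: df => //; rewrite -ni addSn ltnS leq_addl.
by apply: (H m 0); rewrite addn0.
Qed.

Lemma integral_tail_bound (Xi : R -> R) m (M s t c : R) g :
  (forall t, 0 <= t -> 0 < Xi t) ->
  lebesgue_measure.-integrable `[0, +oo[ (fun s => (Xi s ^- m)%:E) ->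
  0 <= M -> 0 <= s -> s <= t -> 0 <= c -> hcont s g ->
  (forall u, s <= u -> 0 <= g u <= c * Xi u ^- m) ->
  (\int[lebesgue_measure]_(u in `[s, +oo[) (Xi u ^- m)%:E <= M%:E)%E ->
  hint s t g <= c * M.
Proof.
move=> Xi0 iXi M0 s0 st c0 cg gX XM.
have s0oo : (`[s, +oo[ : set R) `<=` `[0, +oo[.
  by move=> x /=; rewrite !in_itv/= !andbT; exact: le_trans.
have stoo : (`[s, t] : set R) `<=` `[s, +oo[.
  by move=> x /=; rewrite !in_itv/= andbT => /andP[].
have mX : measurable_fun (`[s, +oo[ : set R) (fun s => (Xi s ^- m)%:E).
  apply: measurable_funS s0oo _ => //.
  exact: measurable_int iXi.
have Xi_ge0 u : s <= u -> 0 <= Xi u ^- m.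
  by move=> su; rewrite invr_ge0 exprn_ge0// ltW// Xi0// (le_trans s0).
apply: hint_le; first exact: mulr_ge0.
apply: (@le_trans _ _ (c%:E * \int[lebesgue_measure]_(u in `[s, +oo[) (Xi u ^- m)%:E)%E); last first.
  by rewrite EFinM lee_wpmul2l.
rewrite -ge0_integralZl//; last first.
  by move=> x /=; rewrite in_itv/= andbT => sx; rewrite lee_fin Xi_ge0.
apply: (@le_trans _ _ (\int[lebesgue_measure]_(u in `[s, t]) (c%:E * (Xi u ^- m)%:E))%E).
  apply: ge0_le_integral => //.
  - by move=> x /=; rewrite in_itv/= => /andP[sx _]; rewrite lee_fin; have /andP[] := gX _ sx.
  - by apply/measurable_EFinP; exact: measurable_hcont.
  - apply: emeasurable_funM; first exact: measurable_cst.
    exact: measurable_funS stoo mX.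
  - by move=> x /=; rewrite in_itv/= => /andP[sx _]; rewrite -EFinM lee_fin; have /andP[] := gX _ sx.
apply: ge0_subset_integral => //.
  by apply: emeasurable_funM => //; exact: measurable_cst.
by move=> x /=; rewrite in_itv/= andbT => sx; rewrite -EFinM lee_fin mulr_ge0// Xi_ge0.
Qed.

End hypotheses.

(** The estimate [key] holds for arbitrary representatives of the transforms. With those of a given
    evolution it becomes the pointwise estimate; with [fourier] it is integrated over the torus and
    gives (i) and (ii), with the same [N0]. *)
Theorem theorem3p4 (R : realType) (d m : nat)
    (a Theta Xi Lam : R -> R) (a0 a1 ainf : R)
    (hd : (1 <= d)%N) (hm : (2 <= m)%N)
    (ha : is_Cm m a)
    (ha0 : 0 < a0) (ha01 : a0 <= a1)
    (ha_bounds : forall t : R, 0 <= t -> a0 <= a t <= a1)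
    (hTheta_pos : forall t : R, 0 <= t -> 0 < Theta t)
    (hTheta_mono : {in `[0, +oo[ &, {homo Theta : s t / s <= t}})
    (hXi_pos : forall t : R, 0 <= t -> 0 < Xi t)
    (hXi_mono : {in `[0, +oo[ &, {homo Xi : s t / s <= t}})
    (hLam_pos : forall t : R, 0 <= t -> 0 < Lam t)
    (hLam_cont : {within `[0, +oo[, continuous Lam})
    (hLam_mono : {in `[0, +oo[ &, {homo Lam : s t / s < t}})
    (hLam_lim : Lam t @[t --> +oo] --> +oo)
    (hainf : 0 < ainf)
    (hstab : forall t : R, 0 <= t ->
       (\int[lebesgue_measure]_(s in `[0%R, t]) (`|(a s - ainf)%R|)%:E <= (Theta t)%:E)%E)
    (hderiv : forall k, (1 <= k <= m)%N ->
       exists2 Ck : R, 0 < Ck &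
         forall t : R, 0 <= t -> `|iter k hderive a t| <= Ck * Xi t ^- k)
    (hTL_mono : {in `[0, +oo[ &, {homo (fun t => Theta t / Lam t) : s t / s <= t}})
    (hTL_lim : Theta t / Lam t @[t --> +oo] --> +oo)
    (hLamXi : exists2 C0 : R, 0 < C0 & forall t : R, 0 <= t -> Lam t <= C0 * Xi t)
    (hXi_L1 : lebesgue_measure.-integrable `[0, +oo[ (fun s => (Xi s ^- m)%:E))
    (hsup : (ereal_sup
       ((fun t : R => (Lam t ^+ m * (Theta t)^-1)%:E *
           \int[lebesgue_measure]_(s in `[t, +oo[) (Xi s ^- m)%:E)
        @` [set t : R | (0 <= t)%R]) < +oo)%E) :
  [/\ (* pointwise estimate of the energy density *)
      exists N0 C : R, [/\ 0 < N0, 0 < C &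
        forall (u0 u1 : 'rV[int]_d -> R[i]) (u : R -> 'rV[int]_d -> R[i])
               (uh : R -> d.-tuple R -> R[i]),
          wave_solution a u0 u1 u -> is_fourier_evolution u uh ->
          forall t : R, 0 <= t ->
            {ae lebesgueT d, forall theta, torus d theta ->
               energy_density a uh t theta <=
               C * expR (2 * xi_norm theta *
                         Theta (Linv Lam (N0 / xi_norm theta))) *
               energy_density a uh 0 theta}],
      (* (i) *)
      forall (u0 u1 : 'rV[int]_d -> R[i]) (u : R -> 'rV[int]_d -> R[i]),
        wave_solution a u0 u1 u ->
        (forall N : R, 1 <= N -> (U a Theta Lam N u0 u1 < +oo)%E) ->
        exists N0 C : R, [/\ 0 < N0, 0 < C &
          forall t : R, 0 <= t -> (energy a u t <= C%:E * U a Theta Lam N0 u0 u1)%E] &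
      (* (ii) *)
      exists N0 C : R, [/\ 0 < N0, 0 < C &
        forall (u0 u1 : 'rV[int]_d -> R[i]) (u : R -> 'rV[int]_d -> R[i]),
          wave_solution a u0 u1 u ->
          (U a Theta Lam N0 u0 u1 < +oo)%E ->
          forall t : R, 0 <= t -> (energy a u t <= C%:E * U a Theta Lam N0 u0 u1)%E]].
Proof.
have Tm s t : 0 <= s -> s <= t -> Theta s <= Theta t.
  by move=> s0 st; apply: hTheta_mono => //; rewrite in_itv/= andbT// (le_trans s0).
have Lm s t : 0 <= s -> s < t -> Lam s < Lam t.
  by move=> s0 st; apply: hLam_mono => //; rewrite in_itv/= andbT// (le_trans s0)// ltW.
have TLm s t : 0 <= s -> s <= t -> Theta s / Lam s <= Theta t / Lam t.
  by move=> s0 st; apply: hTL_mono => //; rewrite in_itv/= andbT// (le_trans s0).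
have a1_ge0 : 0 <= a1 by rewrite (le_trans (ltW ha0)).
have a_bnd t : 0 <= t -> 0 <= a t <= a1.
  by move=> /ha_bounds/andP[h ->]; rewrite andbT (le_trans (ltW ha0)).
have sa : symbol Xi m 0 a.
  apply: (is_Cm_symbol hXi_pos ha a1_ge0) => // t /a_bnd/andP[h1 h2].
  by rewrite ger0_norm.
have stab t : 0 <= t -> hint 0 t (fun s => `|a s - ainf|) <= Theta t.
  by move=> t0; apply: hint_le; [exact/ltW/hTheta_pos|exact: hstab].
have [C0 C00 LX] := hLamXi.
have [M M0 tail] : exists2 M : R, 0 <= M & forall s t c g, 0 <= s -> s <= t ->
    0 <= c -> hcont s g -> (forall r, s <= r -> 0 <= g r <= c * Xi r ^- m) ->
    hint s t g <= c * (M * Theta s / Lam s ^+ m).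
  move: hsup; set S := ereal_sup _ => Soo.
  have HS t : 0 <= t -> ((Lam t ^+ m * (Theta t)^-1)%:E *
      \int[lebesgue_measure]_(s in `[t, +oo[) (Xi s ^- m)%:E <= S)%E.
    by move=> t0; apply: ereal_sup_ubound; exists t.
  have c_gt0 t : 0 <= t -> 0 < Lam t ^+ m * (Theta t)^-1.
    by move=> t0; rewrite mulr_gt0 ?invr_gt0 ?exprn_gt0// ?hLam_pos// hTheta_pos.
  have S0 : (0 <= S)%E.
    apply: le_trans (HS 0 (lexx _)); apply: mule_ge0; first by rewrite lee_fin ltW// c_gt0.
    apply: integral_ge0 => x /=; rewrite in_itv/= andbT => x0.
    by rewrite lee_fin invr_ge0 exprn_ge0// ltW// hXi_pos.
  (* The supremum itself is the tail constant: dividing by [Lam s ^+ m / Theta s] turns it into a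
     bound on the integral of Xi^-m from [s] on. *)
  exists (fine S); first exact: fine_ge0.
  move=> s t c g s0 st c0 cg gX.
  apply: integral_tail_bound st c0 cg gX _ => //.
    rewrite divr_ge0 ?exprn_ge0 ?mulr_ge0 ?fine_ge0//.
      exact/ltW/hTheta_pos.
    exact/ltW/hLam_pos.
  rewrite -(@lee_pmul2l _ (Lam s ^+ m * (Theta s)^-1)%:E) ?lte_fin ?c_gt0//.
  apply: le_trans (HS s s0) _; rewrite -EFinM.
  rewrite (_ : _ * _ = fine S); last first.
    by field; rewrite expf_neq0 ?gt_eqF ?hTheta_pos ?hLam_pos.
  by rewrite fineK// ge0_fin_numE.
(* This bounds [xi_norm], since each coordinate [2 * sin] has square at most 4; it is the [X] that
   enters through [weight_absorb]. *)
have X_gt0 : 0 < Num.sqrt (4 * d%:R) :> R by rewrite sqrtr_gt0 mulr_gt0// ltr0n.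
have acont := symbol_hcont sa.
have [N0 [C [N00 C00' HS]]] := scalar_energy_estimate (ltnW hm) ha0 ha_bounds sa hainf
  hTheta_pos Tm hXi_pos hLam_pos hLam_cont Lm hLam_lim TLm C00 LX stab M0 tail X_gt0.
have key u0 u1 u v0 w0 v w t : wave_solution a u0 u1 u -> 0 <= t ->
    is_fourier (u 0) v0 -> is_fourier (dt u 0) w0 -> is_fourier (u t) v ->
    is_fourier (dt u t) w ->
    {ae lebesgueT d, forall y, torus d y -> mode_energy a t y (v y) (w y) <=
      4 * C * weight Theta Lam N0 y * mode_energy a 0 y (v0 y) (w0 y)}.
  move=> hu t0 f1 f2 f3 f4.
  apply: (mode_energy_estimate acont a_bnd hu (ltW C00')
    (W := fun x => expR (2 * x * Theta (Linv Lam (N0 / x)))) _ _ hd t0 f1 f2 f3 f4).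
    by move=> x; exact: expR_ge0.
  by move=> x p q g T x0 xX wv T0; exact: HS.
have C4 : 0 < 4 * C by rewrite mulr_gt0.
have Cpi0 : 0 < (2 * pi) ^+ d :> R by rewrite exprn_gt0// mulr_gt0// pi_gt0.
have total u0 u1 (u : R -> 'rV[int]_d -> R[i]) t : wave_solution a u0 u1 u -> 0 <= t ->
    (energy a u t <= (2 / (2 * pi) ^+ d * (4 * C))%:E * U a Theta Lam N0 u0 u1)%E.
  move=> hu t0; have [ul2 _ _ _ [u00 u10]] := hu.
  have [lu lv] := ul2 t t0; have [l0 l1] := ul2 0 (lexx _).
  have fu := fourierP lu; have fv := fourierP lv.
  have f0 := fourierP l0; have f1 := fourierP l1.
  have [m1 _] := (is_fourierP _ _).1 fu; have [m2 _] := (is_fourierP _ _).1 fv.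
  have [m3 _] := (is_fourierP _ _).1 f0; have [m4 _] := (is_fourierP _ _).1 f1.
  have mw : measurable_fun (torus d) (fun y : d.-tuple R => weight Theta Lam N0 y).
    apply: measurable_weight => //; first exact: Linv_ge0.
    by move=> r s; exact: Linv_le.
  have mU : measurable_fun (torus d)
      (fun y => (weight Theta Lam N0 y * mode_energy a 0 y (fourier (u 0) y) (fourier (dt u 0) y))%:E).
    by apply/measurable_EFinP; apply: measurable_funM => //; exact: measurable_mode_energy.
  apply: le_trans (energy_le_mode_energy a lu fu fv) _.
  rewrite (EFinM _ (4 * C)) -[leRHS]muleA lee_wpmul2l ?lee_fin ?divr_ge0 ?(ltW Cpi0)//.
  rewrite /U -u00 -u10 -ge0_integralZl//; first last.
  - by rewrite lee_fin ltW.
  - by move=> y _; rewrite lee_fin mulr_ge0 ?expR_ge0// mode_energy_ge0.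
  - exact: measurable_torus.
  apply: ae_ge0_le_integral.
  - exact: measurable_torus.
  - by move=> y _; rewrite lee_fin mode_energy_ge0.
  - by apply/measurable_EFinP; exact: measurable_mode_energy.
  - move=> y _; rewrite mule_ge0 ?lee_fin ?(ltW C4)// mulr_ge0 ?expR_ge0//.
    exact: mode_energy_ge0.
  - by apply: emeasurable_funM => //; exact: measurable_cst.
  have := key _ _ _ _ _ _ _ _ hu t0 f0 f1 fu fv; apply: filterS => y Hy ty.
  by rewrite -EFinM lee_fin mulrA; exact: Hy.
have Ctot : 0 < 2 / (2 * pi) ^+ d * (4 * C) by rewrite mulr_gt0// divr_gt0.
split.
- exists N0, (4 * C); split=> // u0 u1 u uh hu fuh t t0.
  have [ul2 ucont uder _ _] := hu; have [fe _] := fuh.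
  have [_ lv] := ul2 t t0; have [_ l1] := ul2 0 (lexx _).
  have du r k : 0 <= r -> chderivable (u^~ k) r by move=> r0; have [] := uder r k r0.
  have cu r : 0 <= r -> l2_continuous_at (dt u) r by move=> r0; have [] := ucont r r0.
  (* At the times [t] and 0 the derivative of [uh] is replaced by the transform of [dt u], to which
     [key] applies. *)
  have ht := fourier_derivative_ae du cu fuh t0 (fourierP lv).
  have h0 := fourier_derivative_ae du cu fuh (lexx 0) (fourierP l1).
  have hk := key _ _ _ _ _ _ _ _ hu t0 (fe 0 (lexx _)) (fourierP l1) (fe t t0) (fourierP lv).
  apply: filterS3 ht h0 hk => y ht h0 hk ty.
  by rewrite /energy_density ht// h0//; exact: hk.
- move=> u0 u1 u hu _; exists N0, (2 / (2 * pi) ^+ d * (4 * C)); split=> // t t0.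
  exact: total.
- exists N0, (2 / (2 * pi) ^+ d * (4 * C)); split=> // u0 u1 u hu _ t t0.
  exact: total.
Qed.
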